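(* (Convergence) Let $T>0$ and let $s\ge1$ be an integer. Let $u$ be the solution on $[0,2\pi]\times[0,T]$ of $$\frac{\partial u}{\partial\tau}=A\frac{\partial^2u}{\partial x^2}+B\frac{\partial u}{\partial x}+C\Big(\frac{\partial u}{\partial x}\Big)^2,\quad u(0,\tau)=u(2\pi,\tau),\ u_x(0,\tau)=u_x(2\pi,\tau),\quad u(x,0)=u_0(x).$$ Suppose that $u(\tau)$ and $u_\tau(\tau)$ are respectively functions in $H^{s+2}_p$ and $H^s_p$, continuous with respect to $\tau\in[0,T]$. Let $u^N(\tau)\in S_N$ be the approximation obtained by the collocation method, i.e. for all $j=0,\dots,2N-1$, $$\frac{\partial u^N}{\partial\tau}(x_j,\tau)=A\frac{\partial^2u^N}{\partial x^2}(x_j,\tau)+B\frac{\partial u^N}{\partial x}(x_j,\tau)+C\Big(\frac{\partial u^N}{\partial x}(x_j,\tau)\Big)^2,\qquad u^N(x_j,0)=u_0(x_j).$$ Then there exist a constant $$M=M\Big(\max_{0\le\tau\le T}\Big\{\Big\|\frac{\partial^{s+1}u}{\partial x^{s+1}}\Big\|,\Big\|\frac{\partial^{s+2}u}{\partial x^{s+2}}\Big\|,\Big\|\frac{\partial^su_\tau}{\partial x^s}\Big\|\Big\}\Big)$$ and $N_0\in\mathbb N$ such that for all $N\ge N_0$ $$\max_{0\le\tau\le T}\|u(\tau)-u^N(\tau)\|\le MN^{-s}.$$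
   Context: For $N\in\mathbb N$ ($N\ge1$), $S_N=\mathrm{span}\{e^{ikx}:-N\le k\le N-1\}$, with nodes $x_j=j\pi/N$, $j=0,\dots,2N-1$. $\|\cdot\|$ is the $L^2(0,2\pi)$ norm (complex-valued functions). $H^s_p=H^s_p(0,2\pi)$ is the space of $v\in L^2(0,2\pi)$ such that for $0\le k\le s$ the derivative $d^kv/dx^k$ in the sense of periodic distributions belongs to $L^2(0,2\pi)$. $u(\tau)$ denotes $u(\cdot,\tau)$. The constants are $A=C=\kappa^2\frac{\sigma^2}2>0$ and $B=\kappa\left(\alpha-\frac{\sigma^2}2\right)$, with $\kappa=\frac{2\pi}{4\hat x_{\max}-4\hat x_{\min}}$, where $\alpha\in\mathbb R$, $\sigma>0$ and $\hat x_{\min}<\hat x_{\max}$ are fixed reals. Constants may depend also on the fixed data $T,A,B,C,s$, but $M$ does not depend on $N$. It is a standing assumption that $u_0$ has the same regularity as required of $u$. *)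

(* Defs.v *)
From HB Require Import structures.
From mathcomp Require Import all_boot all_order all_algebra.
From mathcomp Require Import all_classical all_reals all_analysis.
From mathcomp Require Import complex.
Import Order.TTheory GRing.Theory Num.Theory.
Import numFieldNormedType.Exports.

Set Implicit Arguments.
Unset Strict Implicit.
Unset Printing Implicit Defensive.

Local Open Scope classical_set_scope.
Local Open Scope ring_scope.
Local Open Scope complex_scope.

(* Functions of [x] have type [R -> R[i]], and only their values on
   [[0, 2 * pi]] matter; functions of [(x, t)] are curried with time first, so
   that [u t] is the function u(., t). *)

(* [Num.Theory] also exports projections Re and Im, valued in R[i]. *)
Local Notation Re := complex.Re.
Local Notation Im := complex.Im.

Section FunctionSpaces.
Context {R : realType}.
Implicit Types (v w phi : R -> R[i]) (s k : nat).

Definition period : set R := `[0, 2 * pi].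

Definition cintegral (v : R -> R[i]) : R[i] :=
  (\int[lebesgue_measure]_(x in period) Re (v x))
  +i* (\int[lebesgue_measure]_(x in period) Im (v x)).

(* The L^2(0, 2 pi) norm, with value +oo outside L^2. *)
Definition L2norm (v : R -> R[i]) : \bar R :=
  ((\int[lebesgue_measure]_(x in period)
      ((Re (v x)) ^+ 2 + (Im (v x)) ^+ 2)%:E) `^ (2^-1))%E.

Definition inL2 (v : R -> R[i]) : Prop :=
  [/\ measurable_fun period (fun x => Re (v x)),
      measurable_fun period (fun x => Im (v x)) &
      (L2norm v < +oo)%E].

Definition smooth (f : R -> R) : Prop :=
  forall (k : nat) (x : R), derivable (derive1n k f) x 1.

(* Test functions for periodic distributions: elements of C^oo_p(0, 2 pi),
   identified with their smooth 2 pi-periodic extensions to the real line. *)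
Definition test_function (phi : R -> R[i]) : Prop :=
  [/\ smooth (fun x => Re (phi x)), smooth (fun x => Im (phi x)) &
      forall x, phi (x + 2 * pi) = phi x].

Definition cderiv (k : nat) (phi : R -> R[i]) : R -> R[i] :=
  fun x => (derive1n k (fun y => Re (phi y)) x) +i* (derive1n k (fun y => Im (phi y)) x).

Definition is_pderiv (k : nat) (v w : R -> R[i]) : Prop :=
  inL2 w /\
  forall phi, test_function phi ->
    cintegral (fun x => v x * cderiv k phi x) =
    (- 1) ^+ k * cintegral (fun x => w x * phi x).

(* An L^2 representative, unique almost everywhere, of the k-th derivative of
   [v] in the sense of periodic distributions. The default value 0 is returned
   when that derivative is not in L^2, so that [pderiv k] is meaningful only on
   H^s_p with k <= s. *)
Definition pderiv (k : nat) (v : R -> R[i]) : R -> R[i] :=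
  xget (fun=> 0) [set w | is_pderiv k v w].

Definition inHp (s : nat) (v : R -> R[i]) : Prop :=
  inL2 v /\ forall k, (k <= s)%N -> exists w, is_pderiv k v w.

Definition Hnorm (s : nat) (v : R -> R[i]) : \bar R :=
  ((\sum_(k < s.+1) (L2norm (pderiv k v)) ^+ 2) `^ (2^-1))%E.

(* [v] belongs to C([0, T]; H^s_p). *)
Definition continuous_Hp (T : R) (s : nat) (v : R -> R -> R[i]) : Prop :=
  (forall t, t \in `[0, T] -> inHp s (v t)) /\
  (forall t0, t0 \in `[0, T] ->
     Hnorm s (fun x => v t x - v t0 x) @[t --> within `[0, T] (nbhs t0)]
       --> 0%E).

End FunctionSpaces.

Section Equation.
Context {R : realType}.

(* [l] is the derivative at [x] of the restriction of [f] to [[a, b]], hence a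
   one-sided derivative at the end points. *)
Definition is_derive_on (a b : R) (f : R -> R[i]) (x : R) (l : R[i]) : Prop :=
  ((Re (f y) - Re (f x)) / (y - x)) @[y --> within `[a, b] (x^')] --> Re l /\
  ((Im (f y) - Im (f x)) / (y - x)) @[y --> within `[a, b] (x^')] --> Im l.

(* [ux] and [uxx] are the first two space derivatives of [u] on
   [[0, 2 pi] x [0, T]]. *)
Definition space_derivatives (T : R) (u ux uxx : R -> R -> R[i]) : Prop :=
  forall t x, t \in `[0, T] -> x \in `[0, 2 * pi] ->
    is_derive_on 0 (2 * pi) (u t) x (ux t x) /\
    is_derive_on 0 (2 * pi) (ux t) x (uxx t x).

Definition time_derivative_at (T : R) (u ut : R -> R -> R[i]) (x : R) : Prop :=
  forall t, t \in `[0, T] -> is_derive_on 0 T (fun t' => u t' x) t (ut t x).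

Definition pde_at (A B C : R) (ut ux uxx : R -> R -> R[i]) (t x : R) : Prop :=
  ut t x = A%:C * uxx t x + B%:C * ux t x + C%:C * (ux t x) ^+ 2.

Definition is_solution (A B C T : R) (u0 : R -> R[i])
    (u ut ux uxx : R -> R -> R[i]) : Prop :=
  [/\ space_derivatives T u ux uxx,
      forall x, x \in `[0, 2 * pi] -> time_derivative_at T u ut x,
      forall t x, t \in `[0, T] -> x \in `[0, 2 * pi] ->
        pde_at A B C ut ux uxx t x,
      forall t, t \in `[0, T] ->
        u t 0 = u t (2 * pi) /\ ux t 0 = ux t (2 * pi) &
      forall x, x \in `[0, 2 * pi] -> u 0 x = u0 x].

Definition expi (y : R) : R[i] := cos y +i* sin y.

(* Membership in S_N; the index j stands for the frequency j - N. *)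
Definition inSN (N : nat) (v : R -> R[i]) : Prop :=
  exists c : 'I_(2 * N) -> R[i], forall x, x \in `[0, 2 * pi] ->
    v x = \sum_(j < 2 * N) c j * expi ((j%:R - N%:R) * x).

Definition node (N : nat) (j : 'I_(2 * N)) : R := j%:R * pi / N%:R.

Definition is_collocation (A B C T : R) (u0 : R -> R[i]) (N : nat)
    (uN uNt uNx uNxx : R -> R -> R[i]) : Prop :=
  [/\ forall t, t \in `[0, T] -> inSN N (uN t),
      space_derivatives T uN uNx uNxx,
      forall j : 'I_(2 * N), time_derivative_at T uN uNt (node j),
      forall t (j : 'I_(2 * N)), t \in `[0, T] ->
        pde_at A B C uNt uNx uNxx t (node j) &
      forall j : 'I_(2 * N), uN 0 (node j) = u0 (node j)].

Definition kappa (xmin xmax : R) : R := 2 * pi / (4 * xmax - 4 * xmin).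

(* The value of both A and C. *)
Definition diffusion_coef (sigma xmin xmax : R) : R :=
  (kappa xmin xmax) ^+ 2 * (sigma ^+ 2 / 2).

Definition drift_coef (alpha sigma xmin xmax : R) : R :=
  kappa xmin xmax * (alpha - sigma ^+ 2 / 2).

(* The supremum over [0, T], which is a maximum when [u] and [ut] are in
   C([0, T]; H^(s+2)_p) and C([0, T]; H^s_p). *)
Definition max_regularity (T : R) (s : nat) (u ut : R -> R -> R[i]) : \bar R :=
  ereal_sup [set maxe (L2norm (pderiv s.+1 (u t)))
                   (maxe (L2norm (pderiv s.+2 (u t)))
                         (L2norm (pderiv s (ut t)))) | t in `[0, T]].

Definition max_error (T : R) (u uN : R -> R -> R[i]) : \bar R :=
  ereal_sup [set L2norm (fun x => u t x - uN t x) | t in `[0, T]].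

End Equation.

(* Main.v *)
(** Let [e] be the trigonometric interpolant of the error [uN - u] at the nodes.
    There the error is the exact value of the difference of two trigonometric
    series, so that replacing its derivatives by those of [e] only costs aliasing
    terms, of size [N^-s] in the discrete norm, which coincides with the L^2 norm
    on [S_N]. Taking the discrete inner product of the equation of the error with
    [e], the diffusion produces [- A |e_x|^2], and the square of [e_x] in the
    nonlinear term is absorbed by it as long as [|e| <= 1/8] at the nodes: no
    bound on [e_x] itself is needed. Gronwall's inequality then gives
    [|e| <= const N^-s], whose maximum norm is at most [const N^(1/2 - s)], so
    that for large [N] the condition [|e| <= 1/8] propagates up to time [T].

    The Fourier series of [u], [u_x] and [u_xx] converge pointwise by Chernoff's
    telescoping argument and by termwise differentiation, and their coefficients
    are controlled by Bessel's inequality for the weak derivative of order [s + 2]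
    of [u]. That the maximum defining the constant is finite rests on the
    uniqueness of Fourier coefficients in L^2: Chernoff's argument applies to
    periodic Lipschitz functions, hence to tents, which approximate the
    indicators of intervals. *)
Require Import Defs.
From mathcomp Require Import all_boot all_order all_algebra.
From mathcomp Require Import all_classical all_reals all_analysis.
From mathcomp Require Import measurable_realfun.
From mathcomp Require Import complex.
From mathcomp Require Import ring lra zify.
Import Order.TTheory GRing.Theory Num.Theory.
Import numFieldNormedType.Exports.
Set Implicit Arguments.
Unset Strict Implicit.
Unset Printing Implicit Defensive.
Local Open Scope classical_set_scope.
Local Open Scope ring_scope.
Local Open Scope complex_scope.
Local Notation Re := complex.Re.
Local Notation Im := complex.Im.

(** * Complex numbers, Cauchy-Schwarz and exponentials *)

(** The collocation solution comes with no Sobolev bound, so none may enter the estimate. The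
    Fourier coefficients of the error are those of [uN], supported in the band [-N, N - 1], minus
    those of [u]: outside the band only [u] contributes, and every aliasing term involves
    frequencies outside the band only. All perturbations are thus controlled by the tail of the sum
    of [sobolev_weight], whatever [uN] is.

    Differentiating the interpolant multiplies a folded coefficient by the frequency of its class in
    the band, whereas the exact derivative multiplies each alias by its own frequency; the
    discrepancies are [sg] for the first derivative and [rh] for the second one. A window of N (2 L
    + 1) levels contains each class modulo 2 N exactly 2 L + 1 times, which makes these identities
    exact on partial sums, before L tends to infinity.

    The derivatives of [u] are given both in the weak sense and in the classical one-sided sense:
    the equation at the nodes uses the classical ones, the constant uses the weak ones, and the
    Fourier coefficients link the two. *)

Section SquaredModulus.
Context {R : realType}.
Implicit Types (z w : R[i]).

(* [|z|^2] with values in [R], whereas [`|z|] lives in [R[i]]. *)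
Definition nsq z : R := Re z ^+ 2 + Im z ^+ 2.

Lemma cReD z w : Re (z + w) = Re z + Re w. Proof. by case: z; case: w. Qed.
Lemma cImD z w : Im (z + w) = Im z + Im w. Proof. by case: z; case: w. Qed.
Lemma cReN z : Re (- z) = - Re z. Proof. by case: z. Qed.
Lemma cImN z : Im (- z) = - Im z. Proof. by case: z. Qed.
Lemma cReM z w : Re (z * w) = Re z * Re w - Im z * Im w.
Proof. by case: z; case: w. Qed.
Lemma cImM z w : Im (z * w) = Re z * Im w + Im z * Re w.
Proof. by case: z; case: w. Qed.
Lemma cRe_conj z : Re (conjc z) = Re z. Proof. by case: z. Qed.
Lemma cIm_conj z : Im (conjc z) = - Im z. Proof. by case: z. Qed.
Lemma Re_real (a : R) : Re a%:C = a. Proof. by []. Qed.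
Lemma Im_real (a : R) : Im a%:C = 0. Proof. by []. Qed.

Lemma Re_mk (a b : R) : Re (a +i* b) = a. Proof. by []. Qed.
Lemma Im_mk (a b : R) : Im (a +i* b) = b. Proof. by []. Qed.

Definition ReImE := (Re_mk, Im_mk, cReD, cImD, cReN, cImN, cReM, cImM, cRe_conj, cIm_conj, Re_real, Im_real).

Lemma complexP z w : Re z = Re w -> Im z = Im w -> z = w.
Proof. by case: z => a b; case: w => c d /= -> ->. Qed.

Lemma cRe_sum (I : Type) (r : seq I) (P : pred I) (F : I -> R[i]) :
  Re (\sum_(i <- r | P i) F i) = \sum_(i <- r | P i) Re (F i).
Proof. by apply: (big_morph (@complex.Re R)) => // ? ?; rewrite cReD. Qed.

Lemma cIm_sum (I : Type) (r : seq I) (P : pred I) (F : I -> R[i]) :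
  Im (\sum_(i <- r | P i) F i) = \sum_(i <- r | P i) Im (F i).
Proof. by apply: (big_morph (@complex.Im R)) => // ? ?; rewrite cImD. Qed.

Lemma nsq_ge0 z : 0 <= nsq z.
Proof. by rewrite addr_ge0// sqr_ge0. Qed.
#[local] Hint Extern 0 (is_true (0 <= nsq _)) => solve [apply: nsq_ge0] : core.

Lemma nsqM z w : nsq (z * w) = nsq z * nsq w.
Proof. by rewrite /nsq !ReImE; ring. Qed.

Lemma nsqN z : nsq (- z) = nsq z.
Proof. by rewrite /nsq !ReImE; ring. Qed.

Lemma nsqJ z : nsq (conjc z) = nsq z.
Proof. by rewrite /nsq !ReImE; ring. Qed.

Lemma nsq0 : nsq 0 = 0.
Proof. by rewrite /nsq /= expr0n /= addr0. Qed.

Lemma nsq_real (a : R) : nsq a%:C = a ^+ 2.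
Proof. by rewrite /nsq /= expr0n /= addr0. Qed.

Lemma mulcJ z : z * conjc z = (nsq z)%:C.
Proof. by apply: complexP; rewrite !ReImE /nsq; ring. Qed.

Lemma nsq_eq0 z : nsq z = 0 -> z = 0.
Proof.
rewrite /nsq => /eqP; rewrite paddr_eq0 ?sqr_ge0// !sqrf_eq0 => /andP[/eqP h1 /eqP h2].
exact: complexP.
Qed.

Lemma le_nsqD z w : nsq (z + w) <= 2 * nsq z + 2 * nsq w.
Proof.
rewrite /nsq !ReImE; have := sqr_ge0 (Re z - Re w); have := sqr_ge0 (Im z - Im w).
nra.
Qed.

Lemma Re_sqr_le z : Re z ^+ 2 <= nsq z.
Proof. by rewrite /nsq lerDl sqr_ge0. Qed.

Lemma Im_sqr_le z : Im z ^+ 2 <= nsq z.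
Proof. by rewrite /nsq lerDr sqr_ge0. Qed.

(** Young's inequality: the difference of the two sides is |e z - w|^2 / e. *)
Lemma Re_mulJ_le z w (e : R) : 0 < e ->
  2 * Re (z * conjc w) <= e * nsq z + e^-1 * nsq w.
Proof.
move=> e0; have e1 : e * e^-1 = 1 by rewrite mulfV ?gt_eqF.
rewrite !ReImE /nsq -subr_ge0.
have -> : e * (Re z ^+ 2 + Im z ^+ 2) + e^-1 * (Re w ^+ 2 + Im w ^+ 2) -
    2 * (Re z * Re w - Im z * - Im w) =
    e^-1 * ((e * Re z - Re w) ^+ 2 + (e * Im z - Im w) ^+ 2).
  by field; rewrite gt_eqF.
by apply: mulr_ge0; [rewrite invr_ge0 ltW|apply: addr_ge0; exact: sqr_ge0].
Qed.

End SquaredModulus.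
#[local] Hint Extern 0 (is_true (0 <= nsq _)) => solve [apply: nsq_ge0] : core.

Section CauchySchwarz.
Context {R : realType} {I : Type}.

Lemma Cauchy_Schwarz_sum (r : seq I) (P : pred I) (a x : I -> R) :
  (\sum_(i <- r | P i) a i * x i) ^+ 2 <=
  (\sum_(i <- r | P i) a i ^+ 2) * (\sum_(i <- r | P i) x i ^+ 2).
Proof.
set S := \sum_(i <- r | P i) a i * x i.
set A := \sum_(i <- r | P i) a i ^+ 2; set X := \sum_(i <- r | P i) x i ^+ 2.
have key t : 0 <= X - 2 * t * S + t ^+ 2 * A.
  rewrite (_ : _ + _ = \sum_(i <- r | P i) (x i - t * a i) ^+ 2).
    by apply: sumr_ge0 => i _; exact: sqr_ge0.
  rewrite /X /S /A !mulr_sumr -sumrN -!big_split /=.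
  by apply: eq_bigr => i _; ring.
have A0 : 0 <= A by apply: sumr_ge0 => i _; exact: sqr_ge0.
have X0 : 0 <= X by apply: sumr_ge0 => i _; exact: sqr_ge0.
have [A00|AN0] := eqVneq A 0.
  rewrite A00 mul0r.
  have [->|SN0] := eqVneq S 0; first by rewrite expr0n.
  (* Without quadratic term, [key] is affine in t; this t makes it equal to -1. *)
  have := key ((X + 1) / (2 * S)); rewrite A00 mulr0 addr0.
  have -> : X - 2 * ((X + 1) / (2 * S)) * S = - 1 by field.
  by rewrite lerNr oppr0 ler10.
have Agt : 0 < A by rewrite lt_def AN0.
have := key (S / A).
have -> : X - 2 * (S / A) * S + (S / A) ^+ 2 * A = X - S ^+ 2 / A by field.
by rewrite subr_ge0 ler_pdivrMr// mulrC.
Qed.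

Lemma nsq_sum_le (r : seq I) (P : pred I) (a : I -> R) (z : I -> R[i]) :
  nsq (\sum_(i <- r | P i) (a i)%:C * z i) <=
  (\sum_(i <- r | P i) a i ^+ 2) * (\sum_(i <- r | P i) nsq (z i)).
Proof.
rewrite [leLHS]/nsq cRe_sum cIm_sum.
under eq_bigr do rewrite cReM Re_real Im_real mul0r subr0.
under [X in _ + X ^+ 2]eq_bigr do rewrite cImM Re_real Im_real mul0r addr0.
rewrite /nsq big_split /= mulrDr; apply: lerD; exact: Cauchy_Schwarz_sum.
Qed.

End CauchySchwarz.

Section Expi.
Context {R : realType}.
Implicit Types (x y : R).

Lemma expiD x y : expi (x + y) = expi x * expi y.
Proof. by apply: complexP; rewrite !ReImE /= ?cosD ?sinD; ring. Qed.

Lemma expi0 : expi (0 : R) = 1.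
Proof. by rewrite /expi cos0 sin0. Qed.

Lemma conj_expi x : conjc (expi x) = expi (- x).
Proof. by rewrite /expi cosN sinN. Qed.

Lemma nsq_expi x : nsq (expi x) = 1.
Proof. by rewrite /nsq /= cos2Dsin2. Qed.

Lemma expi_neq0 x : expi x != 0.
Proof.
by apply/eqP => h; have := nsq_expi x; rewrite h nsq0 => /esym/eqP; rewrite oner_eq0.
Qed.

Lemma expiN x : expi (- x) = (expi x)^-1.
Proof.
apply: (mulfI (expi_neq0 x)).
by rewrite -expiD subrr expi0 mulfV// expi_neq0.
Qed.

Lemma expi_2pi : expi (2 * pi : R) = 1.
Proof. by rewrite /expi mulr_natl cos2pi sin2pi. Qed.

Lemma expiX x n : expi x ^+ n = expi (n%:R * x).
Proof.
elim: n => [|n IH]; first by rewrite expr0 mul0r expi0.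
by rewrite exprS IH -expiD -natr1 mulrDl mul1r addrC.
Qed.

Lemma expi_int_2pi (k : int) : expi (k%:~R * (2 * pi : R)) = 1.
Proof.
have nat (n : nat) : expi (n%:R * (2 * pi : R)) = 1 by rewrite -expiX expi_2pi expr1n.
case: k => n; first exact: nat.
by rewrite NegzE mulrNz mulNr expiN nat invr1.
Qed.

Lemma abs_sin_le x : `|sin x| <= `|x|.
Proof.
wlog x0 : x / 0 <= x.
  move=> h; have [|/ltW x0] := leP 0 x; first exact: h.
  by rewrite -normrN -sinN -(normrN x); apply: h; rewrite oppr_ge0.
move: x0; rewrite le_eqVlt => /predU1P[<-|x0]; first by rewrite sin0.
have [|c _] := @MVT R sin cos 0 x x0 (fun y _ => is_derive_sin y).
  by apply: continuous_subspaceT => y; exact: continuous_sin.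
rewrite sin0 !subr0 => ->; rewrite normrM ler_piMl//; exact: cos_max.
Qed.

Lemma one_sub_cos x : 1 - cos x = 2 * sin (x / 2) ^+ 2.
Proof.
rewrite [in cos x](_ : x = (x / 2) *+ 2); last by rewrite -mulr_natr divfK.
by rewrite cos_mulr2n cos2sin2; ring.
Qed.

Lemma nsq_expiB1 x : nsq (expi x - 1) = 4 * sin (x / 2) ^+ 2.
Proof.
have -> : nsq (expi x - 1) = 2 * (1 - cos x).
  rewrite /nsq !ReImE /=; have := cos2Dsin2 x; lra.
by rewrite one_sub_cos; ring.
Qed.

Lemma nsq_expiB_le x y : nsq (expi y - expi x) <= (y - x) ^+ 2.
Proof.
have -> : expi y - expi x = expi x * (expi (y - x) - 1).
  by rewrite mulrBr mulr1 -expiD subrKC.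
rewrite nsqM nsq_expi mul1r nsq_expiB1.
have : `|sin ((y - x) / 2)| ^+ 2 <= `|(y - x) / 2| ^+ 2.
  by rewrite lerXn2r ?nnegrE// abs_sin_le.
rewrite !real_normK ?num_real// => h.
rewrite (_ : (y - x) ^+ 2 = 4 * ((y - x) / 2) ^+ 2); first by rewrite ler_pM2l.
by field.
Qed.

End Expi.

(** * Frequencies and the discrete Fourier transform *)

Section Frequencies.

(* The frequencies [k] with [n <= k < m] or [- m <= k < - n]. *)
Definition tail_freqs (n m : nat) : seq int :=
  flatten [seq [:: - (j.+1)%:Z; j%:Z] | j <- index_iota n m].

Definition freqs (n : nat) : seq int := tail_freqs 0 n.

Lemma big_tail_freqs (V : nmodType) n m (F : int -> V) :
  \sum_(k <- tail_freqs n m) F k = \sum_(n <= j < m) (F (- (j.+1)%:Z) + F j%:Z).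
Proof.
rewrite /tail_freqs big_flatten /= big_map; apply: eq_bigr => j _.
by rewrite !big_cons big_nil addr0.
Qed.

Lemma big_freqs_cat (V : nmodType) n m (F : int -> V) : (n <= m)%N ->
  \sum_(k <- freqs m) F k = \sum_(k <- freqs n) F k + \sum_(k <- tail_freqs n m) F k.
Proof. by move=> nm; rewrite !big_tail_freqs -big_cat_nat. Qed.

Lemma big_freqsS (V : nmodType) n (F : int -> V) :
  \sum_(k <- freqs n.+1) F k = \sum_(k <- freqs n) F k + (F (- (n.+1)%:Z) + F n%:Z).
Proof. by rewrite (big_freqs_cat _ (leqnSn n)) (big_tail_freqs n) big_nat1. Qed.

Lemma big_freqs0 (V : nmodType) (F : int -> V) : \sum_(k <- freqs 0) F k = 0.
Proof. by rewrite big_tail_freqs big_geq. Qed.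

Lemma mem_tail_freqs n m k : k \in tail_freqs n m -> (n <= `|k|)%N.
Proof.
case/flattenP => s /mapP[j]; rewrite mem_index_iota => /andP[nj _] ->.
by rewrite !inE => /orP[]/eqP ->; lia.
Qed.

Lemma big_freqs (V : nmodType) n (F : int -> V) :
  \sum_(k <- freqs n) F k = \sum_(j < n.*2) F (j%:Z - n%:Z).
Proof.
rewrite -(big_mkord xpredT (fun j => F (j%:Z - n%:Z))).
elim: n => [|n IH]; first by rewrite big_freqs0 big_geq.
rewrite big_freqsS IH doubleS big_nat_recl// big_nat_recr//=.
rewrite addrA (addrC (F _) (\sum_(_ <= _ < _) _)) -addrA; congr (_ + _).
  apply: eq_bigr => j _; congr F; lia.
by rewrite addrC [RHS]addrC; congr (_ + _); congr F; lia.
Qed.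

(* Frequencies [k] in the window of [N (2 L + 1)] are grouped according to
   their residue modulo [2 N], on which the value of [e^{ikx}] at a node only
   depends. *)
Lemma big_freqs_aliases (V : nmodType) N L (F : int -> V) :
  \sum_(k <- freqs (N * (2 * L).+1)) F k =
  \sum_(m < 2 * N) \sum_(q < (2 * L).+1)
     F (m%:Z - N%:Z + (2 * N)%:Z * (q%:Z - L%:Z)).
Proof.
rewrite big_freqs exchange_big /=.
rewrite -(big_mkord xpredT (fun j => F (j%:Z - (N * (2 * L).+1)%:Z))).
have gen b (G : nat -> V) : \sum_(0 <= j < 2 * N * b) G j =
    \sum_(q < b) \sum_(m < 2 * N) G (2 * N * q + m)%N.
  elim: b => [|b IH]; first by rewrite muln0 big_geq// big_ord0.
  rewrite big_ord_recr /= -IH mulnS addnC (@big_cat_nat _ _ _ (2 * N * b))//=.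
    by congr (_ + _); rewrite -{1}[(2 * N * b)%N]add0n big_addn addKn
      big_mkord; apply: eq_bigr => m _; rewrite addnC.
  by rewrite leq_addr.
rewrite (_ : (N * (2 * L).+1).*2 = 2 * N * (2 * L).+1)%N; last by rewrite -mul2n mulnA.
rewrite gen; apply: eq_bigr => q _; apply: eq_bigr => m _; congr F; lia.
Qed.

Context {R : realType}.

(** The two frequencies of level j contribute at most 2 / j^2 <= 2 / (j^2 - 1/4) = 2 / (j - 1/2) - 2
    / (j + 1/2), which telescopes. *)
Lemma sum_tail_invsq n m : (0 < n)%N ->
  \sum_(k <- tail_freqs n m) ((k%:~R : R)^-1) ^+ 2 <= 4 / n%:R.
Proof.
move=> n0; have [nm|mn] := leqP n m; last first.
  by rewrite big_tail_freqs big_geq ?divr_ge0 ?ler0n// ltnW.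
suff : \sum_(k <- tail_freqs n m) ((k%:~R : R)^-1) ^+ 2 <= 4 / n%:R - 2 / m%:R.
  by move/le_trans; apply; rewrite gerBl divr_ge0 ?ler0n.
have step j : (0 < j)%N ->
   (((- (j.+1)%:Z)%:~R : R)^-1) ^+ 2 + ((j%:Z%:~R : R)^-1) ^+ 2
      <= 2 / (j%:R - 2^-1) - 2 / (j.+1%:R - 2^-1).
  move=> j0; have jR : 1 <= j%:R :> R by rewrite ler1n.
  rewrite mulrNz invrN sqrrN -!pmulrn -[j.+1%:R]natr1 !exprVn.
  have -> : 2 / (j%:R - 2^-1) - 2 / (j%:R + 1 - 2^-1) =
            (2 : R) / (j%:R ^+ 2 - 4^-1).
    field; apply/and3P; split; rewrite ?gt_eqF//; nra.
  apply: (@le_trans _ _ (2 / j%:R ^+ 2)).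
    rewrite mulr_natl mulr2n lerD2r lef_pV2 ?posrE ?exprn_gt0//; nra.
  rewrite ler_pM2l// lef_pV2 ?posrE; nra.
rewrite big_tail_freqs.
apply: (@le_trans _ _ (\sum_(n <= j < m) (2 / (j%:R - 2^-1) - 2 / (j.+1%:R - 2^-1)))).
  rewrite big_nat_cond [leRHS]big_nat_cond; apply: ler_sum => j.
  by rewrite andbT => /andP[nj _]; apply: step; exact: leq_trans nj.
rewrite (telescope_sumr_eq (fun j => - (2 / (j%:R - 2^-1))))//; last first.
  by move=> j _; rewrite opprK addrC.
have nR : 1 <= n%:R :> R by rewrite ler1n.
have mR : 1 <= m%:R :> R by rewrite ler1n (leq_trans n0).
rewrite opprK addrC; apply: lerB.
  rewrite ler_pdivrMr; last lra.
  have -> : 4 / n%:R * (n%:R - 2^-1) = 4 - 2 / n%:R :> R by field; rewrite gt_eqF//; lra.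
  suff : 2 / n%:R <= 2 :> R by lra.
  by rewrite ler_pdivrMr; lra.
by rewrite ler_pM2l// lef_pV2 ?posrE; lra.
Qed.

(* The frequency 0 does not contribute, since [0^-1 = 0]. *)
Lemma sum_freqs_invsq n :
  \sum_(k <- freqs n) ((k%:~R : R)^-1) ^+ 2 <= 5.
Proof.
case: n => [|n]; first by rewrite big_freqs0.
(* Level 0 consists of the frequencies -1 and 0 and contributes 1; the levels from 1 on contribute
   at most 4. *)
rewrite (@big_freqs_cat _ 1)//.
have := @sum_tail_invsq 1 n.+1 isT; rewrite divr1.
rewrite big_freqsS big_freqs0 mulrNz !invrN !sqrrN invr1 mulr0z invr0 expr1n expr0n/=; lra.
Qed.

End Frequencies.

Section DiscreteFourier.
Context {R : realType} (N : nat).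
Hypothesis N0 : (0 < N)%N.

Let e (m j : 'I_(2 * N)) : R[i] := expi ((m%:R - N%:R) * node j).

Lemma node_bounds (j : 'I_(2 * N)) : (node j : R) \in `[0, 2 * pi].
Proof.
rewrite in_itv /= /node divr_ge0 ?mulr_ge0 ?ler0n ?pi_ge0//=.
rewrite ler_pdivrMr ?ltr0n// mulrAC ler_wpM2r ?pi_ge0//.
by rewrite -natrM ler_nat ltnW.
Qed.

Lemma expi_node_alias (k l : int) (j : 'I_(2 * N)) :
  expi ((k + (2 * N)%:Z * l)%:~R * (node j : R)) = expi (k%:~R * node j).
Proof.
rewrite rmorphD /= mulrDl expiD.
suff -> : expi (((2 * N)%:Z * l)%:~R * (node j : R)) = 1 by rewrite mulr1.
rewrite -[RHS](@expi_int_2pi R (l * (val j)%:Z)); congr expi.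
rewrite /node !intrM -!pmulrn natrM; field.
by rewrite pnatr_eq0 -lt0n.
Qed.

(** A geometric sum of 2 N terms with ratio [expi t], where t = (m - m') pi / N. As 2 N t is a
    multiple of 2 pi, it vanishes unless the ratio is 1; and t / 2 lies strictly between - pi and
    pi, so that the ratio is 1 only for m = m'. *)
Lemma discrete_orthogonality (m m' : 'I_(2 * N)) :
  \sum_(j < 2 * N) e m j * conjc (e m' j) = if m == m' then (2 * N)%:R else 0.
Proof.
pose t : R := (m%:R - m'%:R) * pi / N%:R.
have NR : (N%:R : R) != 0 by rewrite pnatr_eq0 -lt0n.
rewrite (eq_bigr (fun j : 'I_(2 * N) => expi t ^+ j)); last first.
  move=> j _; rewrite /e conj_expi -expiD expiX; congr expi.
  by rewrite /t /node; field.
case: eqVneq => [mm|mm].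
  rewrite (eq_bigr (fun=> 1)) ?sumr_const ?card_ord// => j _.
  by rewrite /t mm subrr !mul0r expi0 expr1n.
have t1 : expi t - 1 != 0.
  apply/eqP => h; have : nsq (expi t - 1) = 0 by rewrite h nsq0.
  rewrite nsq_expiB1 => /eqP; rewrite mulf_eq0 pnatr_eq0 /= sqrf_eq0 => /eqP {}h.
  have s0 (x : R) : 0 < x < pi -> sin x != 0.
    by move=> ?; rewrite gt_eqF// sin_gt0_pi.
  have pos (a b : 'I_(2 * N)) : (a < b)%N ->
     sin ((b%:R - a%:R) * pi / N%:R / 2 : R) != 0.
    move=> ab; apply: s0.
    have ab' : (a%:R : R) < b%:R by rewrite ltr_nat.
    have b2 : (b%:R : R) < 2 * N%:R by rewrite -natrM ltr_nat.
    have a0 : 0 <= (a%:R : R) by rewrite ler0n.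
    have n0 : 0 < (N%:R : R) by rewrite ltr0n.
    have p0 := pi_gt0 R.
    rewrite !divr_gt0 ?mulr_gt0 ?subr_gt0//=.
    rewrite ltr_pdivrMr// ltr_pdivrMr//; nra.
  case: (ltngtP m m') mm => [lt|lt|/val_inj ->]; last by rewrite eqxx.
    move=> _; have /eqP := pos _ _ lt; apply.
    rewrite (_ : _ / 2 = - (t / 2)) ?sinN ?h ?oppr0//.
    by rewrite /t; field.
  by move=> _; have /eqP := pos _ _ lt.
apply: (mulfI t1); rewrite mulr0 -(big_mkord xpredT (fun j => expi t ^+ j)).
rewrite big_mkord -subrX1 expiX.
rewrite (_ : _ * t = (m%:Z - m'%:Z)%:~R * (2 * pi)) ?expi_int_2pi ?subrr//.
by rewrite /t rmorphB /= -!pmulrn natrM; field.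
Qed.

Lemma discrete_Parseval (a b : 'I_(2 * N) -> R[i]) :
  \sum_(j < 2 * N) (\sum_(m < 2 * N) a m * e m j) *
     conjc (\sum_(m < 2 * N) b m * e m j) =
  (2 * N)%:R * \sum_(m < 2 * N) a m * conjc (b m).
Proof.
transitivity (\sum_(m < 2 * N) \sum_(m' < 2 * N)
   a m * conjc (b m') * \sum_(j < 2 * N) e m j * conjc (e m' j)).
  rewrite exchange_big /=.
  under [RHS]eq_bigr do under eq_bigr do rewrite mulr_sumr.
  under [RHS]eq_bigr do rewrite exchange_big /=.
  rewrite [RHS]exchange_big /=; apply: eq_bigr => j _.
  rewrite rmorph_sum /= mulr_sumr; apply: eq_bigr => m' _.
  rewrite mulr_suml; apply: eq_bigr => m _.
  by rewrite rmorphM /=; ring.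
rewrite mulr_sumr; apply: eq_bigr => m _.
rewrite (bigD1 m)//= [X in _ + X]big1 ?addr0 => [|m' m'm].
  by rewrite discrete_orthogonality eqxx; ring.
by rewrite discrete_orthogonality eq_sym (negPf m'm) mulr0.
Qed.

Lemma discrete_Parseval_nsq (a : 'I_(2 * N) -> R[i]) :
  \sum_(j < 2 * N) nsq (\sum_(m < 2 * N) a m * e m j) =
  (2 * N)%:R * \sum_(m < 2 * N) nsq (a m).
Proof.
apply: complexI; rewrite rmorph_sum rmorphM rmorph_nat rmorph_sum /=.
under eq_bigr do rewrite -mulcJ.
by under [in RHS]eq_bigr do rewrite -mulcJ; rewrite discrete_Parseval.
Qed.

End DiscreteFourier.

(** * Aliasing *)

Section Aliasing.
Context {R : realType} (N L s : nat).
Hypotheses (N0 : (0 < N)%N) (s1 : (1 <= s)%N).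
Variable d : int -> R[i].

Let alias (m : 'I_(2 * N)) (q : 'I_(2 * L).+1) : int :=
  m%:Z - N%:Z + (2 * N)%:Z * (q%:Z - L%:Z).

Let l (q : 'I_(2 * L).+1) : int := q%:Z - L%:Z.

(** The summand of the squared L^2 norm of the derivative of order s + 2, up to the factor 2 pi. The
    two orders beyond s pay for the two space derivatives of the equation. *)
Definition sobolev_weight (k : int) : R := (k%:~R ^+ 2) ^+ s.+2 * nsq (d k).

Lemma sobolev_weight_ge0 k : 0 <= sobolev_weight k.
Proof. by apply: mulr_ge0 => //; apply: exprn_ge0; exact: sqr_ge0. Qed.

Lemma sum_alias_invsq : \sum_(q < (2 * L).+1) ((l q)%:~R^-1 : R) ^+ 2 <= 5.
Proof.
apply: le_trans (@sum_freqs_invsq R L.+1); rewrite big_freqs.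
rewrite (_ : L.+1.*2 = (2 * L).+2)%N; last by rewrite doubleS mul2n.
(* The shifts range over [-L, L]; the additional frequency - (L + 1) of [freqs L.+1] is dropped. *)
rewrite [leRHS]big_ord_recl; apply: ler_wpDl; first exact: sqr_ge0.
by apply: ler_sum => q _; rewrite /l lift0 (_ : q.+1%:Z - _ = q%:Z - L%:Z)//; lia.
Qed.

(** The frequency m - N of the band is at most N in modulus, and a shift by 2 N l with l nonzero
    leaves a modulus of at least 2 N |l| - N >= N |l|. *)
Lemma alias_ge m q : N%:R ^+ 2 * (l q)%:~R ^+ 2 <= ((alias m q)%:~R : R) ^+ 2.
Proof.
rewrite -exprMn -[leLHS]real_normK ?num_real// -[leRHS]real_normK ?num_real//.
rewrite lerXn2r ?nnegrE// (_ : N%:R = N%:Z%:~R :> R)// -intrM.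
rewrite -!intr_norm ler_int /alias -/(l q); have := ltn_ord m; move: (l q) (val m) => i n.
move=> mN; have -> : (2 * N)%:Z * i = 2 * (N%:Z * i) by lia.
have : N%:Z * i = 0 \/ N%:Z <= N%:Z * i \/ N%:Z * i <= - N%:Z.
  have [i1|[->|i1]] : i <= -1 \/ i = 0 \/ 1 <= i by lia.
  - by right; right; nia.
  - by left; rewrite mulr0.
  - by right; left; nia.
move: (N%:Z * i) => x; lia.
Qed.

(* Cauchy-Schwarz with the weights [1 / l], whose squares have a bounded sum. *)
Lemma nsq_aliases_le (m : 'I_(2 * N)) (w : 'I_(2 * L).+1 -> R) (P : pred 'I_(2 * L).+1)
    (b : R) : 0 <= b ->
    (forall q, P q -> l q = 0 -> w q = 0) ->
    (forall q, l q != 0 ->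
       ((l q)%:~R * w q) ^+ 2 <= b * ((alias m q)%:~R ^+ 2) ^+ s.+2) ->
  nsq (\sum_(q < (2 * L).+1 | P q) (w q)%:C * d (alias m q)) <=
    5 * b * \sum_(q < (2 * L).+1 | l q != 0) sobolev_weight (alias m q).
Proof.
move=> b0 w0 wb.
pose z q := ((l q)%:~R * w q)%:C * d (alias m q).
rewrite (eq_bigr (fun q => ((l q)%:~R^-1 : R)%:C * z q)); last first.
  move=> q Pq; rewrite /z mulrA -rmorphM /=.
  have [lq|lq] := eqVneq (l q) 0; first by rewrite w0// !mulr0.
  by rewrite mulKf// intr_eq0.
apply: (le_trans (nsq_sum_le _ _ _ _)); rewrite -mulrA; apply: ler_pM.
- by apply: sumr_ge0 => q _; exact: sqr_ge0.
- exact: sumr_ge0.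
- apply: le_trans sum_alias_invsq; rewrite [leRHS](bigID P) /= lerDl.
  by apply: sumr_ge0 => q _; exact: sqr_ge0.
rewrite mulr_sumr; apply: (@le_trans _ _ (\sum_(q < (2 * L).+1) nsq (z q))).
  by rewrite [leRHS](bigID P) /= lerDl sumr_ge0.
rewrite (bigID (fun q => l q != 0)) /= [X in _ + X]big1 ?addr0 => [|q]; last first.
  by rewrite negbK => /eqP lq; rewrite /z lq mul0r mul0r nsq0.
apply: ler_sum => q lq; rewrite /z nsqM nsq_real /sobolev_weight mulrA.
by rewrite ler_wpM2r// wb.
Qed.

Let NR : 1 <= (N%:R : R). Proof. by rewrite ler1n. Qed.

Let lq_ge1 q : l q != 0 -> 1 <= ((l q)%:~R : R) ^+ 2.
Proof.
move=> lq; rewrite -rmorphXn /= ler1z.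
move: (l q) lq => k; rewrite expr2 => k0.
have [k1|k1] : k <= -1 \/ 1 <= k by lia.
  nia.
nia.
Qed.

Let pow_alias m q : l q != 0 ->
  (N%:R ^+ 2 : R) ^+ s * (l q)%:~R ^+ 2 <= ((alias m q)%:~R ^+ 2) ^+ s.
Proof.
move=> lq; apply: (@le_trans _ _ ((N%:R ^+ 2 * (l q)%:~R ^+ 2) ^+ s)); last first.
  apply: lerXn2r; last exact: alias_ge.
    by rewrite nnegrE mulr_ge0// sqr_ge0.
  by rewrite nnegrE sqr_ge0.
rewrite [leRHS]exprMn; apply: ler_wpM2l; first by rewrite exprn_ge0// sqr_ge0.
by rewrite -[leLHS]expr1 ler_weXn2l// lq_ge1.
Qed.

Let invN (n : nat) : 0 <= ((N%:R ^+ 2 : R) ^+ n)^-1.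
Proof. by rewrite invr_ge0 exprn_ge0// sqr_ge0. Qed.

(** Folding error of the values: what the aliases outside the band add to the coefficient inside. *)
Lemma nsq_alias_rest m :
  nsq (\sum_(q < (2 * L).+1 | l q != 0) d (alias m q)) <=
  5 * ((N%:R ^+ 2) ^+ s)^-1 * \sum_(q < (2 * L).+1 | l q != 0) sobolev_weight (alias m q).
Proof.
under eq_bigr do rewrite -[d _]mul1r -[1]/(1%:C).
apply: nsq_aliases_le => // [q /eqP//|q lq].
rewrite mulr1 mulrC ler_pdivlMr ?exprn_gt0 ?ltr0n// mulrC.
apply: (le_trans (pow_alias m lq)); rewrite ler_weXn2l//.
  apply: le_trans (alias_ge m q); rewrite -[leLHS]mul1r.
  by apply: ler_pM; [| |exact: exprn_ege1|exact: lq_ge1].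
by rewrite -addn2 leq_addr.
Qed.

(** Folding error of the first derivative: an alias exceeds the frequency of its class by 2 N l, and
    the square of the factor 2 turns 5 into 20. *)
Lemma nsq_alias_shift m :
  nsq (\sum_(q < (2 * L).+1) ((2 * N)%:R * (l q)%:~R : R)%:C * d (alias m q)) <=
  20 * ((N%:R ^+ 2) ^+ s)^-1 * \sum_(q < (2 * L).+1 | l q != 0) sobolev_weight (alias m q).
Proof.
rewrite (_ : 20 * _ = 5 * (4 * ((N%:R ^+ 2) ^+ s)^-1)); last by ring.
apply: nsq_aliases_le => [|q _ ->|q lq]; rewrite ?mulr0 ?mulr_ge0//.
rewrite mulrAC ler_pdivlMr ?exprn_gt0 ?ltr0n//.
have := pow_alias m lq; have := alias_ge m q; have := lq_ge1 lq.
rewrite natrM (exprSr _ s.+1) (exprSr _ s); move: ((l q)%:~R : R) ((alias m q)%:~R : R) => x k.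
set P := (N%:R ^+ 2) ^+ s; set Q := (k ^+ 2) ^+ s; move=> x1 Nx PQ.
have P0 : 0 <= P by rewrite /P exprn_ge0 ?sqr_ge0.
rewrite (_ : _ * P = 4 * ((P * x ^+ 2) * (N%:R ^+ 2 * x ^+ 2))); last by ring.
rewrite (_ : 4 * (Q * _ * _) = 4 * (Q * (k ^+ 2 * k ^+ 2))); last by ring.
rewrite ler_pM2l//; apply: ler_pM => //.
- by rewrite mulr_ge0// sqr_ge0.
- by rewrite mulr_ge0// sqr_ge0.
- rewrite -[leLHS]mulr1; apply: ler_pM => //; first by rewrite mulr_ge0// sqr_ge0.
  apply: le_trans Nx; rewrite -[leLHS]mul1r.
  by apply: ler_pM; [| |exact: exprn_ege1|].
Qed.

(** Folding error of the second derivative. The frequency of the class is at most N in modulus,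
    hence at most that of any alias k with l nonzero: the squares differ by at most k^2, which uses
    up both additional orders of the weight, while N^(2 s) l^2 <= k^(2 s) yields the rate. *)
Lemma nsq_alias_square_shift (m : 'I_(2 * N)) :
  nsq (\sum_(q < (2 * L).+1)
    ((m%:R - N%:R) ^+ 2 - (alias m q)%:~R ^+ 2 : R)%:C * d (alias m q)) <=
  5 * ((N%:R ^+ 2) ^+ s)^-1 * \sum_(q < (2 * L).+1 | l q != 0) sobolev_weight (alias m q).
Proof.
apply: nsq_aliases_le => [//|q _|q lq].
  by rewrite /alias -/(l q) => ->; rewrite mulr0 addr0 rmorphB subrr.
rewrite [leRHS]mulrC ler_pdivlMr ?exprn_gt0 ?ltr0n//.
have := pow_alias m lq; have := alias_ge m q; have := lq_ge1 lq.
have : (m%:R - N%:R : R) ^+ 2 <= N%:R ^+ 2.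
  have : (m%:R : R) <= 2 * N%:R by rewrite -natrM ler_nat ltnW.
  have : 0 <= (m%:R : R) by []. 
  nra.
rewrite (exprSr _ s.+1) (exprSr _ s); move: ((l q)%:~R : R) ((alias m q)%:~R : R) (m%:R - N%:R : R) => x k w.
set P := (N%:R ^+ 2) ^+ s; set Q := (k ^+ 2) ^+ s; move=> wN x1 Nx PQ.
have P0 : 0 <= P by rewrite /P exprn_ge0 ?sqr_ge0.
rewrite (_ : _ * P = (P * x ^+ 2) * (w ^+ 2 - k ^+ 2) ^+ 2); last by ring.
rewrite -(mulrA Q); apply: ler_pM => //.
- by rewrite mulr_ge0// sqr_ge0.
- exact: sqr_ge0.
have w0 := sqr_ge0 w.
have wk : w ^+ 2 <= k ^+ 2.
  by apply: (le_trans wN); apply: le_trans Nx; rewrite ler_peMr ?sqr_ge0.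
by move: (w ^+ 2) (k ^+ 2) w0 wk => a b a0 ab; nra.
Qed.

End Aliasing.

(** * Energy inequality for trigonometric sums *)

Section Energy.
Context {R : realType}.

(** Origin of the threshold 1/64: Young's inequality with parameter 1/8, applied to z and conj(z) f,
    bounds 2 Re(z^2 conj f) by |z|^2 / 8 + 8 |z|^2 |f|^2, and the threshold makes the second term no
    larger than the first. The quadratic term thus costs |z|^2 / 8 and the cross term |z|^2 / 4. *)
Lemma Re_nonlinearity_le (z f w : R[i]) (W : R) :
  nsq f <= 64^-1 -> nsq w <= W ->
  Re ((z ^+ 2 + 2 * w * z) * conjc f) <= 3 / 8 * nsq z + 4 * W * nsq f.
Proof.
move=> fle wle.
have h1 : 2 * Re (z ^+ 2 * conjc f) <= 4^-1 * nsq z.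
  rewrite (_ : z ^+ 2 * _ = z * conjc (conjc z * f)); last by rewrite rmorphM /= conjcK; ring.
  apply: le_trans (Re_mulJ_le _ _ (_ : 0 < 8^-1)) _ => //.
  rewrite nsqM nsqJ invrK.
  have := ler_wpM2l (nsq_ge0 z) fle; lra.
have h2 : 2 * Re (w * z * conjc f) <= 4^-1 * nsq z + 4 * W * nsq f.
  rewrite (_ : w * z * _ = z * conjc (conjc w * f)); last by rewrite rmorphM /= conjcK; ring.
  apply: le_trans (Re_mulJ_le _ _ (_ : 0 < 4^-1)) _ => //.
  rewrite nsqM nsqJ invrK.
  have := ler_wpM2r (nsq_ge0 f) wle; lra.
rewrite (_ : _ * conjc f = z ^+ 2 * conjc f + (w * z * conjc f + w * z * conjc f)); last by ring.
rewrite !cReD; lra.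
Qed.

Variables (N : nat) (A B W : R).
Hypotheses (N0 : (0 < N)%N) (A0 : 0 < A).

Let fr (m : 'I_(2 * N)) : R := m%:R - N%:R.
Let e (m j : 'I_(2 * N)) : R[i] := expi (fr m * node j).

(* The nonlinear term loses [3/4 A |e_x|^2], which diffusion compensates since
   the quadratic coefficient of the equation is equal to [A]. *)
Lemma energy_coef (a sg rh : 'I_(2 * N) -> R[i]) (f fx fxx w : 'I_(2 * N) -> R[i]) :
  (forall j, f j = \sum_(m < 2 * N) a m * e m j) ->
  (forall j, fx j = \sum_(m < 2 * N) ((0 +i* fr m) * a m + sg m) * e m j) ->
  (forall j, fxx j = \sum_(m < 2 * N) (rh m - (fr m ^+ 2)%:C * a m) * e m j) ->
  (forall j, nsq (f j) <= 64^-1) -> (forall j, nsq (w j) <= W) ->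
  \sum_(j < 2 * N) Re ((A%:C * fxx j + B%:C * fx j +
      A%:C * (fx j ^+ 2 + 2 * w j * fx j)) * conjc (f j)) <=
  (4 * W * A + A / 2 + `|B| / 2) * \sum_(j < 2 * N) nsq (f j) +
  (2 * N)%:R * ((3 / 4 * A + `|B| / 2) * \sum_(m < 2 * N) nsq (sg m)
              + A / 2 * \sum_(m < 2 * N) nsq (rh m)).
Proof.
move=> fE fxE fxxE fle wle.
set NN : R := (2 * N)%:R.
have NN0 : 0 <= NN by rewrite ler0n.
have fN : \sum_(j < 2 * N) nsq (f j) = NN * \sum_(m < 2 * N) nsq (a m).
  by under eq_bigr do rewrite fE; exact: discrete_Parseval_nsq.
have diffusion : \sum_(j < 2 * N) Re (fxx j * conjc (f j)) <=
    NN * \sum_(m < 2 * N) (nsq (rh m) / 2 + nsq (a m) / 2 - fr m ^+ 2 * nsq (a m)).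
  rewrite -cRe_sum; under eq_bigr do rewrite fxxE fE.
  rewrite discrete_Parseval// cReM cIm_sum (_ : Im (2 * N)%:R = 0) ?mul0r ?subr0; last first.
    by rewrite -(rmorph_nat (real_complex R)).
  rewrite (_ : Re (2 * N)%:R = NN); last by rewrite -(rmorph_nat (real_complex R)).
  rewrite cRe_sum; apply: ler_wpM2l => //; apply: ler_sum => m _.
  have := Re_mulJ_le (rh m) (a m) (ltr01 : 0 < 1 :> R); rewrite invr1.
  rewrite mulrBl cReD cReN -mulrA mulcJ -rmorphM Re_real; lra.
have drift : B * \sum_(j < 2 * N) Re (fx j * conjc (f j)) <=
    NN * (`|B| * \sum_(m < 2 * N) (nsq (sg m) / 2 + nsq (a m) / 2)).
  rewrite -cRe_sum; under eq_bigr do rewrite fxE fE.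
  rewrite discrete_Parseval// cReM cIm_sum (_ : Im (2 * N)%:R = 0) ?mul0r ?subr0; last first.
    by rewrite -(rmorph_nat (real_complex R)).
  rewrite (_ : Re (2 * N)%:R = NN); last by rewrite -(rmorph_nat (real_complex R)).
  rewrite cRe_sum mulrCA; apply: ler_wpM2l => //.
  apply: le_trans (ler_norm _) _; rewrite normrM; apply: ler_wpM2l => //.
  apply: le_trans (ler_norm_sum _ _ _) _; apply: ler_sum => m _.
  (* The main part i (fr m) |a m|^2 is imaginary, so that only the aliasing error [sg] contributes
     to the drift. *)
  rewrite mulrDl cReD -mulrA mulcJ (_ : Re _ = 0); last first.
    by rewrite cReM Re_real Im_real /= mul0r mulr0 subrr.
  rewrite add0r ler_norml; apply/andP; split.
    have := Re_mulJ_le (- sg m) (a m) (ltr01 : 0 < 1 :> R).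
    rewrite invr1 nsqN mulNr cReN; lra.
  by have := Re_mulJ_le (sg m) (a m) (ltr01 : 0 < 1 :> R); rewrite invr1; lra.
have fxN : \sum_(j < 2 * N) nsq (fx j) <=
    NN * \sum_(m < 2 * N) (2 * (fr m ^+ 2 * nsq (a m)) + 2 * nsq (sg m)).
  under eq_bigr do rewrite fxE.
  rewrite discrete_Parseval_nsq//; apply: ler_wpM2l => //; apply: ler_sum => m _.
  apply: le_trans (le_nsqD _ _) _; rewrite nsqM.
  by rewrite [in X in _ <= X]/nsq /nsq /= expr0n /= add0r.
have nonlin : \sum_(j < 2 * N) Re ((fx j ^+ 2 + 2 * w j * fx j) * conjc (f j)) <=
    3 / 8 * \sum_(j < 2 * N) nsq (fx j) + 4 * W * \sum_(j < 2 * N) nsq (f j).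
  rewrite !mulr_sumr -big_split /=; apply: ler_sum => j _.
  exact: Re_nonlinearity_le.
rewrite (eq_bigr (fun j => A * Re (fxx j * conjc (f j)) + B * Re (fx j * conjc (f j))
    + A * Re ((fx j ^+ 2 + 2 * w j * fx j) * conjc (f j)))); last first.
  by move=> j _; rewrite !ReImE; ring.
rewrite big_split /= [X in X + _ <= _]big_split /= -!mulr_sumr.
move: fN diffusion drift nonlin fxN.
set SF := \sum_(j < 2 * N) nsq (f j); set SX := \sum_(j < 2 * N) nsq (fx j).
set SR := \sum_(m < 2 * N) nsq (rh m); set SS := \sum_(m < 2 * N) nsq (sg m).
set SA := \sum_(m < 2 * N) nsq (a m); move=> ->.
rewrite !big_split /= -!mulr_suml -!mulr_sumr sumrN -/SR -/SS -/SA.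
move=> diffusion drift nonlin fxN.
have {}diffusion := ler_wpM2l (ltW A0) diffusion.
have {}nonlin := ler_wpM2l (ltW A0) nonlin.
have {}fxN := ler_wpM2l (ltW A0) fxN.
move: diffusion drift nonlin fxN.
set X := \sum_(m < 2 * N) fr m ^+ 2 * nsq (a m).
have X0 : 0 <= NN * X.
  by rewrite mulr_ge0// sumr_ge0// => m _; rewrite mulr_ge0// sqr_ge0.
have AX := mulr_ge0 (ltW A0) X0.
lra.
Qed.

End Energy.

(** * Trigonometric sums sampled at the nodes *)

Section TrigSums.
Context {R : realType}.

Definition trig_sum (n : nat) (c : int -> R[i]) (x : R) : R[i] :=
  \sum_(k <- freqs n) c k * expi (k%:~R * x).

Definition fderiv (c : int -> R[i]) (k : int) : R[i] := (0 +i* k%:~R) * c k.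

Lemma nsq_fderiv c k : nsq (fderiv c k) = k%:~R ^+ 2 * nsq (c k).
Proof. by rewrite /fderiv nsqM /nsq /= expr0n /= add0r. Qed.

Variables (N L : nat).
Hypothesis N0 : (0 < N)%N.

Let fr (m : 'I_(2 * N)) : R := m%:R - N%:R.
Let e (m j : 'I_(2 * N)) : R[i] := expi (fr m * node j).
Let l (q : 'I_(2 * L).+1) : int := q%:Z - L%:Z.
Let al (m : 'I_(2 * N)) (q : 'I_(2 * L).+1) : int :=
  m%:Z - N%:Z + (2 * N)%:Z * l q.

Lemma intr_freq (m : 'I_(2 * N)) : (m%:Z - N%:Z)%:~R = fr m.
Proof. by rewrite rmorphB. Qed.

Lemma big_freqs_ord (V : nmodType) (F : int -> V) :
  \sum_(k <- freqs N) F k = \sum_(m < 2 * N) F (m%:Z - N%:Z).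
Proof. by rewrite big_freqs -mul2n. Qed.

Lemma big_alias0 (V : nmodType) (m : 'I_(2 * N)) (F : int -> V) :
  \sum_(q < (2 * L).+1) F (al m q) =
  F (m%:Z - N%:Z) + \sum_(q < (2 * L).+1 | l q != 0) F (al m q).
Proof.
have Llt : (L < (2 * L).+1)%N by lia.
rewrite (bigD1 (Ordinal Llt))//= {1}/al /l /= subrr mulr0 addr0; congr (_ + _).
apply: eq_bigl => q; congr negb; apply/eqP/eqP => [-> /=|h]; first by rewrite subrr.
by apply: val_inj => /=; lia.
Qed.

Lemma big_tail_freqs_aliases (V : zmodType) (F : int -> V) :
  \sum_(k <- tail_freqs N (N * (2 * L).+1)) F k =
  \sum_(m < 2 * N) \sum_(q < (2 * L).+1 | l q != 0) F (al m q).
Proof.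
apply: (addrI (\sum_(k <- freqs N) F k)).
rewrite -big_freqs_cat; last by rewrite leq_pmulr.
rewrite big_freqs_aliases big_freqs_ord -big_split /=.
by apply: eq_bigr => m _; rewrite big_alias0.
Qed.

Lemma trig_sum_node (c : int -> R[i]) j :
  trig_sum (N * (2 * L).+1) c (node j) =
  \sum_(m < 2 * N) (\sum_(q < (2 * L).+1) c (al m q)) * e m j.
Proof.
rewrite /trig_sum big_freqs_aliases; apply: eq_bigr => m _.
rewrite mulr_suml; apply: eq_bigr => q _.
by rewrite expi_node_alias// intr_freq.
Qed.

Variables (s : nat) (d : int -> R[i]) (G : R).
Hypothesis s1 : (1 <= s)%N.
Hypothesis dG : \sum_(k <- tail_freqs N (N * (2 * L).+1)) sobolev_weight s d k <= G.

(** The [a m] are the coefficients of the interpolant at the nodes; [sg] and [rh] are the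
    coefficients of the differences between the sampled derivatives of the sum and the derivatives
    of the interpolant. *)
Let a (m : 'I_(2 * N)) : R[i] := \sum_(q < (2 * L).+1) d (al m q).
Let sg (m : 'I_(2 * N)) : R[i] :=
  (0 +i* 1) * \sum_(q < (2 * L).+1) ((2 * N)%:R * (l q)%:~R : R)%:C * d (al m q).
Let rh (m : 'I_(2 * N)) : R[i] :=
  \sum_(q < (2 * L).+1) (fr m ^+ 2 - (al m q)%:~R ^+ 2 : R)%:C * d (al m q).

Let alE m q : ((al m q)%:~R : R) = fr m + (2 * N)%:R * (l q)%:~R.
Proof. by rewrite /al rmorphD /= intr_freq rmorphM. Qed.

Let fderiv1 m : \sum_(q < (2 * L).+1) fderiv d (al m q) = (0 +i* fr m) * a m + sg m.
Proof.
rewrite /a /sg !mulr_sumr -big_split /=; apply: eq_bigr => q _.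
rewrite /fderiv alE mulrA -mulrDl; congr (_ * _).
by apply: complexP; rewrite !ReImE; ring.
Qed.

Let fderiv2 m : \sum_(q < (2 * L).+1) fderiv (fderiv d) (al m q) =
  rh m - (fr m ^+ 2)%:C * a m.
Proof.
rewrite /a /rh mulr_sumr -sumrB; apply: eq_bigr => q _.
rewrite /fderiv mulrA -mulrBl; congr (_ * _).
by apply: complexP; rewrite !ReImE; ring.
Qed.

Let sum_weights (b : R) (F : 'I_(2 * N) -> R) : 0 <= b ->
  (forall m, F m <= b * \sum_(q < (2 * L).+1 | l q != 0) sobolev_weight s d (al m q)) ->
  \sum_(m < 2 * N) F m <= b * G.
Proof.
move=> b0 Fb; apply: le_trans (ler_wpM2l b0 dG).
rewrite big_tail_freqs_aliases mulr_sumr; exact: ler_sum.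
Qed.

Let NV0 : 0 <= ((N%:R ^+ 2 : R) ^+ s)^-1.
Proof. by rewrite invr_ge0 exprn_ge0// sqr_ge0. Qed.

Lemma energy_trig_sum (A B W : R) (w : 'I_(2 * N) -> R[i]) : 0 < A ->
  let f j := trig_sum (N * (2 * L).+1) d (node j) in
  let fx j := trig_sum (N * (2 * L).+1) (fderiv d) (node j) in
  let fxx j := trig_sum (N * (2 * L).+1) (fderiv (fderiv d)) (node j) in
  (forall j, nsq (f j) <= 64^-1) -> (forall j, nsq (w j) <= W) ->
  \sum_(j < 2 * N) Re ((A%:C * fxx j + B%:C * fx j +
      A%:C * (fx j ^+ 2 + 2 * w j * fx j)) * conjc (f j)) <=
  (4 * W * A + A / 2 + `|B| / 2) * \sum_(j < 2 * N) nsq (f j) +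
  (2 * N)%:R * ((20 * (3 / 4 * A + `|B| / 2) + 5 * A / 2) *
     ((N%:R ^+ 2) ^+ s)^-1 * G).
Proof.
move=> A0 f fx fxx f64 wW.
apply: (le_trans (@energy_coef _ _ A B W N0 A0 a sg rh f fx fxx w _ _ _ f64 wW)).
- by move=> j; rewrite /f trig_sum_node.
- by move=> j; rewrite /fx trig_sum_node; apply: eq_bigr => m _; rewrite fderiv1.
- by move=> j; rewrite /fxx trig_sum_node; apply: eq_bigr => m _; rewrite fderiv2.
rewrite lerD2l ler_wpM2l//.
have hs : \sum_(m < 2 * N) nsq (sg m) <= 20 * ((N%:R ^+ 2) ^+ s)^-1 * G.
  apply: sum_weights => [|m]; first by rewrite mulr_ge0.
  by rewrite /sg nsqM {1}/nsq /= expr0n expr1n /= add0r mul1r; exact: nsq_alias_shift.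
have hr : \sum_(m < 2 * N) nsq (rh m) <= 5 * ((N%:R ^+ 2) ^+ s)^-1 * G.
  apply: sum_weights => [|m]; first by rewrite mulr_ge0.
  exact: nsq_alias_square_shift.
have c1 : 0 <= 3 / 4 * A + `|B| / 2 by have := normr_ge0 B; lra.
have c2 : 0 <= A / 2 by lra.
have := ler_wpM2l c1 hs; have := ler_wpM2l c2 hr; lra.
Qed.

(** The way back from the nodes to the L^2 norm: inside the band, [d] is the folded coefficient,
    measured by the discrete Parseval identity, minus the aliases. *)
Lemma low_freqs_le :
  (2 * N)%:R * \sum_(k <- freqs N) nsq (d k) <=
  2 * \sum_(j < 2 * N) nsq (trig_sum (N * (2 * L).+1) d (node j)) +
  (2 * N)%:R * (10 * ((N%:R ^+ 2) ^+ s)^-1 * G).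
Proof.
under [in leRHS]eq_bigr do rewrite trig_sum_node.
rewrite discrete_Parseval_nsq// -/a mulrCA -mulrDr ler_wpM2l//.
rewrite big_freqs_ord.
pose b (m : 'I_(2 * N)) := \sum_(q < (2 * L).+1 | l q != 0) d (al m q).
have hb : \sum_(m < 2 * N) nsq (b m) <= 5 * ((N%:R ^+ 2) ^+ s)^-1 * G.
  apply: sum_weights => [|m]; first by rewrite mulr_ge0.
  exact: nsq_alias_rest.
apply: (@le_trans _ _ (\sum_(m < 2 * N) (2 * nsq (a m) + 2 * nsq (b m)))).
  apply: ler_sum => m _.
  rewrite (_ : d _ = a m - b m); last by rewrite /a big_alias0 addrK.
  by rewrite -[nsq (b m)]nsqN le_nsqD.
rewrite big_split /= -!mulr_sumr lerD2l; lra.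
Qed.

End TrigSums.

(** * One-sided slopes *)

Section Slopes.
Context {R : realType}.
Implicit Types (f g : R -> R) (a b x l : R).

(** A first order expansion relative to the segment, without quotient: it is one-sided at the end
    points, and y = x needs no exclusion. *)
Definition has_slope a b f x l := forall e, 0 < e -> exists2 d, 0 < d &
  forall y, y \in `[a, b] -> `|y - x| < d -> `|f y - f x - l * (y - x)| <= e * `|y - x|.

Lemma has_slope_cvg a b f x l :
  ((f y - f x) / (y - x)) @[y --> within `[a, b] (x^')] --> l -> has_slope a b f x l.
Proof.
move=> /cvgrPdist_le fl e e0; have := fl e e0.
rewrite near_withinE near_withinE => /nbhs_ballP[d /= d0 H].
exists d => // y yab yd; have [->|yx] := eqVneq y x.
  by rewrite !subrr mulr0 subrr normr0 mulr0.
have yx0 : y - x != 0 by rewrite subr_eq0.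
have := H y; rewrite /ball /= distrC => /(_ yd yx yab).
rewrite -(ler_pM2r (_ : 0 < `|y - x|)) ?normr_gt0// -normrM.
by rewrite mulrBl divfK// distrC.
Qed.

Lemma is_derive_has_slope a b f x l : is_derive x 1 f l -> has_slope a b f x l.
Proof.
case=> fx fl e e0; move: fx; rewrite /derivable => /cvg_ex[l' fl'].
have {l'} fl' : h^-1 *: ((f \o shift x) (h *: 1) - f x) @[h --> 0^'] --> l.
  by rewrite -fl /derive (cvg_lim _ fl').
move/cvgrPdist_le : fl' => /(_ e e0); rewrite near_withinE => /nbhs_ballP[d /= d0 H].
exists d => // y yab yd; have [->|yx] := eqVneq y x.
  by rewrite !subrr mulr0 subrr normr0 mulr0.
have yx0 : y - x != 0 by rewrite subr_eq0.
have := H (y - x); rewrite /ball /= sub0r normrN => /(_ yd yx0).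
rewrite -(ler_pM2r (_ : 0 < `|y - x|)) ?normr_gt0// -normrM.
rewrite /GRing.scale /= mulr1 subrK mulrBl mulrAC mulVf// mul1r.
by rewrite distrC.
Qed.

Lemma has_slope_is_derive a b f x l : x \in `]a, b[ -> has_slope a b f x l ->
  is_derive x 1 f l.
Proof.
rewrite in_itv /= => /andP[ax xb] H.
have fl : h^-1 *: ((f \o shift x) (h *: 1) - f x) @[h --> 0^'] --> l.
  apply/cvgrPdist_le => e e0; have [d d0 {}H] := H e e0.
  rewrite near_withinE; apply/nbhs_ballP.
  exists (Num.min d (Num.min (x - a) (b - x))); first by rewrite /= !lt_min d0 !subr_gt0 ax.
  move=> h /=; rewrite /ball /= sub0r normrN !lt_min => /and3P[hd hx hb] h0.
  rewrite /GRing.scale /= mulr1.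
  rewrite -(ler_pM2r (_ : 0 < `|h|)) ?normr_gt0// -normrM.
  rewrite mulrBl mulrAC mulVf// mul1r distrC.
  have := H (h + x); rewrite addrK in_itv /=; apply => //.
  by move: hx hb; rewrite !ltr_norml; lra.
by split; [apply/cvg_ex; exists l|apply: cvg_lim].
Qed.

Lemma has_slope_uniq a b f x l l' : a < b -> x \in `[a, b] ->
  has_slope a b f x l -> has_slope a b f x l' -> l = l'.
Proof.
move=> ab xab H H'; apply/eqP; rewrite -subr_eq0 -normr_le0.
apply/ler_addgt0Pl => e e0; rewrite addr0.
have e2 : 0 < e / 2 by rewrite divr_gt0.
have [d d0 {}H] := H _ e2; have [d' d'0 {}H'] := H' _ e2.
suff [y [yab yd yd' yx]] : exists y, [/\ y \in `[a, b], `|y - x| < d, `|y - x| < d' & y - x != 0].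
  have := H y yab yd; have := H' y yab yd'; set A := f y - f x => h1 h2.
  rewrite -(ler_pM2r (_ : 0 < `|y - x|)) ?normr_gt0// -normrM.
  rewrite (_ : (l - l') * _ = (A - l' * (y - x)) - (A - l * (y - x))); last by ring.
  apply: le_trans (ler_normB _ _) _; lra.
(* As r is at most half the length of the segment, x + r or x - r lies in it. *)
pose r := Num.min d (Num.min d' (b - a)) / 2.
have r0 : 0 < r by rewrite divr_gt0// !lt_min d0 d'0 subr_gt0.
have [rd rd' rba] : [/\ r < d, r < d' & r * 2 <= b - a].
  have : r * 2 <= d by rewrite divfK// ge_min lexx.
  have : r * 2 <= d' by rewrite divfK// !ge_min lexx !orbT.
  have : r * 2 <= b - a by rewrite divfK// !ge_min lexx !orbT.
  by move=> ? ? ?; split; lra.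
move: xab; rewrite in_itv /= => /andP[ax xb].
have [xb'|xb'] := leP (x + r) b.
  exists (x + r); rewrite addrAC subrr add0r gtr0_norm// in_itv /= xb' gt_eqF// rd rd' andbT.
  by split => //; lra.
exists (x - r); rewrite addrAC subrr add0r normrN gtr0_norm// in_itv /= rd rd' oppr_eq0 gt_eqF//.
by split => //; apply/andP; split; lra.
Qed.

Lemma has_slope_continuous a b f x l : has_slope a b f x l ->
  f y @[y --> within `[a, b] (nbhs x)] --> f x.
Proof.
move=> H; apply/cvgrPdist_le => e e0.
have [d d0 {}H] := H 1 ltr01.
rewrite near_withinE; apply/nbhs_ballP.
pose c := `|l| + 1; have c0 : 0 < c by rewrite ltr_wpDl.
exists (Num.min d (e / c)); first by rewrite /= lt_min d0 divr_gt0.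
move=> y /=; rewrite /ball /= distrC lt_min => /andP[yd ye] yab.
have := H y yab yd; rewrite mul1r => h; rewrite distrC.
rewrite (_ : f y - f x = (f y - f x - l * (y - x)) + l * (y - x)); last by ring.
apply: le_trans (ler_normD _ _) _; rewrite normrM.
apply: (@le_trans _ _ (c * `|y - x|)); first by rewrite /c; lra.
by rewrite mulrC -ler_pdivlMr// ltW.
Qed.

Lemma has_slope_within a b f (f' : R -> R) :
  (forall x, x \in `[a, b] -> has_slope a b f x (f' x)) -> {within `[a, b], continuous f}.
Proof.
move=> H; apply/subspace_continuousP => x xab.
by apply: has_slope_continuous; apply: H.
Qed.

Lemma has_slopeD a b f g x l l' : has_slope a b f x l -> has_slope a b g x l' ->
  has_slope a b (fun y => f y + g y) x (l + l').
Proof.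
move=> H H' e e0; have e2 : 0 < e / 2 by rewrite divr_gt0.
have [d d0 {}H] := H _ e2; have [d' d'0 {}H'] := H' _ e2.
exists (Num.min d d'); first by rewrite lt_min d0.
move=> y yab; rewrite lt_min => /andP[yd yd'].
have := H y yab yd; have := H' y yab yd' => h1 h2.
rewrite (_ : _ - _ = (f y - f x - l * (y - x)) + (g y - g x - l' * (y - x))); last by ring.
apply: le_trans (ler_normD _ _) _; lra.
Qed.

Lemma has_slopeN a b f x l : has_slope a b f x l -> has_slope a b (fun y => - f y) x (- l).
Proof.
move=> H e e0; have [d d0 {}H] := H _ e0; exists d => // y yab yd.
rewrite (_ : _ - _ = - (f y - f x - l * (y - x))); last by ring.
by rewrite normrN H.
Qed.

Lemma has_slope_sqr a b f x l : has_slope a b f x l ->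
  has_slope a b (fun y => f y ^+ 2) x (2 * f x * l).
Proof.
move=> H e e0.
(* With z = y - x and D the remainder of f, the remainder of the square is 2 f(x) D + (D + l z)^2;
   for |D| <= e' |z| and |z| < e' <= 1 it is at most c e' |z|. *)
pose c := 2 * `|f x| + (`|l| + 1) ^+ 2.
have c0 : 0 <= c by rewrite /c addr_ge0 ?mulr_ge0 ?sqr_ge0.
have c1 : 0 < c + 1 by lra.
pose e' := Num.min 1 (e / (c + 1)).
have e'0 : 0 < e' by rewrite /e' lt_min ltr01 divr_gt0.
have [d d0 {}H] := H _ e'0.
exists (Num.min d e'); first by rewrite lt_min d0 e'0.
move=> y yab; rewrite lt_min => /andP[yd ye].
have h := H y yab yd; set D := f y - f x - l * (y - x) in h.
set z := y - x in D h yd ye *.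
rewrite (_ : _ - _ = 2 * f x * D + (D + l * z) ^+ 2); last by rewrite /D /z; ring.
apply: le_trans (ler_normD _ _) _; rewrite normrX (normrM (2 * f x) D) (normrM 2) normr_nat.
have e'1 : e' <= 1 by rewrite /e' ge_min lexx.
have e'e : e' * (c + 1) <= e by rewrite -ler_pdivlMr// /e' ge_min lexx orbT.
have z0 := normr_ge0 z; have D0 := normr_ge0 D; have l0 := normr_ge0 l; have f0 := normr_ge0 (f x).
have DD : `|D + l * z| <= (`|l| + 1) * `|z|.
  apply: le_trans (ler_normD _ _) _; rewrite normrM.
  by have := ler_wpM2r z0 e'1; lra.
have {}DD : `|D + l * z| ^+ 2 <= (`|l| + 1) ^+ 2 * (e' * `|z|).
  have : `|D + l * z| ^+ 2 <= ((`|l| + 1) * `|z|) ^+ 2.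
    by apply: lerXn2r => //; rewrite nnegrE// mulr_ge0// addr_ge0.
  move/le_trans; apply; rewrite exprMn; apply: ler_wpM2l; first exact: sqr_ge0.
  by rewrite expr2; apply: ler_wpM2r => //; exact: ltW.
have h1 : 2 * `|f x| * `|D| <= 2 * `|f x| * (e' * `|z|).
  by apply: ler_wpM2l => //; rewrite mulr_ge0.
have : (c + 1) * (e' * `|z|) <= e * `|z|.
  by rewrite mulrA; apply: ler_wpM2r => //; rewrite mulrC.
have : 0 <= e' * `|z| by rewrite mulr_ge0// ltW.
rewrite /c; lra.
Qed.

Lemma has_slope_eq (a b x l : R) (f g : R -> R) : x \in `[a, b] ->
  (forall y, y \in `[a, b] -> f y = g y) -> has_slope a b f x l -> has_slope a b g x l.
Proof.
move=> xab fg H e e0; have [d d0 {}H] := H e e0; exists d => // y yab yd.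
by rewrite -!fg//; exact: H.
Qed.

Lemma has_slope_sum (a b x : R) (I : Type) (r : seq I) (f : I -> R -> R) (l : I -> R) :
  (forall i, has_slope a b (f i) x (l i)) ->
  has_slope a b (fun y => \sum_(i <- r) f i y) x (\sum_(i <- r) l i).
Proof.
move=> fl; elim: r => [|i r IH].
  under eq_fun do rewrite big_nil; rewrite big_nil => e e0.
  by exists 1 => // y _ _; rewrite mul0r !subrr normr0 mulr_ge0// ltW.
by under eq_fun do rewrite big_cons; rewrite big_cons; exact: has_slopeD.
Qed.

End Slopes.

Section ComplexSlopes.
Context {R : realType}.
Implicit Types (f g : R -> R[i]) (a b x : R) (l : R[i]).

Definition has_cslope a b f x l :=
  has_slope a b (fun y => Re (f y)) x (Re l) /\ has_slope a b (fun y => Im (f y)) x (Im l).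

Lemma is_derive_on_cslope a b f x l : is_derive_on a b f x l -> has_cslope a b f x l.
Proof. by case=> h h'; split; exact: has_slope_cvg. Qed.

Lemma has_cslope_uniq a b f x l l' : a < b -> x \in `[a, b] ->
  has_cslope a b f x l -> has_cslope a b f x l' -> l = l'.
Proof.
by move=> ab xab [h1 h2] [h3 h4]; apply: complexP; [exact: (has_slope_uniq ab xab h1 h3)|
  exact: (has_slope_uniq ab xab h2 h4)].
Qed.

Lemma has_cslopeD a b f g x l l' : has_cslope a b f x l -> has_cslope a b g x l' ->
  has_cslope a b (fun y => f y + g y) x (l + l').
Proof.
move=> [h1 h2] [h3 h4]; split.
  by under eq_fun do rewrite cReD; rewrite cReD; exact: has_slopeD.
by under eq_fun do rewrite cImD; rewrite cImD; exact: has_slopeD.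
Qed.

Lemma has_cslopeN a b f x l : has_cslope a b f x l -> has_cslope a b (fun y => - f y) x (- l).
Proof.
move=> [h1 h2]; split.
  by under eq_fun do rewrite cReN; rewrite cReN; exact: has_slopeN.
by under eq_fun do rewrite cImN; rewrite cImN; exact: has_slopeN.
Qed.

Lemma has_cslope_nsq_le a b f x l : has_cslope a b f x l -> forall e, 0 < e ->
  exists2 d, 0 < d & forall y, y \in `[a, b] -> `|y - x| < d ->
    nsq (f y - f x - l * (y - x)%:C) <= e * (y - x) ^+ 2.
Proof.
move=> [h1 h2] e e0; pose r := Num.sqrt (e / 2).
have r0 : 0 < r by rewrite sqrtr_gt0 divr_gt0.
have r2 : r ^+ 2 = e / 2 by rewrite sqr_sqrtr// ltW// divr_gt0.
have [d d0 {}h1] := h1 _ r0; have [d' d'0 {}h2] := h2 _ r0.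
exists (Num.min d d'); first by rewrite lt_min d0.
move=> y yab; rewrite lt_min => /andP[yd yd'].
have := h1 y yab yd; have := h2 y yab yd'.
rewrite /nsq !ReImE !mulr0 subr0 add0r addrC.
have sq (z w : R) : `|z| <= r * `|w| -> z ^+ 2 <= e / 2 * w ^+ 2.
  move=> h; rewrite -r2 -[z ^+ 2]real_normK ?num_real// -[w ^+ 2]real_normK ?num_real//.
  by rewrite -exprMn; apply: lerXn2r; rewrite ?nnegrE ?mulr_ge0// ltW.
by move=> /sq h /sq h'; rewrite [Im l * _]mulrC in h *; lra.
Qed.

Lemma has_cslope_nsq a b f x l : has_cslope a b f x l ->
  has_slope a b (fun y => nsq (f y)) x (2 * Re (l * conjc (f x))).
Proof.
move=> [h1 h2]; rewrite (_ : 2 * _ = 2 * Re (f x) * Re l + 2 * Im (f x) * Im l).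
  by apply: has_slopeD; exact: has_slope_sqr.
by rewrite !ReImE; ring.
Qed.

Lemma has_cslope_eq (a b x : R) (l : R[i]) (f g : R -> R[i]) : x \in `[a, b] ->
  (forall y, y \in `[a, b] -> f y = g y) -> has_cslope a b f x l -> has_cslope a b g x l.
Proof.
move=> xab fg [h1 h2]; split; [apply: has_slope_eq h1|apply: has_slope_eq h2] => // y yab;
  by rewrite fg.
Qed.

End ComplexSlopes.

(** * Limits of trigonometric sums *)

Section ComplexLimits.
Context {R : realType}.
Implicit Types (u v : nat -> R[i]) (l m : R[i]).

Definition ccvg u l :=
  Re (u n) @[n --> \oo] --> Re l /\ Im (u n) @[n --> \oo] --> Im l.

Lemma ccvg_cst l : ccvg (fun=> l) l.
Proof. by split; exact: cvg_cst. Qed.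

Lemma ccvgD u v l m : ccvg u l -> ccvg v m -> ccvg (fun n => u n + v n) (l + m).
Proof.
move=> [h1 h2] [h3 h4]; split.
  by under eq_fun do rewrite cReD; rewrite cReD; exact: cvgD.
by under eq_fun do rewrite cImD; rewrite cImD; exact: cvgD.
Qed.

Lemma ccvgN u l : ccvg u l -> ccvg (fun n => - u n) (- l).
Proof.
move=> [h1 h2]; split.
  by under eq_fun do rewrite cReN; rewrite cReN; exact: cvgN.
by under eq_fun do rewrite cImN; rewrite cImN; exact: cvgN.
Qed.

Lemma ccvgM u v l m : ccvg u l -> ccvg v m -> ccvg (fun n => u n * v n) (l * m).
Proof.
move=> [h1 h2] [h3 h4]; split.
  by under eq_fun do rewrite cReM; rewrite cReM; apply: cvgB; exact: cvgM.
by under eq_fun do rewrite cImM; rewrite cImM; apply: cvgD; exact: cvgM.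
Qed.

Lemma ccvg_conj u l : ccvg u l -> ccvg (fun n => conjc (u n)) (conjc l).
Proof.
move=> [h1 h2]; split.
  by under eq_fun do rewrite cRe_conj; rewrite cRe_conj.
by under eq_fun do rewrite cIm_conj; rewrite cIm_conj; exact: cvgN.
Qed.

Lemma ccvg_nsq u l : ccvg u l -> nsq (u n) @[n --> \oo] --> nsq l.
Proof.
move=> [h1 h2]; rewrite /nsq; apply: cvgD; rewrite expr2.
  by under eq_fun do rewrite expr2; exact: cvgM.
by under eq_fun do rewrite expr2; exact: cvgM.
Qed.

Lemma ccvg_subseq u l (k : nat -> nat) : k n @[n --> \oo] --> \oo -> ccvg u l ->
  ccvg (fun n => u (k n)) l.
Proof.
move=> kn [h1 h2]; split.
  by apply: (cvg_comp k (fun n => Re (u n)) kn h1).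
by apply: (cvg_comp k (fun n => Im (u n)) kn h2).
Qed.

Lemma ccvg_nsq_lim0 u l : nsq (u n - l) @[n --> \oo] --> 0 -> ccvg u l.
Proof.
have aux (a : nat -> R) (b : R) : (forall n, (a n - b) ^+ 2 <= nsq (u n - l)) ->
    nsq (u n - l) @[n --> \oo] --> 0 -> a n @[n --> \oo] --> b.
  move=> ab /cvgrPdist_lt H; apply/cvgrPdist_lt => e e0.
  have := H (e ^+ 2) (exprn_gt0 _ e0); apply: filterS => n.
  rewrite sub0r normrN (ger0_norm (nsq_ge0 _)) => /(le_lt_trans (ab n)).
  by rewrite distrC -[_ ^+ 2 < _]ltr_sqrt ?exprn_gt0// !sqrtr_sqr (gtr0_norm e0).
move=> h; split; apply: aux h => n.
  by apply: le_trans (Re_sqr_le _); rewrite cReD cReN.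
by apply: le_trans (Im_sqr_le _); rewrite cImD cImN.
Qed.

Lemma ccvg_eventually_cst u l n0 : (forall n, (n0 <= n)%N -> u n = l) -> ccvg u l.
Proof.
move=> h; split; apply: cvg_near_cst; exists n0 => // n /= n0n; rewrite h//.
Qed.

End ComplexLimits.

(** * Remainders of trigonometric series and termwise differentiation *)

Section TrigSeries.
Context {R : realType}.
Implicit Types (c : int -> R[i]) (a b x : R).

Lemma intr_tail_freqs_neq0 n m k : (0 < n)%N -> k \in tail_freqs n m ->
  (k%:~R : R) != 0.
Proof.
move=> n0 /mem_tail_freqs nk; rewrite intr_eq0.
by apply: contraTneq nk => ->; rewrite -ltnNge.
Qed.

(** Cauchy-Schwarz with the weights 1 / k. The factors [z] are exponentials when values are
    estimated, and normalized difference quotients of exponentials when increments are. *)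
Lemma nsq_tail_le n m c (z : int -> R[i]) Q : (0 < n)%N -> 0 <= Q ->
  (forall k, nsq (z k) <= 1) ->
  \sum_(k <- tail_freqs n m) k%:~R ^+ 2 * nsq (c k) <= Q ->
  nsq (\sum_(k <- tail_freqs n m) c k * z k) <= 4 / n%:R * Q.
Proof.
move=> n0 Q0 z1 cQ.
have E : \sum_(k <- tail_freqs n m) c k * z k =
    \sum_(k <- tail_freqs n m) ((k%:~R)^-1 : R)%:C * ((k%:~R : R)%:C * (c k * z k)).
  rewrite big_seq [RHS]big_seq; apply: eq_bigr => k /(intr_tail_freqs_neq0 n0) k0.
  by rewrite mulrA -rmorphM /= mulVf ?mul1r.
rewrite E; apply: le_trans (nsq_sum_le _ _ _ _) _.
apply: ler_pM; [by apply: sumr_ge0 => k _; exact: sqr_ge0|exact: sumr_ge0|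
  exact: sum_tail_invsq|].
apply: le_trans cQ; apply: ler_sum => k _.
rewrite !nsqM nsq_real; apply: ler_wpM2l; first exact: sqr_ge0.
by rewrite -[leRHS]mulr1; exact: ler_wpM2l.
Qed.

Lemma trig_sum_cat n m c x : (n <= m)%N ->
  trig_sum m c x = trig_sum n c x +
    \sum_(k <- tail_freqs n m) c k * expi (k%:~R * x).
Proof. exact: big_freqs_cat. Qed.

Lemma nsq_trig_remainder n c x (v : R[i]) Q : (0 < n)%N -> 0 <= Q ->
  (forall m, \sum_(k <- tail_freqs n m) k%:~R ^+ 2 * nsq (c k) <= Q) ->
  ccvg (fun m => trig_sum m c x) v ->
  nsq (v - trig_sum n c x) <= 4 / n%:R * Q.
Proof.
move=> n0 Q0 cQ cv.
have := ccvg_nsq (ccvgD cv (ccvgN (ccvg_cst (trig_sum n c x)))).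
move/cvgr_to_le; apply; exists n => // m /= nm.
rewrite (trig_sum_cat _ _ nm) addrAC subrr add0r; apply: nsq_tail_le => // k.
by rewrite nsq_expi.
Qed.

(** Cauchy-Schwarz with the weights 1 / k over all frequencies; the mean [c 0] is invisible to the
    weight k^2 and has to vanish. *)
Lemma nsq_trig_lim_le c x (v : R[i]) Q : c 0 = 0 ->
  (forall m, \sum_(k <- freqs m) k%:~R ^+ 2 * nsq (c k) <= Q) ->
  ccvg (fun m => trig_sum m c x) v -> nsq v <= 5 * Q.
Proof.
move=> c0 cQ /ccvg_nsq/cvgr_to_le; apply; apply: nearW => m.
rewrite /trig_sum.
have -> : \sum_(k <- freqs m) c k * expi (k%:~R * x) =
    \sum_(k <- freqs m) ((k%:~R)^-1 : R)%:C * ((k%:~R : R)%:C * (c k * expi (k%:~R * x))).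
  apply: eq_bigr => k _; have [->|k0] := eqVneq k 0; first by rewrite c0 mul0r !mulr0.
  by rewrite mulrA -rmorphM /= mulVf ?mul1r// intr_eq0.
apply: le_trans (nsq_sum_le _ _ _ _) _.
apply: ler_pM; [by apply: sumr_ge0 => k _; exact: sqr_ge0|exact: sumr_ge0|
  exact: sum_freqs_invsq|].
apply: le_trans (cQ m); apply: ler_sum => k _.
by rewrite !nsqM nsq_real nsq_expi mulr1.
Qed.

Lemma is_derive_cos_scaled (k x : R) :
  is_derive x 1 (fun y => cos (k * y)) (- k * sin (k * x)).
Proof. by apply: is_derive_eq; rewrite /GRing.scale /= !mulr1; ring. Qed.

Lemma is_derive_sin_scaled (k x : R) :
  is_derive x 1 (fun y => sin (k * y)) (k * cos (k * x)).
Proof. by apply: is_derive_eq; rewrite /GRing.scale /= !mulr1; ring. Qed.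

Lemma has_cslope_trig_sum a b n c x :
  has_cslope a b (trig_sum n c) x (trig_sum n (fderiv c) x).
Proof.
rewrite /trig_sum; elim: (freqs n) => [|k r IH].
  rewrite big_nil (_ : (fun _ => _) = fun=> 0); last by apply/funext => y; rewrite big_nil.
  by split => e e0; exists 1 => // y _ _; rewrite mul0r !subrr normr0 mulr_ge0// ltW.
rewrite big_cons.
under eq_fun do rewrite big_cons.
apply: has_cslopeD => //; split.
  have -> : (fun y => Re (c k * expi (k%:~R * y))) =
      (fun y => Re (c k) * cos (k%:~R * y) - Im (c k) * sin (k%:~R * y)).
    by apply/funext => y; rewrite !ReImE.
  apply: is_derive_has_slope.
  have := is_derive_cos_scaled k%:~R x; have := is_derive_sin_scaled k%:~R x => hs hc.
  by apply: is_derive_eq; rewrite /fderiv !ReImE /GRing.scale /=; ring.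
have -> : (fun y => Im (c k * expi (k%:~R * y))) =
    (fun y => Re (c k) * sin (k%:~R * y) + Im (c k) * cos (k%:~R * y)).
  by apply/funext => y; rewrite !ReImE.
apply: is_derive_has_slope.
have := is_derive_cos_scaled k%:~R x; have := is_derive_sin_scaled k%:~R x => hs hc.
by apply: is_derive_eq; rewrite /fderiv !ReImE /GRing.scale /=; ring.
Qed.

(* Increments of the remainder over [[x, y]] are [O(|y - x| / sqrt n)],
   uniformly in [y], hence so is its derivative at [x]. *)
Lemma nsq_derive_trig_remainder a b n c (f : R -> R[i]) x l Q : a < b -> x \in `[a, b] ->
  (0 < n)%N -> 0 <= Q ->
  (forall m, \sum_(k <- freqs m) k%:~R ^+ 2 * nsq (fderiv c k) <= Q) ->
  (forall y, y \in `[a, b] -> ccvg (fun m => trig_sum m c y) (f y)) ->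
  has_cslope a b f x l ->
  nsq (l - trig_sum n (fderiv c) x) <= 4 / n%:R * Q.
Proof.
move=> ab xab n0 Q0 cQ cf fl.
pose g y := f y - trig_sum n c y.
have gl : has_cslope a b g x (l - trig_sum n (fderiv c) x).
  by apply: has_cslopeD => //; apply: has_cslopeN; exact: has_cslope_trig_sum.
have gQ y : y \in `[a, b] -> nsq (g y - g x) <= 4 / n%:R * Q * (y - x) ^+ 2.
  move=> yab; have [->|yx] := eqVneq y x.
    by rewrite !subrr nsq0 expr0n /= mulr0.
  have yx0 : (y - x) ^+ 2 != 0 by rewrite sqrf_eq0 subr_eq0.
  have := ccvg_nsq (ccvgD (ccvgD (cf y yab) (ccvgN (ccvg_cst (trig_sum n c y))))
    (ccvgN (ccvgD (cf x xab) (ccvgN (ccvg_cst (trig_sum n c x)))))).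
  move/cvgr_to_le; apply; exists n => // m /= nm.
  rewrite !(trig_sum_cat _ _ nm) ![_ + _ - trig_sum n _ _]addrAC !subrr !add0r -sumrB.
  (* The difference quotient of the exponential divided by k: its modulus is at most 1, uniformly in
     k and y. *)
  pose z k : R[i] := ((k%:~R * (y - x) : R)^-1)%:C * (expi (k%:~R * y) - expi (k%:~R * x)).
  have -> : \sum_(k <- tail_freqs n m) (c k * expi (k%:~R * y) - c k * expi (k%:~R * x)) =
      (y - x)%:C * \sum_(k <- tail_freqs n m) ((k%:~R : R)%:C * c k) * z k.
    rewrite mulr_sumr big_seq [RHS]big_seq; apply: eq_bigr => k /(intr_tail_freqs_neq0 n0) k0.
    rewrite -mulrBr /z; set E := _ - expi _.
    have -> : (y - x)%:C * ((k%:~R : R)%:C * c k * (((k%:~R * (y - x))^-1 : R)%:C * E)) =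
       ((k%:~R * (y - x)) * (k%:~R * (y - x))^-1 : R)%:C * (c k * E).
      by rewrite !rmorphM /=; ring.
    by rewrite mulfV ?mul1r// mulf_neq0// subr_eq0.
  rewrite nsqM nsq_real mulrC ler_pM2r; last by rewrite lt_def yx0 sqr_ge0.
  apply: nsq_tail_le => // [k|].
    rewrite /z nsqM nsq_real exprVn.
    have [k0|k0] := eqVneq (k%:~R * (y - x)) 0.
      by rewrite k0 expr0n /= invr0 mul0r.
    rewrite mulrC ler_pdivrMr ?lt_def ?sqr_ge0 ?sqrf_eq0 ?k0// mul1r.
    by apply: le_trans (nsq_expiB_le _ _) _; rewrite -mulrBr.
  apply: le_trans (cQ m); rewrite (big_freqs_cat _ nm) ler_wpDl//.
    by apply: sumr_ge0 => k _; rewrite mulr_ge0// sqr_ge0.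
  by apply: ler_sum => k _; rewrite nsqM nsq_real nsq_fderiv.
set v := l - _ in gl *; set q := 4 / _ * _ in gQ *.
have q0 : 0 <= q by rewrite mulr_ge0// divr_ge0.
apply/ler_addgt0Pl => e e0.
(* |v|^2 <= (1 + r) q + (1 + 1/r) e' for all r, e' > 0 *)
pose r := e / (2 * (q + 1)).
have r0 : 0 < r by rewrite divr_gt0// mulr_gt0// ltr_wpDl.
pose e' := e / (2 * (1 + r^-1)).
have e'0 : 0 < e' by rewrite divr_gt0// mulr_gt0// addr_gt0// invr_gt0.
have [d d0 H] := has_cslope_nsq_le gl e'0.
have [y [yab yd yx]] : exists y, [/\ y \in `[a, b], `|y - x| < d & y - x != 0].
  pose t := Num.min d (b - a) / 2.
  have t0 : 0 < t by rewrite divr_gt0// !lt_min d0 subr_gt0.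
  have [td tba] : t < d /\ t * 2 <= b - a.
    have : t * 2 <= d by rewrite divfK// ge_min lexx.
    have : t * 2 <= b - a by rewrite divfK// !ge_min lexx !orbT.
    by move=> ? ?; split; lra.
  move: xab; rewrite in_itv /= => /andP[ax xb].
  have [xb'|xb'] := leP (x + t) b.
    exists (x + t); rewrite addrAC subrr add0r gtr0_norm// in_itv /= xb' gt_eqF// td andbT.
    by split => //; lra.
  exists (x - t); rewrite addrAC subrr add0r normrN gtr0_norm// in_itv /= td oppr_eq0 gt_eqF//.
  by split => //; apply/andP; split; lra.
have h1 := H y yab yd; have h2 := gQ y yab.
set w := y - x in h1 h2 yx.
have w0 : 0 < w ^+ 2 by rewrite lt_def sqr_ge0 sqrf_eq0 yx.
rewrite -(ler_pM2r w0) -nsq_real -nsqM.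
set D := g y - g x in h1 h2; set z := D - _ in h1.
have -> : v * w%:C = D - z by rewrite /z; ring.
have mix : nsq (D - z) <= (1 + r) * nsq D + (1 + r^-1) * nsq z.
  have := Re_mulJ_le D (- z) r0; rewrite nsqN /nsq !ReImE; lra.
apply: le_trans mix _.
have h3 : (1 + r) * nsq D <= (1 + r) * (q * w ^+ 2).
  by apply: ler_wpM2l => //; rewrite addr_ge0// ltW.
have h4 : (1 + r^-1) * nsq z <= (1 + r^-1) * (e' * w ^+ 2).
  by apply: ler_wpM2l => //; rewrite addr_ge0// invr_ge0 ltW.
have c4 : (1 + r^-1) * e' = e / 2.
  have t0 : 1 + r^-1 != 0 by rewrite gt_eqF// addr_gt0// invr_gt0.
  by rewrite /e'; move: (1 + r^-1) t0 => t t0; field.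
have c3 : r * q <= e / 2.
  rewrite /r mulrAC ler_pdivrMr; last by rewrite mulr_gt0// ltr_wpDl.
  rewrite (_ : e / 2 * _ = e * (q + 1)); last by field.
  by apply: ler_wpM2l; [exact: ltW|rewrite lerDl].
rewrite nsq_real.
apply: le_trans (lerD h3 h4) _.
rewrite (mulrA (1 + r) q) (mulrA (1 + r^-1) e') -mulrDl c4.
by apply: ler_wpM2r; [exact: ltW|lra].
Qed.

End TrigSeries.

(** * Energy inequality for convergent series *)

Section LimitEnergy.
Context {R : realType}.

Lemma ccvg_energy_density (u v w : nat -> R[i]) (l m p q : R[i]) (a b : R) :
  ccvg u l -> ccvg v m -> ccvg w p ->
  Re ((a%:C * w n + b%:C * v n + a%:C * (v n ^+ 2 + 2 * q * v n)) * conjc (u n))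
    @[n --> \oo] -->
  Re ((a%:C * p + b%:C * m + a%:C * (m ^+ 2 + 2 * q * m)) * conjc l).
Proof.
move=> ul vm wp.
have cc z := @ccvg_cst R z.
have h := ccvgM (ccvgD (ccvgD (ccvgM (cc a%:C) wp) (ccvgM (cc b%:C) vm))
  (ccvgM (cc a%:C) (ccvgD (ccvgM vm vm) (ccvgM (cc (2 * q)) vm)))) (ccvg_conj ul).
rewrite expr2; under eq_fun do rewrite expr2; exact: h.1.
Qed.

Lemma cvg_sumr (I : Type) (r : seq I) (u : I -> nat -> R) (l : I -> R) :
  (forall i, u i n @[n --> \oo] --> l i) ->
  \sum_(i <- r) u i n @[n --> \oo] --> \sum_(i <- r) l i.
Proof. by move=> ul; apply: cvg_big => //; exact: add_continuous. Qed.

Variables (N s : nat) (d : int -> R[i]) (G : R) (f : 'I_(2 * N) -> R[i]).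
Hypotheses (N0 : (0 < N)%N) (s1 : (1 <= s)%N).
Hypothesis dG : forall m, \sum_(k <- tail_freqs N m) sobolev_weight s d k <= G.
Hypothesis fE : forall j, ccvg (fun n => trig_sum n d (node j)) (f j).

(** The sizes of the windows made of complete residue classes; convergent series also converge along
    them. *)
Let idx L := (N * (2 * L).+1)%N.

Let cvg_idx : idx L @[L --> \oo] --> \oo.
Proof.
move=> P [n _ nP]; exists n => // L /= nL; apply: nP => /=.
by apply: leq_trans nL _; rewrite /idx; nia.
Qed.

Lemma energy_lim (A B W : R) (fx fxx w : 'I_(2 * N) -> R[i]) : 0 < A ->
  (forall j, ccvg (fun n => trig_sum n (fderiv d) (node j)) (fx j)) ->
  (forall j, ccvg (fun n => trig_sum n (fderiv (fderiv d)) (node j)) (fxx j)) ->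
  (forall j, nsq (f j) < 64^-1) -> (forall j, nsq (w j) <= W) ->
  \sum_(j < 2 * N) Re ((A%:C * fxx j + B%:C * fx j +
      A%:C * (fx j ^+ 2 + 2 * w j * fx j)) * conjc (f j)) <=
  (4 * W * A + A / 2 + `|B| / 2) * \sum_(j < 2 * N) nsq (f j) +
  (2 * N)%:R * ((20 * (3 / 4 * A + `|B| / 2) + 5 * A / 2) *
     ((N%:R ^+ 2) ^+ s)^-1 * G).
Proof.
move=> A0 fxE fxxE f64 wW.
have fL j := ccvg_subseq cvg_idx (fE j).
have fxL j := ccvg_subseq cvg_idx (fxE j).
have fxxL j := ccvg_subseq cvg_idx (fxxE j).
apply: (@ler_cvg_to _ \oo _ _ 
  (fun L => \sum_(j < 2 * N) Re ((A%:C * trig_sum (idx L) (fderiv (fderiv d)) (node j)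
      + B%:C * trig_sum (idx L) (fderiv d) (node j)
      + A%:C * (trig_sum (idx L) (fderiv d) (node j) ^+ 2
                + 2 * w j * trig_sum (idx L) (fderiv d) (node j)))
      * conjc (trig_sum (idx L) d (node j))))
  (fun L => (4 * W * A + A / 2 + `|B| / 2) *
      \sum_(j < 2 * N) nsq (trig_sum (idx L) d (node j)) +
     (2 * N)%:R * ((20 * (3 / 4 * A + `|B| / 2) + 5 * A / 2) *
       ((N%:R ^+ 2) ^+ s)^-1 * G))).
- by apply: cvg_sumr => j; exact: ccvg_energy_density.
- apply: cvgD; last exact: cvg_cst.
  by apply: cvgM; [exact: cvg_cst|apply: cvg_sumr => j]; exact: ccvg_nsq.
(* The strict inequality at the limit passes to partial sums with large L, at all the nodes at
   once. *)
have near64 := @filter_forall _ _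
  (fun j L => nsq (trig_sum (idx L) d (node j)) <= 64^-1) \oo _
  (fun j => cvgr_le _ (ccvg_nsq (fL j)) _ (f64 j)).
apply: filterS (near64 _ _) => L hL.
exact: (energy_trig_sum N0 s1 (dG (idx L)) B A0 hL wW).
Qed.

Lemma low_freqs_lim :
  (2 * N)%:R * \sum_(k <- freqs N) nsq (d k) <=
  2 * \sum_(j < 2 * N) nsq (f j) + (2 * N)%:R * (10 * ((N%:R ^+ 2) ^+ s)^-1 * G).
Proof.
have fL j := ccvg_subseq cvg_idx (fE j).
apply: (@cvgr_to_ge _ \oo _ _
  (fun L => 2 * \sum_(j < 2 * N) nsq (trig_sum (idx L) d (node j)) +
     (2 * N)%:R * (10 * ((N%:R ^+ 2) ^+ s)^-1 * G))).
  apply: cvgD; last exact: cvg_cst.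
  by apply: cvgM; [exact: cvg_cst|apply: cvg_sumr => j]; exact: ccvg_nsq.
by apply: nearW => L; exact: (low_freqs_le N0 s1 (dG (idx L))).
Qed.

End LimitEnergy.

(** * Integrals over a period *)

Section Integration.
Context {R : realType}.
Implicit Types (v w : R -> R[i]) (z : R[i]).

Notation mu := (@lebesgue_measure R).
Notation D := (@period R).

Lemma measurable_period : measurable (D : set (measurableTypeR R)).
Proof. exact: measurable_itv. Qed.

Lemma measure_period : mu D = (2 * pi)%:E.
Proof.
rewrite lebesgue_measure_itv /= lte_fin mulr_gt0 ?pi_gt0//.
by rewrite oppr0 adde0.
Qed.

Definition cmeasurable v : Prop :=
  measurable_fun (D : set (measurableTypeR R)) (fun x : measurableTypeR R => Re (v x)) /\
  measurable_fun (D : set (measurableTypeR R)) (fun x : measurableTypeR R => Im (v x)).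

Definition cintegrable v : Prop :=
  mu.-integrable D (fun x => (Re (v x))%:E) /\ mu.-integrable D (fun x => (Im (v x))%:E).

Lemma cintegralD v w : cintegrable v -> cintegrable w ->
  cintegral (fun x => v x + w x) = cintegral v + cintegral w.
Proof.
move=> [v1 v2] [w1 w2]; rewrite /cintegral; apply: complexP; rewrite ?ReImE.
  by under eq_Rintegral do rewrite cReD; rewrite RintegralD//; exact: measurable_period.
by under eq_Rintegral do rewrite cImD; rewrite RintegralD//; exact: measurable_period.
Qed.

Lemma cintegralZ z v : cintegrable v -> cintegral (fun x => z * v x) = z * cintegral v.
Proof.
move=> [v1 v2]; rewrite /cintegral.
have i1 r : mu.-integrable D (fun x => (r * Re (v x))%:E).
  by under eq_fun do rewrite EFinM; apply: integrableZl => //; exact: measurable_period.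
have i2 r : mu.-integrable D (fun x => (r * Im (v x))%:E).
  by under eq_fun do rewrite EFinM; apply: integrableZl => //; exact: measurable_period.
apply: complexP; rewrite !ReImE.
  under eq_Rintegral do rewrite cReM.
  by rewrite RintegralB ?RintegralZl//; first [exact: measurable_period|exact: i1|exact: i2].
under eq_Rintegral do rewrite cImM.
by rewrite RintegralD ?RintegralZl//; first [exact: measurable_period|exact: i1|exact: i2].
Qed.

Lemma cintegrableD v w : cintegrable v -> cintegrable w -> cintegrable (fun x => v x + w x).
Proof.
move=> [v1 v2] [w1 w2]; split.
  by under eq_fun do rewrite cReD EFinD; apply: integrableD => //; exact: measurable_period.
by under eq_fun do rewrite cImD EFinD; apply: integrableD => //; exact: measurable_period.
Qed.

Lemma cintegrableZ z v : cintegrable v -> cintegrable (fun x => z * v x).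
Proof.
move=> [v1 v2]; split.
  under eq_fun do rewrite cReM EFinB !EFinM.
  by apply: integrableB; [exact: measurable_period|..]; apply: integrableZl => //; exact: measurable_period.
under eq_fun do rewrite cImM EFinD !EFinM.
by apply: integrableD; [exact: measurable_period|..]; apply: integrableZl => //; exact: measurable_period.
Qed.

Lemma cintegrable0 : cintegrable (fun=> 0).
Proof. by split; exact: integrable0. Qed.

Lemma cintegral0 : cintegral (fun=> 0 : R[i]) = 0.
Proof.
by apply: complexP; rewrite /cintegral !ReImE Rintegral_cst ?mul0r//; exact: measurable_period.
Qed.

Lemma cintegrable_sum (I : Type) (r : seq I) (F : I -> R -> R[i]) :
  (forall i, cintegrable (F i)) -> cintegrable (fun x => \sum_(i <- r) F i x).
Proof.
move=> Fi; elim: r => [|i r IH].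
  by under eq_fun do rewrite big_nil; exact: cintegrable0.
by under eq_fun do rewrite big_cons; exact: cintegrableD.
Qed.

Lemma cintegral_sum (I : Type) (r : seq I) (F : I -> R -> R[i]) :
  (forall i, cintegrable (F i)) ->
  cintegral (fun x => \sum_(i <- r) F i x) = \sum_(i <- r) cintegral (F i).
Proof.
move=> Fi; elim: r => [|i r IH].
  by under eq_fun do rewrite big_nil; rewrite big_nil cintegral0.
under eq_fun do rewrite big_cons; rewrite big_cons cintegralD ?IH//.
exact: cintegrable_sum.
Qed.

Lemma eq_cintegral v w : (forall x, x \in `[0, 2 * pi] -> v x = w x) ->
  cintegral v = cintegral w.
Proof.
by move=> vw; rewrite /cintegral; congr (_ +i* _); apply: eq_Rintegral => x /[!inE] xD;
  rewrite vw.
Qed.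

Lemma cmeasurableD v w : cmeasurable v -> cmeasurable w -> cmeasurable (fun x => v x + w x).
Proof.
move=> [v1 v2] [w1 w2]; split.
  by under eq_fun do rewrite cReD; exact: measurable_funD.
by under eq_fun do rewrite cImD; exact: measurable_funD.
Qed.

Lemma cmeasurableM v w : cmeasurable v -> cmeasurable w -> cmeasurable (fun x => v x * w x).
Proof.
move=> [v1 v2] [w1 w2]; split.
  by under eq_fun do rewrite cReM; apply: measurable_funB; exact: measurable_funM.
by under eq_fun do rewrite cImM; apply: measurable_funD; exact: measurable_funM.
Qed.

Lemma cmeasurable_cst z : cmeasurable (fun=> z).
Proof. by split; exact: measurable_cst. Qed.

Lemma cmeasurableB v w : cmeasurable v -> cmeasurable w -> cmeasurable (fun x => v x - w x).
Proof.
move=> [v1 v2] [w1 w2]; split.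
  by under eq_fun do rewrite cReD cReN; exact: measurable_funB.
by under eq_fun do rewrite cImD cImN; exact: measurable_funB.
Qed.

Lemma measurable_nsq v : cmeasurable v ->
  measurable_fun (D : set (measurableTypeR R)) (fun x : measurableTypeR R => nsq (v x)).
Proof. by move=> [v1 v2]; apply: measurable_funD; exact: measurable_funX. Qed.

Lemma within_cmeasurable v : {within D, continuous (fun x => Re (v x))} ->
  {within D, continuous (fun x => Im (v x))} -> cmeasurable v.
Proof.
by move=> h1 h2; split; apply: subspace_continuous_measurable_fun => //; exact: measurable_period.
Qed.

Lemma cmeasurable_expi (k : R) : cmeasurable (fun x => expi (k * x)).
Proof.
apply: within_cmeasurable; apply: continuous_subspaceT => x /=.
  have := is_derive_cos_scaled k x => h.
  exact/differentiable_continuous/derivable1_diffP.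
have := is_derive_sin_scaled k x => h.
exact/differentiable_continuous/derivable1_diffP.
Qed.

Lemma nsq_integrable v : cmeasurable v ->
  (\int[mu]_(x in D) (nsq (v x))%:E < +oo)%E ->
  mu.-integrable D (fun x => (nsq (v x))%:E).
Proof.
move=> vm vI; apply/integrableP; split.
  by apply/measurable_EFinP; exact: measurable_nsq.
by under eq_integral do rewrite abse_EFin ger0_norm//.
Qed.

Lemma bounded_nsq_integrable v (M : R) : cmeasurable v ->
  (forall x, x \in `[0, 2 * pi] -> nsq (v x) <= M) ->
  mu.-integrable D (fun x => (nsq (v x))%:E).
Proof.
move=> vm vM; apply: measurable_bounded_integrable.
- exact: measurable_period.
- exact: (eq_ind_r (fun y => (y < +oo)%E) (ltry _) measure_period).
- exact: measurable_nsq.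
by exists M; split; [exact: num_real|move=> y My x xD /=; rewrite ger0_norm//; apply: le_trans (vM x xD) (ltW My)].
Qed.

(* |v w| <= |v|^2 + |w|^2 *)
Lemma cintegrableM v w : cmeasurable v -> cmeasurable w ->
  mu.-integrable D (fun x => (nsq (v x))%:E) ->
  mu.-integrable D (fun x => (nsq (w x))%:E) -> cintegrable (fun x => v x * w x).
Proof.
move=> vm wm vI wI.
have [m1 m2] := cmeasurableM vm wm.
have I : mu.-integrable D (fun x => (nsq (v x) + nsq (w x))%:E).
  by under eq_fun do rewrite EFinD; apply: integrableD => //; exact: measurable_period.
have bnd x (y : R) : y ^+ 2 <= nsq (v x * w x) -> `|y| <= `|nsq (v x) + nsq (w x)|.
  rewrite nsqM; move: (nsq_ge0 (v x)) (nsq_ge0 (w x)).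
  move: (nsq (v x)) (nsq (w x)) => a b a0 b0 h.
  by rewrite (ger0_norm (addr_ge0 a0 b0)) ler_norml; apply/andP; split; nra.
split; apply: le_integrable I; [exact: measurable_period|exact/measurable_EFinP| |
  exact: measurable_period|exact/measurable_EFinP|] => x _ /=; rewrite lee_fin; apply: bnd.
  exact: Re_sqr_le.
exact: Im_sqr_le.
Qed.

Lemma nsq_expi_integrable (k : R) : mu.-integrable D (fun x => (nsq (expi (k * x)))%:E).
Proof.
apply: (@bounded_nsq_integrable _ 1) => [|x _]; [exact: cmeasurable_expi|].
by rewrite nsq_expi.
Qed.

Lemma cintegral_expi (k : int) :
  cintegral (fun x : R => expi (k%:~R * x)) = if k == 0 then (2 * pi)%:C else 0.
Proof.
have p0 : 0 < 2 * pi :> R by rewrite mulr_gt0 ?pi_gt0.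
have ccos y : {for y, continuous (fun x : R => cos (k%:~R * x))}.
  have := is_derive_cos_scaled k%:~R y => h.
  exact/differentiable_continuous/derivable1_diffP.
have csin y : {for y, continuous (fun x : R => sin (k%:~R * x))}.
  have := is_derive_sin_scaled k%:~R y => h.
  exact/differentiable_continuous/derivable1_diffP.
case: eqVneq => [->|k0].
  under eq_fun do rewrite mulr0z mul0r expi0.
  apply: complexP; rewrite /cintegral !ReImE Rintegral_cst ?mul1r ?mul0r//; try exact: measurable_period.
  by rewrite -[RHS]/(fine (2 * pi)%:E); congr fine; exact: measure_period.
have kR : (k%:~R : R) != 0 by rewrite intr_eq0.
have s2 : sin (k%:~R * (2 * pi : R)) = 0.
  by have := @expi_int_2pi R k; move/(congr1 (@complex.Im R)).
have c2 : cos (k%:~R * (2 * pi : R)) = 1.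
  by have := @expi_int_2pi R k; move/(congr1 (@complex.Re R)).
apply: complexP; rewrite /cintegral !ReImE /Rintegral.
  rewrite (@continuous_FTC2 _ _ (fun x => k%:~R^-1 * sin (k%:~R * x)))//.
  - by rewrite s2 !mulr0 sin0 mulr0 -EFinD subrr.
  - exact: continuous_subspaceT.
  - split.
    + move=> x _; have := is_derive_sin_scaled k%:~R x => h; exact: derivableZ.
    + by apply: cvg_at_right_filter; apply: cvgMl_tmp; exact: csin.
    + by apply: cvg_at_left_filter; apply: cvgMl_tmp; exact: csin.
  - move=> x _; have h := is_derive_sin_scaled k%:~R x.
    by rewrite derive1E derive_val /GRing.scale /= mulKf.
rewrite (@continuous_FTC2 _ _ (fun x => - k%:~R^-1 * cos (k%:~R * x)))//.
- by rewrite c2 !mulr0 cos0 -EFinD subrr.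
- exact: continuous_subspaceT.
- split.
  + move=> x _; have := is_derive_cos_scaled k%:~R x => h; exact: derivableZ.
  + by apply: cvg_at_right_filter; apply: cvgMl_tmp; exact: ccos.
  + by apply: cvg_at_left_filter; apply: cvgMl_tmp; exact: ccos.
- move=> x _; have h := is_derive_cos_scaled k%:~R x.
  by rewrite derive1E derive_val /GRing.scale /=; field.
Qed.

End Integration.

(** * Fourier coefficients *)

Section Fourier.
Context {R : realType}.
Implicit Types (v w f : R -> R[i]) (c d : int -> R[i]).

Notation mu := (@lebesgue_measure R).
Notation D := (@period R).

Definition fourier w (k : int) : R[i] :=
  ((2 * pi)^-1)%:C * cintegral (fun x => w x * expi (- (k%:~R * x))).

Let tpi : 2 * pi != 0 :> R.
Proof. by rewrite mulf_neq0 ?gt_eqF ?pi_gt0. Qed.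

Lemma cintegral_fourier w k :
  cintegral (fun x => w x * expi (- (k%:~R * x))) = (2 * pi)%:C * fourier w k.
Proof. by rewrite /fourier mulrA -rmorphM /= divff// mul1r. Qed.

Definition square_integrable w : Prop :=
  cmeasurable w /\ mu.-integrable D (fun x => (nsq (w x))%:E).

Lemma square_integrable_expi (k : R) : square_integrable (fun x => expi (k * x)).
Proof. by split; [exact: cmeasurable_expi|exact: nsq_expi_integrable]. Qed.

Lemma square_integrable_expiN (k : int) :
  square_integrable (fun x : R => expi (- (k%:~R * x))).
Proof. by under eq_fun do rewrite -mulNr; exact: square_integrable_expi. Qed.

Lemma cintegrable_mul v w : square_integrable v -> square_integrable w ->
  cintegrable (fun x => v x * w x).
Proof. by move=> [? ?] [? ?]; exact: cintegrableM. Qed.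

Lemma bounded_square_integrable w (M : R) : cmeasurable w ->
  (forall x, x \in `[0, 2 * pi] -> nsq (w x) <= M) -> square_integrable w.
Proof. by move=> wm wM; split => //; exact: bounded_nsq_integrable wM. Qed.

Lemma cmeasurable_trig_sum n c : cmeasurable (trig_sum n c).
Proof.
rewrite /trig_sum; elim: (freqs n) => [|k r IH].
  by under eq_fun do rewrite big_nil; exact: cmeasurable_cst.
under eq_fun do rewrite big_cons; apply: cmeasurableD => //.
by apply: cmeasurableM; [exact: cmeasurable_cst|exact: cmeasurable_expi].
Qed.

Lemma conj_trig_sum n c x :
  conjc (trig_sum n c x) = \sum_(k <- freqs n) conjc (c k) * expi (- (k%:~R * x)).
Proof.
rewrite /trig_sum rmorph_sum; apply: eq_bigr => k _; rewrite rmorphM.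
by congr (_ * _); exact: conj_expi.
Qed.

Lemma cintegral_mul_conj_trig_sum n c w : square_integrable w ->
  cintegral (fun x => w x * conjc (trig_sum n c x)) =
  (2 * pi)%:C * \sum_(k <- freqs n) fourier w k * conjc (c k).
Proof.
move=> wI; under eq_fun do rewrite conj_trig_sum mulr_sumr.
have kI k : cintegrable (fun x => w x * expi (- (k%:~R * x))).
  exact/cintegrable_mul/square_integrable_expiN.
have kI' k : cintegrable (fun x => w x * (conjc (c k) * expi (- (k%:~R * x)))).
  by under eq_fun do rewrite mulrCA; exact: cintegrableZ.
rewrite cintegral_sum// mulr_sumr; apply: eq_bigr => k _.
by under eq_fun do rewrite mulrCA; rewrite cintegralZ// cintegral_fourier; ring.
Qed.

Lemma fourier_trig_sum n c (m : 'I_(n.*2)) :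
  fourier (trig_sum n c) (m%:Z - n%:Z) = c (m%:Z - n%:Z).
Proof.
rewrite /fourier; under eq_fun do rewrite /trig_sum big_freqs mulr_suml.
have E (j : 'I_(n.*2)) : (fun x : R => c (j%:Z - n%:Z) * expi ((j%:Z - n%:Z)%:~R * x)
    * expi (- ((m%:Z - n%:Z)%:~R * x))) =
    (fun x => c (j%:Z - n%:Z) * expi ((j%:Z - m%:Z)%:~R * x)).
  apply/funext => x; rewrite -mulrA -expiD; congr (_ * expi _).
  by rewrite -mulrBl -rmorphB /=; congr (_%:~R * _); lia.
have I (k : int) : cintegrable (fun x : R => expi (k%:~R * x)).
  under eq_fun do rewrite -[expi _]mul1r.
  apply: cintegrable_mul; last exact: square_integrable_expi.
  apply: (@bounded_square_integrable _ 1) => [|x _]; first exact: cmeasurable_cst.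
  by rewrite -[1]/(1%:C) nsq_real expr1n.
rewrite cintegral_sum => [|j]; last by rewrite E; exact: cintegrableZ.
rewrite (bigD1 m)//= big1 => [|j jm]; rewrite E cintegralZ// cintegral_expi.
  by rewrite subrr eqxx addr0 mulrCA -rmorphM /= mulVf// mulr1.
rewrite subr_eq0 ifF ?mulr0//; apply/negbTE; apply: contra jm => /eqP[] /val_inj ->.
exact: eqxx.
Qed.

Lemma square_integrable_trig_sum n c : square_integrable (trig_sum n c).
Proof.
split; first exact: cmeasurable_trig_sum.
pose C := (\sum_(k <- freqs n) 1 ^+ 2) * \sum_(k <- freqs n) nsq (c k).
apply: (@bounded_nsq_integrable _ _ C) => [|x _]; first exact: cmeasurable_trig_sum.
rewrite /trig_sum; under eq_bigr do rewrite -[c _ * _]mul1r -[1]/(1%:C).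
apply: le_trans (nsq_sum_le _ _ _ _) _.
by under [X in _ * X <= _]eq_bigr do rewrite nsqM nsq_expi mulr1.
Qed.

Lemma Parseval_trig_sum n c :
  \int[mu]_(x in D) nsq (trig_sum n c x) = 2 * pi * \sum_(k <- freqs n) nsq (c k).
Proof.
have := cintegral_mul_conj_trig_sum n c (square_integrable_trig_sum n c).
move/(congr1 (@complex.Re R)); rewrite {1}/cintegral Re_mk.
under [in LHS]eq_Rintegral do rewrite mulcJ Re_real.
move=> ->; rewrite !ReImE mul0r subr0 cRe_sum; congr (_ * _).
rewrite !big_freqs; apply: eq_bigr => m _.
by rewrite fourier_trig_sum mulcJ.
Qed.

(** Expand the integral of |w - T|^2 >= 0 for the partial sum T of the Fourier series of w: the
    cross term is twice the squared norm of T. *)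
Lemma Bessel n w : square_integrable w ->
  2 * pi * \sum_(k <- freqs n) nsq (fourier w k) <= \int[mu]_(x in D) nsq (w x).
Proof.
move=> wI; pose T := trig_sum n (fourier w).
have TI : square_integrable T := square_integrable_trig_sum _ _.
have TcI : square_integrable (fun x => conjc (T x)).
  split.
    case: TI => -[t1 t2] _; split; first by under eq_fun do rewrite cRe_conj.
    by under eq_fun do rewrite cIm_conj; exact: measurable_funN.
  by under eq_fun do rewrite nsqJ; case: TI.
have mD := @measurable_period R.
have [wTI _] := cintegrable_mul wI TcI.
have E x : nsq (w x - T x) = nsq (w x) + nsq (T x) - 2 * Re (w x * conjc (T x)).
  by rewrite /nsq !ReImE; ring.
have : 0 <= \int[mu]_(x in D) nsq (w x - T x) by exact: Rintegral_ge0.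
under eq_Rintegral do rewrite E.
have I2 : mu.-integrable D (fun x => (2 * Re (w x * conjc (T x)))%:E).
  by under eq_fun do rewrite EFinM; exact: integrableZl.
have I1 : mu.-integrable D (fun x => (nsq (w x) + nsq (T x))%:E).
  by under eq_fun do rewrite EFinD; apply: integrableD => //; [case: wI|case: TI].
rewrite RintegralB// RintegralD//; [|by case: wI|by case: TI].
rewrite RintegralZl//.
have -> : \int[mu]_(x in D) Re (w x * conjc (T x)) =
    2 * pi * \sum_(k <- freqs n) nsq (fourier w k).
  have := cintegral_mul_conj_trig_sum n (fourier w) wI.
  move/(congr1 (@complex.Re R)); rewrite {1}/cintegral Re_mk => ->.
  rewrite !ReImE mul0r subr0 cRe_sum; congr (_ * _).
  by apply: eq_bigr => k _; rewrite mulcJ.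
by rewrite Parseval_trig_sum; lra.
Qed.

(** The Riemann-Lebesgue lemma in L^2: by Bessel, this is the general term of a convergent
    series. *)
Lemma fourier_cvg0 w : square_integrable w ->
  nsq (fourier w (- (n.+1)%:Z)) + nsq (fourier w n%:Z) @[n --> \oo] --> 0.
Proof.
move=> wI; apply: cvg_series_cvg_0.
pose S n := \sum_(k <- freqs n) nsq (fourier w k).
have -> : series (fun n => nsq (fourier w (- (n.+1)%:Z)) + nsq (fourier w n%:Z)) = S.
  by apply/funext => n; rewrite /series /S /= big_tail_freqs.
apply: nondecreasing_is_cvgn.
  move=> n m nm; rewrite /S (big_freqs_cat _ nm) lerDl.
  exact: sumr_ge0.
exists ((2 * pi)^-1 * \int[mu]_(x in D) nsq (w x)) => _ [n _ <-].
by rewrite ler_pdivlMl ?mulr_gt0 ?pi_gt0//; exact: Bessel.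
Qed.

Lemma Rintegral_nsq_le w (M : R) : cmeasurable w ->
  (forall x, x \in `[0, 2 * pi] -> nsq (w x) <= M) ->
  \int[mu]_(x in D) nsq (w x) <= 2 * pi * M.
Proof.
move=> wm wM; have wI := bounded_square_integrable wm wM.
apply: (@le_trans _ _ (\int[mu]_(x in D) M)).
  apply: le_Rintegral => //; first exact: measurable_period.
  - by case: wI.
  - apply: measurable_bounded_integrable; [exact: measurable_period|
      exact: (eq_ind_r (fun y => (y < +oo)%E) (ltry _) measure_period)|
      exact: measurable_cst|].
    by exists `|M|; split; [exact: num_real|move=> y My x _ /=; exact: ltW].
rewrite Rintegral_cst; last exact: measurable_period.
by rewrite [leLHS]mulrC (_ : fine _ = 2 * pi)// -[RHS]/(fine (2 * pi)%:E); congr fine; exact: measure_period.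
Qed.

Lemma nsq_fourier_le w (M : R) k : cmeasurable w ->
  (forall x, x \in `[0, 2 * pi] -> nsq (w x) <= M) -> nsq (fourier w k) <= M.
Proof.
move=> wm wM; have wI := bounded_square_integrable wm wM.
have p0 : 0 < 2 * pi :> R by rewrite mulr_gt0 ?pi_gt0.
have kn : exists n, exists m : 'I_(n.*2), k = m%:Z - n%:Z.
  exists `|k|.+1; have h : (`|(k + (`|k|.+1)%:Z)%R| < (`|k|.+1).*2)%N by lia.
  by exists (Ordinal h) => /=; lia.
case: kn => n [m ->].
apply: (@le_trans _ _ (\sum_(k <- freqs n) nsq (fourier w k))).
  by rewrite big_freqs (bigD1 m)//= lerDl sumr_ge0.
rewrite -(ler_pM2l p0); apply: le_trans (Bessel n wI) _.
exact: Rintegral_nsq_le.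
Qed.

End Fourier.

(** * Pointwise convergence of the Fourier series of periodic Lipschitz functions *)

Section Chernoff.
Context {R : realType}.
Implicit Types (f : R -> R[i]).

(** Up to pi / 4 the cosine exceeds 1/2, and the mean value theorem applies; beyond, the sine
    exceeds 1/2 whereas y < 2. *)
Lemma sin_ge_quarter (y : R) : 0 <= y <= pi / 2 -> y / 4 <= sin y.
Proof.
move=> /andP[]; rewrite le_eqVlt => /predU1P[<- _|y0 yp].
  by rewrite sin0 mul0r.
have p2 := @pihalf_lt2 R; have p0 := pi_gt0 R.
have c4 : cos (pi / 4 : R) ^+ 2 = 2^-1.
  have := @cos_mulr2n R (pi / 4); rewrite (_ : pi / 4 *+ 2 = pi / 2); last by rewrite -mulr_natr; field.
  by rewrite cos_pihalf -mulr_natr; lra.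
have c40 : 0 < cos (pi / 4 : R) by apply: cos_gt0_pihalf; lra.
have s40 : 0 < sin (pi / 4 : R) by apply: sin_gt0_pihalf; lra.
have s4 : sin (pi / 4 : R) ^+ 2 = 2^-1 by rewrite sin2cos2 c4; lra.
have half (z : R) : 0 < z -> z ^+ 2 = 2^-1 -> 2^-1 < z by move=> z0 zz; rewrite ltNge; apply/negP => zle; nra.
have {}c4 := half _ c40 c4; have {}s4 := half _ s40 s4.
have [y4|y4] := leP y (pi / 4).
  have [|c /[!in_itv]/= /andP[c0 cy]] := @MVT R sin cos 0 y y0 (fun y _ => is_derive_sin y).
    by apply: continuous_subspaceT => z; exact: continuous_sin.
  rewrite sin0 !subr0 => ->.
  have : cos (pi / 4) < cos c by rewrite ltr_cos ?in_itv /=; lra.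
  by move=> h; rewrite mulrC; apply: ler_wpM2r; lra.
have : sin (pi / 4) < sin y by rewrite ltr_sin ?in_itv /=; lra.
lra.
Qed.

(** The minimum is the distance of t to 0 on the circle. The right-hand side is 4 sin(t / 2)^2, and
    [sin_ge_quarter] at t / 2 or at pi - t / 2 bounds this sine below by an eighth of the
    minimum. *)
Lemma nsq_expiB1_ge (t : R) : 0 <= t <= 2 * pi ->
  Num.min t (2 * pi - t) ^+ 2 / 16 <= nsq (expi t - 1).
Proof.
move=> /andP[t0 t2]; have p0 := pi_gt0 R.
suff : 0 <= Num.min t (2 * pi - t) /\ Num.min t (2 * pi - t) / 8 <= sin (t / 2).
  by move=> [m0 h]; rewrite nsq_expiB1; nra.
have [tp|tp] := leP t (2 * pi - t).
  by split => //; have := @sin_ge_quarter (t / 2); lra.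
split; first lra.
have -> : sin (t / 2) = sin (pi - t / 2) by rewrite sinB sinpi cospi; lra.
by have := @sin_ge_quarter (pi - t / 2); lra.
Qed.

Definition clipschitz (M : R) f := forall x y, x \in `[0, 2 * pi] -> y \in `[0, 2 * pi] ->
  `|Re (f x) - Re (f y)| <= M * `|x - y| /\ `|Im (f x) - Im (f y)| <= M * `|x - y|.

Variables (f : R -> R[i]) (M : R).
Hypotheses (fM : clipschitz M f) (f2pi : f 0 = f (2 * pi)).

Let p0 : 0 < 2 * pi :> R. Proof. by rewrite mulr_gt0 ?pi_gt0. Qed.

Let D0 : 0 \in `[0 : R, 2 * pi]. Proof. by rewrite in_itv /= lexx ltW. Qed.
Let D2 : 2 * pi \in `[0 : R, 2 * pi]. Proof. by rewrite in_itv /= lexx ltW. Qed.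

Let M0 : 0 <= M.
Proof.
have [h _] := fM D0 D2; have := le_trans (normr_ge0 _) h.
by rewrite pmulr_lge0// normr_gt0 sub0r oppr_eq0 gt_eqF.
Qed.

(** As f 0 = f(2 pi), one may also go from x to x0 through the end points, so that f is Lipschitz
    for the distance on the circle; each of the two components contributes 16 M^2. *)
Lemma nsq_clipschitz_le x x0 : x \in `[0, 2 * pi] -> x0 \in `[0, 2 * pi] ->
  nsq (f x - f x0) <= 32 * M ^+ 2 * nsq (expi (x - x0) - 1).
Proof.
wlog xx0 : x x0 / x0 <= x.
  move=> H xD x0D; have [h|/ltW h] := leP x0 x; first exact: H.
  rewrite -nsqN opprB; apply: le_trans (H _ _ h x0D xD) _.
  by rewrite !nsq_expiB1 -(opprB x0) mulNr sinN sqrrN.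
move=> xD x0D; have [r1 i1] := fM xD x0D.
have [r2 i2] := fM xD D2; have [r3 i3] := fM D0 x0D.
move: xD x0D; rewrite !in_itv /= => /andP[x0' x2] /andP[x00 x02].
have t0 : 0 <= x - x0 <= 2 * pi by lra.
have := nsq_expiB1_ge t0.
have E1 : `|x - x0| = x - x0 by rewrite ger0_norm ?subr_ge0.
have E2 : `|x - 2 * pi| = - (x - 2 * pi) by rewrite ler0_norm ?subr_le0.
have E3 : `|0 - x0| = - (0 - x0) by rewrite ler0_norm ?subr_le0.
rewrite E1 in r1 i1; rewrite E2 in r2 i2; rewrite E3 in r3 i3.
have bnd (a b c d : R) : b = d -> `|a - c| <= M * (x - x0) -> `|a - b| <= M * - (x - 2 * pi) ->
   `|d - c| <= M * - (0 - x0) -> (a - c) ^+ 2 <= M ^+ 2 * Num.min (x - x0) (2 * pi - (x - x0)) ^+ 2.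
  move=> -> h1 h2 h3; rewrite -exprMn -[leLHS]real_normK ?num_real//.
  apply: lerXn2r; rewrite ?nnegrE//.
    by apply: mulr_ge0 => //; rewrite le_min; apply/andP; split; lra.
  rewrite minr_pMr// le_min h1 /= (_ : a - c = (a - d) + (d - c)); last by ring.
  apply: le_trans (ler_normD _ _) _; lra.
have hr := bnd _ _ _ _ (congr1 (@complex.Re R) (esym f2pi)) r1 r2 r3.
have hi := bnd _ _ _ _ (congr1 (@complex.Im R) (esym f2pi)) i1 i2 i3.
have MM : 0 <= M ^+ 2 by exact: sqr_ge0.
have E : nsq (f x - f x0) = (Re (f x) - Re (f x0)) ^+ 2 + (Im (f x) - Im (f x0)) ^+ 2.
  by rewrite /nsq !ReImE.
move=> /(ler_wpM2l MM) hm; rewrite E; lra.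
Qed.

Lemma clipschitz_cmeasurable : cmeasurable f.
Proof.
have cont (g : R -> R) : (forall x y, x \in `[0, 2 * pi] -> y \in `[0, 2 * pi] ->
    `|g x - g y| <= M * `|x - y|) -> {within `[0, 2 * pi], continuous g}.
  move=> gM; apply/subspace_continuousP => x xD; apply/cvgrPdist_le => e e0.
  have M1 : 0 < M + 1 by rewrite ltr_wpDl.
  rewrite near_withinE; apply/nbhs_ballP; exists (e / (M + 1)); first by rewrite /= divr_gt0.
  move=> y; rewrite /ball /= ltr_pdivlMr// => h yD.
  by apply: le_trans (gM _ _ xD yD) _; have := normr_ge0 (x - y); nra.
by apply: within_cmeasurable; apply: cont => x y xD yD; case: (fM xD yD).
Qed.

Variable x0 : R.
Hypothesis x0D : x0 \in `[0, 2 * pi].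

(* Chernoff's argument: [f - f x0 = g h] with [g] bounded, so that up to the phase
   [G] the Fourier coefficients of [f - f x0] telescope. *)
Let h x := expi (x - x0) - 1 : R[i].
Let g x := ((nsq (h x))^-1)%:C * ((f x - f x0) * conjc (h x)).

Let gh x : x \in `[0, 2 * pi] -> f x = f x0 + g x * h x.
Proof.
move=> xD; rewrite /g -mulrA -(mulrA (f x - f x0)) (mulrC (conjc _)) mulcJ mulrCA -rmorphM /=.
(* Where h vanishes the default 0^-1 = 0 makes g vanish too, and f x = f x0 by
   [nsq_clipschitz_le]. *)
have [h0|h0] := eqVneq (nsq (h x)) 0; last by rewrite mulVf// mulr1 subrKC.
rewrite h0 mulr0 mulr0 addr0; apply/eqP; rewrite -subr_eq0; apply/eqP; apply: nsq_eq0.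
apply/eqP; rewrite eq_le nsq_ge0 andbT.
by apply: le_trans (nsq_clipschitz_le xD x0D) _; rewrite -/(h x) h0 mulr0.
Qed.

Let g_le x : x \in `[0, 2 * pi] -> nsq (g x) <= 32 * M ^+ 2.
Proof.
move=> xD; rewrite /g !nsqM nsq_real nsqJ.
have [h0|h0] := eqVneq (nsq (h x)) 0.
  by rewrite h0 !mulr0 mulr_ge0// sqr_ge0.
have hp : 0 < nsq (h x) by rewrite lt_def h0 nsq_ge0.
rewrite (_ : _ * _ = nsq (f x - f x0) / nsq (h x)); last by field.
by rewrite ler_pdivrMr//; exact: nsq_clipschitz_le.
Qed.

Let hE x : h x = expi (- x0) * expi (1 * x) - 1.
Proof. by rewrite /h mul1r (addrC x) expiD. Qed.

Let h_cmeasurable : cmeasurable h.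
Proof.
rewrite (_ : h = fun x => expi (- x0) * expi (1 * x) - 1); last exact/funext.
apply: cmeasurableB; last exact: cmeasurable_cst.
by apply: cmeasurableM; [exact: cmeasurable_cst|exact: cmeasurable_expi].
Qed.

Let g_cmeasurable : cmeasurable g.
Proof.
apply: cmeasurableM.
  split; last by exact: measurable_cst.
  rewrite (_ : (fun _ => _) = (fun x => nsq (h x) `^ (-1))).
    exact: (measurableT_comp (measurable_powR (-1)) (measurable_nsq h_cmeasurable)).
  by apply/funext => x; rewrite Re_real powR_inv1.
apply: cmeasurableM.
  by apply: cmeasurableB; [exact: clipschitz_cmeasurable|exact: cmeasurable_cst].
have [h1 h2] := h_cmeasurable; split; first by under eq_fun do rewrite cRe_conj.
by under eq_fun do rewrite cIm_conj; exact: measurable_funN.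
Qed.

Let gI : square_integrable g := bounded_square_integrable g_cmeasurable g_le.

Let G (k : int) : R[i] := expi (k%:~R * x0) * fourier g k.

(** Multiplication by e^{ix} shifts the Fourier coefficients of g by one, and the phase contained in
    [G] turns g h into an exact difference. In partial sums only two end terms remain, which tend to
    0 by [fourier_cvg0]. *)
Let fourier_telescope k : fourier f k * expi (k%:~R * x0) =
  (if k == 0 then f x0 else 0) + (G (k - 1) - G k).
Proof.
have gk (l : int) : cintegrable (fun x => g x * expi (- (l%:~R * x))).
  exact/cintegrable_mul/square_integrable_expiN.
have ek : cintegrable (fun x : R => expi ((- k)%:~R * x)).
  under eq_fun do rewrite -[expi _]mul1r.
  apply: cintegrable_mul; last exact: square_integrable_expi.
  by have := @square_integrable_expi R 0; under eq_fun do rewrite mul0r expi0.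
have tp : (2 * pi)^-1 * (2 * pi) = 1 :> R by rewrite mulVf// gt_eqF.
rewrite {1}/fourier (@eq_cintegral _ _ (fun x => f x0 * expi ((- k)%:~R * x) +
   (expi (- x0) * (g x * expi (- ((k - 1)%:~R * x))) + - 1 * (g x * expi (- (k%:~R * x)))))).
  rewrite !(cintegralD, cintegralZ)//; do ?[apply: cintegrableD|apply: cintegrableZ] => //.
  rewrite cintegral_expi !cintegral_fourier oppr_eq0 /G.
  have -> : expi ((k - 1)%:~R * x0) = expi (- x0) * expi (k%:~R * x0).
    by rewrite -expiD rmorphB /=; congr expi; ring.
  have c1 : ((2 * pi)^-1)%:C * (2 * pi)%:C = 1 :> R[i] by rewrite -rmorphM /= tp.
  move: (fourier g (k - 1)) (fourier g k) c1 => a b.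
  move: ((2 * pi)^-1)%:C (2 * pi)%:C => P Q PQ.
  case: eqVneq => [->|_]; last first.
    set E := expi (k%:~R * x0); set F := expi (- x0).
    transitivity ((P * Q) * (F * E * a - E * b)); first by ring.
    by rewrite PQ; ring.
  rewrite mulr0z mul0r expi0; set F := expi (- x0).
  transitivity ((P * Q) * (f x0 + (F * a - b))); first by ring.
  by rewrite PQ; ring.
move=> x xD; rewrite {1}(gh xD) hE mul1r.
have e1 : expi (- ((k - 1)%:~R * x)) = expi (- (k%:~R * x)) * expi x.
  by rewrite -expiD rmorphB /=; congr expi; ring.
have e2 : expi ((- k)%:~R * x) = expi (- (k%:~R * x)) by rewrite rmorphN mulNr.
by rewrite e1 e2; ring.
Qed.

Let trig_sumS n : trig_sum n.+1 (fourier f) x0 = f x0 + (G (- (n.+2)%:Z) - G n%:Z).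
Proof.
rewrite /trig_sum; elim: n => [|n IH].
  rewrite big_freqsS big_freqs0 !fourier_telescope add0r /=.
  rewrite (_ : - 1%:Z - 1 = - 2%:Z); last by lia.
  rewrite (_ : 0 - 1 = - 1%:Z); last by lia.
  by move: (G (- 2%:Z)) (G (- 1%:Z)) (G 0) (f x0) => a b c y; ring.
rewrite big_freqsS IH !fourier_telescope.
have -> : (- (n.+2)%:Z == 0) = false by lia.
have -> : ((n.+1)%:Z == 0) = false by lia.
have -> : - (n.+2)%:Z - 1 = - (n.+3)%:Z by lia.
have -> : (n.+1)%:Z - 1 = n%:Z by lia.
move: (G _) (G _) (G _) (G _) (f x0) => a b c d y; ring.
Qed.

Lemma fourier_clipschitz_cvg : ccvg (fun n => trig_sum n (fourier f) x0) (f x0).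
Proof.
suff : ccvg (fun n => trig_sum n.+1 (fourier f) x0) (f x0).
  move=> [h1 h2]; split; rewrite -cvg_shiftS; [exact: h1|exact: h2].
apply: ccvg_nsq_lim0.
have u0 := fourier_cvg0 gI.
have [u1 u2] : nsq (fourier g (- (n.+1)%:Z)) @[n --> \oo] --> 0 /\
    nsq (fourier g n%:Z) @[n --> \oo] --> 0.
  by split; apply: (squeeze_cvgr _ (cvg_cst 0) u0); apply: nearW => n; rewrite nsq_ge0 /= ?lerDl ?lerDr.
have u3 : 2 * nsq (fourier g (- (n.+2)%:Z)) + 2 * nsq (fourier g n%:Z) @[n --> \oo] --> 0.
  rewrite -[X in _ --> X]addr0 -[X in _ --> X + _](mulr0 2) -[X in _ --> _ + X](mulr0 2).
  apply: cvgD; apply: cvgMl_tmp => //.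
  by move: u1; rewrite -cvg_shiftS.
apply: (squeeze_cvgr _ (cvg_cst 0) u3); apply: nearW => n; rewrite nsq_ge0 /=.
rewrite trig_sumS addrAC subrr add0r; apply: le_trans (le_nsqD _ _) _.
by rewrite nsqN /G !(nsqM (expi _)) !nsq_expi !mul1r.
Qed.

(** A bound uniform in [n] and [x0], used for dominated convergence: each of the two end terms of
    the telescoping sum contributes 2 * 32 M^2. *)
Lemma nsq_fourier_clipschitz_remainder n :
  nsq (trig_sum n.+1 (fourier f) x0 - f x0) <= 128 * M ^+ 2.
Proof.
rewrite trig_sumS addrAC subrr add0r; apply: le_trans (le_nsqD _ _) _.
rewrite nsqN /G !(nsqM (expi _)) !nsq_expi !mul1r.
have := nsq_fourier_le n%:Z g_cmeasurable g_le.
have := nsq_fourier_le (- (n.+2)%:Z) g_cmeasurable g_le.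
lra.
Qed.

End Chernoff.

(** * Uniqueness of Fourier coefficients *)

Section Uniqueness.
Context {R : realType}.
Implicit Types (f w v : R -> R[i]).

Notation mu := (@lebesgue_measure R).
Notation D := (@period R).

Let mD := @measurable_period R.

Lemma square_integrableD v w : square_integrable v -> square_integrable w ->
  square_integrable (fun x => v x + w x).
Proof.
move=> [v1 v2] [w1 w2]; have vw := cmeasurableD v1 w1; split => //.
have I : mu.-integrable D (fun x => (2 * nsq (v x) + 2 * nsq (w x))%:E).
  under eq_fun do rewrite EFinD !EFinM.
  by apply: integrableD => //; exact: integrableZl.
apply: le_integrable I => //; first by apply/measurable_EFinP; exact: measurable_nsq.
move=> x _ /=; rewrite lee_fin ger0_norm// ger0_norm; first exact: le_nsqD.
by rewrite addr_ge0// mulr_ge0.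
Qed.

Lemma square_integrableN w : square_integrable w -> square_integrable (fun x => - w x).
Proof.
move=> [[w1 w2] w3]; split; last by under eq_fun do rewrite nsqN.
split; first by under eq_fun do rewrite cReN; exact: measurable_funN.
by under eq_fun do rewrite cImN; exact: measurable_funN.
Qed.

Lemma square_integrable_conj w : square_integrable w ->
  square_integrable (fun x => conjc (w x)).
Proof.
move=> [[w1 w2] w3]; split; last by under eq_fun do rewrite nsqJ.
split; first by under eq_fun do rewrite cRe_conj.
by under eq_fun do rewrite cIm_conj; exact: measurable_funN.
Qed.

Lemma Rintegral_nsqD_le v w : square_integrable v -> square_integrable w ->
  \int[mu]_(x in D) nsq (v x + w x) <=
  2 * (\int[mu]_(x in D) nsq (v x)) + 2 * (\int[mu]_(x in D) nsq (w x)).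
Proof.
move=> vI wI; have [_ vwI] := square_integrableD vI wI.
case: vI wI => [_ vI] [_ wI].
have v2 : mu.-integrable D (fun x => (2 * nsq (v x))%:E).
  by under eq_fun do rewrite EFinM; exact: integrableZl.
have w2 : mu.-integrable D (fun x => (2 * nsq (w x))%:E).
  by under eq_fun do rewrite EFinM; exact: integrableZl.
rewrite -!RintegralZl// -RintegralD//; apply: le_Rintegral => //.
  have : mu.-integrable D (fun x => (2 * nsq (v x) + 2 * nsq (w x))%:E).
    by under eq_fun do rewrite EFinD; exact: integrableD.
  exact.
by move=> x _; exact: le_nsqD.
Qed.

Lemma L2normE w : square_integrable w ->
  L2norm w = (Num.sqrt (\int[mu]_(x in D) nsq (w x)))%:E.
Proof.
move=> [_ wI]; rewrite /L2norm -powR12_sqrt; last exact: Rintegral_ge0.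
by rewrite -poweR_EFin /Rintegral fineK//; exact: integrable_fin_num.
Qed.

Lemma inL2_square_integrable w : inL2 w -> square_integrable w.
Proof.
move=> [w1 w2 wI]; split => //; apply: nsq_integrable => //.
by apply: (@lty_poweRy _ _ 2^-1) => //; rewrite invr_eq0 pnatr_eq0.
Qed.

Lemma square_integrable_inL2 w : square_integrable w -> inL2 w.
Proof. by move=> wI; case: (wI) => [[w1 w2] _]; split => //; rewrite L2normE// ltry. Qed.

(** The function w is orthogonal to every trigonometric sum, hence to f by dominated convergence
    along the Fourier series of f. *)
Lemma cintegral_orthogonal_clipschitz w f (M K : R) : square_integrable w ->
  (forall k, fourier w k = 0) -> clipschitz M f -> f 0 = f (2 * pi) ->
  (forall x, x \in `[0, 2 * pi] -> nsq (f x) <= K) ->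
  \int[mu]_(x in D) Re (w x * conjc (f x)) = 0.
Proof.
move=> wI w0 fM f2 fK.
have fI := bounded_square_integrable (clipschitz_cmeasurable fM) fK.
pose T n := trig_sum n.+1 (fourier f).
have wTI n : cintegrable (fun x => w x * conjc (T n x)).
  exact: cintegrable_mul (square_integrable_conj (square_integrable_trig_sum _ _)).
have wfI : cintegrable (fun x => w x * conjc (f x)).
  exact: cintegrable_mul (square_integrable_conj fI).
have T0 n : \int[mu]_(x in D) Re (w x * conjc (T n x)) = 0.
  have := cintegral_mul_conj_trig_sum n.+1 (fourier f) wI.
  by move/(congr1 (@complex.Re R)); rewrite {1}/cintegral Re_mk => ->;
    rewrite big1 ?mulr0// => k _; rewrite w0 mul0r.
(* Domination by |w|^2 + |T|^2, where |T|^2 <= 2 |T - f|^2 + 2 |f|^2 is bounded uniformly in n. *)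
pose G x := (nsq (w x) + (2 * (128 * M ^+ 2) + 2 * K))%:E.
have GI : mu.-integrable D G.
  rewrite /G; under eq_fun do rewrite EFinD; apply: integrableD => //; first by case: wI.
  apply: measurable_bounded_integrable => //.
    exact: (eq_ind_r (fun y => (y < +oo)%E) (ltry _) measure_period).
  by exists `|2 * (128 * M ^+ 2) + 2 * K|; split; [exact: num_real|move=> y My x _ /=; exact: ltW].
have [] := @dominated_convergence _ _ _ mu D mD
  (fun n x => (Re (w x * conjc (T n x)))%:E) (fun x => (Re (w x * conjc (f x)))%:E) G.
- by move=> n; apply/measurable_EFinP; case: (wTI n) => /measurable_int/measurable_EFinP.
- by apply/measurable_EFinP; case: wfI => /measurable_int/measurable_EFinP.
- apply: aeW => x xD; apply: cvg_EFin; first exact: nearW.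
  have := fourier_clipschitz_cvg fM f2 xD => h.
  have [] := ccvgM (ccvg_cst (w x)) (ccvg_conj h).
  by rewrite -cvg_shiftS.
- exact: GI.
- apply: aeW => x n xD; rewrite /G lee_fin.
  have TK : nsq (T n x) <= 2 * (128 * M ^+ 2) + 2 * K.
    rewrite -[T n x](subrK (f x)); apply: le_trans (le_nsqD _ _) _.
    have := nsq_fourier_clipschitz_remainder fM f2 xD n; have := fK x xD.
    by rewrite -/(T n x); lra.
  have a1 := Re_mulJ_le (w x) (T n x) ltr01.
  have a2 := Re_mulJ_le (- w x) (T n x) ltr01.
  rewrite invr1 mul1r mulNr cReN nsqN in a2; rewrite invr1 mul1r in a1.
  have := nsq_ge0 (w x); have := nsq_ge0 (T n x).
  by rewrite ler_norml; move=> *; apply/andP; split; lra.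
move=> _ _ cv.
have cst0 : [sequence (\int[mu]_(x in D) (Re (w x * conjc (T n x)))%:E)%E]_n = fun=> 0%E.
  apply/funext => n /=; rewrite -[LHS]fineK; first by rewrite -/(Rintegral _ _ _) T0.
  by apply: integrable_fin_num => //; case: (wTI n).
rewrite cst0 in cv.
have h := cvg_unique (@ereal_hausdorff R) cv (cvg_cst (0%E : \bar R)).
by rewrite /Rintegral h.
Qed.

Lemma dist_min_le (a b c : R) : `|Num.min a b - Num.min a c| <= `|b - c|.
Proof.
have := ler_norm (b - c); have := ler_norm (c - b); rewrite (distrC c b) => h1 h2.
by rewrite ler_norml; case: (leP a b) => ?; case: (leP a c) => ?; apply/andP; split; lra.
Qed.

Lemma dist_max_le (a b c : R) : `|Num.max a b - Num.max a c| <= `|b - c|.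
Proof.
have := ler_norm (b - c); have := ler_norm (c - b); rewrite (distrC c b) => h1 h2.
by rewrite ler_norml; case: (leP a b) => ?; case: (leP a c) => ?; apply/andP; split; lra.
Qed.

(** A trapezoid of height at most 1 with sides of slope [n], supported in [0, b]. For b <= 2 pi it
    vanishes at both ends of the period, hence is periodic and Lipschitz. *)
Definition tent (b : R) (n : nat) (x : R) : R :=
  Num.min 1 (n%:R * Num.max 0 (Num.min x (b - x))).

Lemma tent_lipschitz b n x y : `|tent b n x - tent b n y| <= n%:R * `|x - y|.
Proof.
apply: le_trans (dist_min_le _ _ _) _.
rewrite -mulrBr normrM normr_nat; apply: ler_wpM2l => //.
apply: le_trans (dist_max_le _ _ _) _.
have := ler_norm (x - y); have := ler_norm (y - x); rewrite (distrC y x) => h1 h2.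
by rewrite ler_norml; case: (leP x (b - x)) => ?; case: (leP y (b - y)) => ?; apply/andP; split; lra.
Qed.

Lemma tent_bounds b n x : 0 <= tent b n x <= 1.
Proof.
by rewrite /tent ge_min lexx le_min ler01 mulr_ge0//= le_max lexx.
Qed.

Lemma tent_outside b n x : x <= 0 \/ b <= x -> tent b n x = 0.
Proof.
move=> h; rewrite /tent; have -> : Num.max 0 (Num.min x (b - x)) = 0.
  by apply: max_l; rewrite ge_min subr_le0; apply/orP.
by rewrite mulr0 min_r.
Qed.

Lemma tent_cvg b x : tent b n x @[n --> \oo] --> ((if 0 < x < b then 1 else 0) : R).
Proof.
case: ifPn => [/andP[x0 xb]|]; last first.
  rewrite negb_and -!leNgt => /orP h.
  by under eq_fun do rewrite (tent_outside _ h); exact: cvg_cst.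
have m0 : 0 < Num.min x (b - x) by rewrite lt_min x0 subr_gt0.
apply: cvg_near_cst; near=> n; rewrite /tent max_r ?ltW//; apply: min_l.
rewrite -ler_pdivrMr//; near: n; exact: nbhs_infty_ger.
Unshelve. all: by end_near. Qed.

(* Tents converge to the indicator of [(0, b)], so that the primitive of [q]
   vanishes. *)
Lemma ae_eq0_tents (q : R -> R) : mu.-integrable D (fun x => (q x)%:E) ->
  (forall b n, b <= 2 * pi -> \int[mu]_(x in D) (q x * tent b n x) = 0) ->
  ae_eq mu D q (cst 0).
Proof.
move=> qI q0.
have qm : measurable_fun D q by move/measurable_int/measurable_EFinP : qI.
have p0 : 0 < 2 * pi :> R by rewrite mulr_gt0 ?pi_gt0.
have Q b : 0 < b -> b <= 2 * pi -> \int[mu]_(x in `[0, b]) q x = 0.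
  move=> b0 b2; pose A := `]0, b[%classic : set R.
  have AD : A `<=` D.
    by move=> x; rewrite /A /period /= !in_itv /= => /andP[/ltW -> /ltW xb]; exact: le_trans b2.
  have tI n : measurable_fun D (tent b n : measurableTypeR R -> R).
    apply: subspace_continuous_measurable_fun => //; apply: continuous_subspaceT => x.
    apply/cvgrPdist_le => e e0; apply/nbhs_ballP; exists (e / n.+1%:R); first by rewrite /= divr_gt0.
    move=> y; rewrite /ball /= ltr_pdivlMr// => h; apply: le_trans (tent_lipschitz _ _ _ _) _.
    by rewrite -natr1 in h; have := normr_ge0 (x - y); lra.
  have [] := @dominated_convergence _ _ _ mu D mD
    (fun n x => (q x * tent b n x)%:E) (fun x => ((q \_ A) x)%:E) (fun x => `|(q x)%:E|%E).
  - by move=> n; apply/measurable_EFinP; exact: (measurable_funM qm (tI n)).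
  - apply/measurable_EFinP; apply/(measurable_restrict _ _ mD); first exact: measurable_itv.
    by apply: measurable_funS qm => //; move=> x [].
  - apply: aeW => x xD; apply: cvg_EFin; first exact: nearW.
    have -> : (q \_ A) x = q x * (if 0 < x < b then 1 else 0).
      rewrite patchE /A; case: ifPn => [|/negP]; rewrite inE /= in_itv /=.
        by move=> ->; rewrite mulr1.
      by move/negP/negbTE => ->; rewrite mulr0.
    exact: cvgM (cvg_cst (q x)) (@tent_cvg b x).
  - exact: integrable_abse.
  - apply: aeW => x n xD; rewrite lee_fin normrM ler_piMr//.
    by have := tent_bounds b n x; rewrite ler_norml; lra.
  move=> rI _ cv.
  have cst0 : [sequence (\int[mu]_(x in D) (q x * tent b n x)%:E)%E]_n = fun=> 0%E.
    apply/funext => n /=; rewrite -[LHS]fineK; first by rewrite -/(Rintegral _ _ _) q0.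
    apply: integrable_fin_num => //; apply: le_integrable qI => //.
      by apply/measurable_EFinP; exact: (measurable_funM qm (tI n)).
    move=> x _ /=; rewrite lee_fin normrM ler_piMr//.
    by have := tent_bounds b n x; rewrite ler_norml; lra.
  rewrite cst0 in cv.
  have h := cvg_unique (@ereal_hausdorff R) cv (cvg_cst (0%E : \bar R)).
  have {}h : \int[mu]_(x in A) q x = 0.
    by rewrite -(setIidr AD) Rintegral_mkcondr /Rintegral h.
  have I1 : mu.-integrable A (EFin \o q).
    exact: (integrableS mD (measurable_itv _) AD qI).
  have I2 : mu.-integrable `[0, b[ (EFin \o q).
    apply: (integrableS mD (measurable_itv _) _ qI).
    by move=> x; rewrite /period /= !in_itv /= => /andP[-> /ltW xb]; exact: le_trans b2.
  by rewrite -(Rintegral_itv_bndo_bndc I2) -(Rintegral_itv_obnd_cbnd I1).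
(* Extended by 0, q has a primitive starting at -oo; intersecting with the period cuts the interval
   at min(x, 2 pi), where [Q] applies. *)
pose qq := q \_ D.
have qqI : mu.-integrable setT (EFin \o qq).
  have /(integrable_mkcond _ mD) := qI.
  by rewrite (restrict_EFin q).
have F0 x : \int[mu]_(t in `]-oo, x]) qq t = 0.
  rewrite /qq -Rintegral_mkcondr.
  have -> : `]-oo, x]%classic `&` D = `[0, Num.min x (2 * pi)]%classic.
    apply/seteqP; split => y; rewrite /period /= !in_itv /= le_min.
      by move=> [-> /andP[-> ->]].
    by move=> /andP[-> /andP[-> ->]].
  have [b0|b0|<-] := ltgtP 0 (Num.min x (2 * pi)).
  - by apply: Q => //; rewrite ge_min lexx orbT.
  - by rewrite set_itv_ge ?Rintegral_set0// bnd_simp -ltNge.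
  - by rewrite set_itv1 Rintegral_set1.
have loc : locally_integrable setT qq.
  split; [by move/measurable_int/measurable_EFinP : qqI|exact: openT|].
  move=> K _ Kc; have KI : mu.-integrable K (EFin \o qq).
    by apply: integrableS qqI => //; exact: compact_measurable.
  by have [_] := integrableP _ _ _ KI.
have yI y : mu.-integrable `]-oo, y]%classic (EFin \o qq).
  by apply: integrableS qqI => //; exact: measurable_itv.
(* Lebesgue differentiation: almost everywhere [qq] is the derivative of its primitive, which is
   identically 0 by [F0]. *)
have := @FTC1Ny R qq yI loc.
apply: filterS; first exact: (ae_filter_ringOfSetsType mu).
move=> x [_ dF] xD.
rewrite /= -[RHS](derive1_cst (0 : R) x) -[LHS]/(q x).
transitivity (qq x); first by rewrite /qq patchE mem_set.
rewrite -dF; congr (derive1 _ x); exact/funext.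
Qed.

(** Testing w against a tent multiplied by 1, then by i, isolates its real and imaginary parts. *)
Lemma fourier_eq0_nsq w : square_integrable w -> (forall k, fourier w k = 0) ->
  \int[mu]_(x in D) nsq (w x) = 0.
Proof.
move=> wI w0; have [[m1 m2] wI2] := wI.
have p0 : 0 < 2 * pi :> R by rewrite mulr_gt0 ?pi_gt0.
have one : square_integrable (fun=> 1 : R[i]).
  by have := @square_integrable_expi R 0; under eq_fun do rewrite mul0r expi0.
have [i1 i2] : cintegrable w.
  by have := cintegrable_mul wI one; under eq_fun do rewrite mulr1.
have tentE (z : R[i]) b n : nsq z = 1 -> b <= 2 * pi ->
    \int[mu]_(x in D) Re (w x * conjc ((tent b n x)%:C * z)) = 0.
  move=> z1 b2; apply: (@cintegral_orthogonal_clipschitz w _ n%:R 1) => //.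
  - have zle (a : R) : a ^+ 2 <= 1 -> `|a| <= 1.
      by move=> h; rewrite -(ler_pXn2r (isT : (0 < 2)%N)) ?nnegrE// real_normK ?num_real// expr1n.
    have r1 : `|Re z| <= 1 by apply: zle; rewrite -z1 Re_sqr_le.
    have r2 : `|Im z| <= 1 by apply: zle; rewrite -z1 Im_sqr_le.
    move=> x y _ _; rewrite !ReImE !mul0r !subr0 !addr0 -!mulrBl !normrM.
    have := tent_lipschitz b n x y; have := normr_ge0 (tent b n x - tent b n y).
    by move=> t0 t1; split; apply: le_trans t1; rewrite ler_piMr.
  - by rewrite !tent_outside ?mul0r//; [right|left].
  - move=> x _; rewrite nsqM nsq_real z1 mulr1.
    by have := tent_bounds b n x; move=> /andP[t0 t1]; rewrite expr_le1.
have h1 : ae_eq mu D (fun x => Re (w x)) (cst 0).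
  apply: ae_eq0_tents => // b n b2.
  have := tentE 1 b n _ b2; rewrite -{1}[1]/(1%:C) nsq_real expr1n => /(_ erefl) <-.
  by apply: eq_Rintegral => x _; rewrite [_%:C * 1]mulr1 !ReImE; ring.
have h2 : ae_eq mu D (fun x => Im (w x)) (cst 0).
  apply: ae_eq0_tents => // b n b2.
  have := tentE (0 +i* 1) b n _ b2; rewrite {1}/nsq !ReImE expr0n expr1n add0r => /(_ erefl) <-.
  by apply: eq_Rintegral => x _; rewrite !ReImE; ring.
rewrite /Rintegral; have -> : (\int[mu]_(x in D) (nsq (w x))%:E = \int[mu]_(x in D) 0)%E.
  apply: ae_eq_integral => //.
    by move/measurable_int : wI2.
  apply: filterS2 h1 h2 => x h1 h2 xD.
  by rewrite /nsq (h1 xD) (h2 xD) expr0n addr0.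
by rewrite integral0.
Qed.

End Uniqueness.

(** * Weak derivatives *)

Section WeakDerivatives.
Context {R : realType}.
Implicit Types (v w phi : R -> R[i]).

Notation mu := (@lebesgue_measure R).
Notation D := (@period R).

Let mD := @measurable_period R.

Lemma is_derive_Re_expi (z : R[i]) (k x : R) :
  is_derive x 1 (fun y => Re (z * expi (k * y))) (Re ((0 +i* k) * z * expi (k * x))).
Proof.
have hs := is_derive_sin_scaled k x; have hc := is_derive_cos_scaled k x.
under eq_fun do rewrite cReM Re_mk Im_mk.
by apply: is_derive_eq; rewrite !ReImE /GRing.scale /=; ring.
Qed.

Lemma derivable_Re_expi (z : R[i]) (k x : R) :
  derivable (fun y => Re (z * expi (k * y))) x 1.
Proof. by case: (is_derive_Re_expi z k x). Qed.

Lemma derive1n_Re_expi m (z : R[i]) (k : R) :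
  derive1n m (fun y => Re (z * expi (k * y))) =
  fun y => Re ((0 +i* k) ^+ m * z * expi (k * y)).
Proof.
elim: m => [|m IH]; first by rewrite derive1n0; under [RHS]eq_fun do rewrite expr0 mul1r.
rewrite derive1nS IH; apply/funext => y; rewrite derive1E.
have h := is_derive_Re_expi ((0 +i* k) ^+ m * z) k y.
by rewrite derive_val exprS !mulrA.
Qed.

Lemma Im_as_Re (z : R[i]) : Im z = Re ((0 -i* 1) * z).
Proof. by rewrite !ReImE; ring. Qed.

Lemma derivable_Im_expi (z : R[i]) (k x : R) :
  derivable (fun y => Im (z * expi (k * y))) x 1.
Proof.
have -> : (fun y => Im (z * expi (k * y))) = (fun y => Re ((0 -i* 1) * z * expi (k * y))).
  by apply/funext => y; rewrite Im_as_Re mulrA.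
exact: derivable_Re_expi.
Qed.

Lemma derive1n_Im_expi m (z : R[i]) (k : R) :
  derive1n m (fun y => Im (z * expi (k * y))) =
  fun y => Im ((0 +i* k) ^+ m * z * expi (k * y)).
Proof.
under eq_fun do rewrite Im_as_Re mulrA; rewrite derive1n_Re_expi.
by under [RHS]eq_fun do rewrite Im_as_Re; apply/funext => y; congr complex.Re; ring.
Qed.

Lemma cderiv_expi m (k x : R) :
  cderiv m (fun y => expi (k * y)) x = (0 +i* k) ^+ m * expi (k * x).
Proof.
rewrite /cderiv; under [fun y => Re _]eq_fun do rewrite -[expi _]mul1r.
under [fun y => Im _]eq_fun do rewrite -[expi _]mul1r.
rewrite derive1n_Re_expi derive1n_Im_expi; apply: complexP; rewrite ?Re_mk ?Im_mk;
  by rewrite mulr1.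
Qed.

Lemma test_function_expi (k : int) : test_function (fun x : R => expi (k%:~R * x)).
Proof.
split.
- move=> m x; under [fun y => Re _]eq_fun do rewrite -[expi _]mul1r.
  rewrite derive1n_Re_expi.
  exact: derivable_Re_expi.
- move=> m x; under [fun y => Im _]eq_fun do rewrite -[expi _]mul1r.
  rewrite derive1n_Im_expi; exact: derivable_Im_expi.
by move=> x; rewrite mulrDr expiD expi_int_2pi mulr1.
Qed.

Lemma square_integrable_cderiv m phi : test_function phi ->
  square_integrable (cderiv m phi).
Proof.
move=> [h1 h2 _].
have c1 : continuous (derive1n m (fun y => Re (phi y))).
  by move=> x; apply/differentiable_continuous/derivable1_diffP; exact: h1.
have c2 : continuous (derive1n m (fun y => Im (phi y))).
  by move=> x; apply/differentiable_continuous/derivable1_diffP; exact: h2.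
split; first by apply: within_cmeasurable; exact: continuous_subspaceT.
apply: (@continuous_compact_integrable R (fun x => nsq (cderiv m phi x))).
  exact: segment_compact.
have -> : (fun x => nsq (cderiv m phi x)) =
    (fun x => derive1n m (fun y => Re (phi y)) x * derive1n m (fun y => Re (phi y)) x +
              derive1n m (fun y => Im (phi y)) x * derive1n m (fun y => Im (phi y)) x).
  by apply/funext => x; rewrite /nsq /cderiv Re_mk Im_mk !expr2.
apply: continuous_subspaceT => x.
by apply: cvgD; apply: cvgM; first [exact: c1|exact: c2].
Qed.

Lemma cderiv0 phi : cderiv 0 phi = phi.
Proof. by apply/funext => x; rewrite /cderiv /derive1n /=; case: (phi x). Qed.

Lemma square_integrable_test phi : test_function phi -> square_integrable phi.
Proof. by move=> /(square_integrable_cderiv 0); rewrite cderiv0. Qed.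

(** Take e^{-ikx} as test function: the sign in (-ik)^m cancels that of the definition of the weak
    derivative. *)
Lemma fourier_pderiv m v w k : inL2 v -> is_pderiv m v w ->
  fourier w k = (0 +i* k%:~R) ^+ m * fourier v k.
Proof.
move=> /inL2_square_integrable vI [/inL2_square_integrable wI /(_ _ (test_function_expi (- k)))].
under eq_fun do rewrite cderiv_expi rmorphN /= mulNr mulrCA.
under [X in _ = _ * cintegral X -> _]eq_fun do rewrite rmorphN /= mulNr.
rewrite cintegralZ; last exact/cintegrable_mul/square_integrable_expiN.
have -> : (0 +i* - k%:~R : R[i]) ^+ m = (-1) ^+ m * (0 +i* k%:~R) ^+ m.
  by rewrite -exprNn; congr (_ ^+ m); apply: complexP; rewrite !ReImE ?oppr0.
have m1 : (-1 : R[i]) ^+ m != 0 by rewrite expf_neq0// oppr_eq0 oner_eq0.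
rewrite -mulrA => /(mulfI m1) E.
by rewrite /fourier -E; ring.
Qed.

Lemma sobolev_fourier_le m v w n : inL2 v -> is_pderiv m v w ->
  \sum_(k <- freqs n) (k%:~R ^+ 2) ^+ m * nsq (fourier v k) <=
  \int[mu]_(x in D) nsq (w x).
Proof.
move=> vL vw; have wI : square_integrable w by apply: inL2_square_integrable; case: vw.
have nsqX (z : R[i]) : nsq (z ^+ m) = nsq z ^+ m.
  elim: {vw} m => [|m IH]; first by rewrite !expr0 -[1]/(1%:C) nsq_real expr1n.
  by rewrite !exprS nsqM IH.
apply: le_trans (Bessel n wI).
have -> : \sum_(k <- freqs n) (k%:~R ^+ 2) ^+ m * nsq (fourier v k) =
    \sum_(k <- freqs n) nsq (fourier w k).
  apply: eq_bigr => k _; rewrite (fourier_pderiv _ vL vw) nsqM nsqX; congr (_ ^+ _ * _).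
  by rewrite /nsq !ReImE expr0n add0r.
(* The factor 2 pi of Bessel's inequality is at least 1 and is given up. *)
rewrite -[leLHS]mul1r; apply: ler_wpM2r; first exact: sumr_ge0.
have := pi_ge2 R; lra.
Qed.

(** Both have the Fourier coefficients imposed by [fourier_pderiv]. This serves because [pderiv]
    chooses a representative separately for each function, so that it respects differences only
    almost everywhere. *)
Lemma is_pderiv_unique m v w1 w2 : inL2 v -> is_pderiv m v w1 -> is_pderiv m v w2 ->
  \int[mu]_(x in D) nsq (w1 x - w2 x) = 0.
Proof.
move=> vL h1 h2.
have w1I : square_integrable w1 by apply: inL2_square_integrable; case: h1.
have w2I : square_integrable w2 by apply: inL2_square_integrable; case: h2.
apply: fourier_eq0_nsq.
  exact: square_integrableD (square_integrableN w2I).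
move=> k; rewrite /fourier.
under eq_fun do rewrite mulrDl -[- w2 _]mulN1r -mulrA.
have e1 := cintegrable_mul w1I (square_integrable_expiN k).
have e2 := cintegrable_mul w2I (square_integrable_expiN k).
rewrite cintegralD// ?cintegralZ//; last exact: cintegrableZ.
have E : fourier w1 k = fourier w2 k.
  by rewrite (fourier_pderiv k vL h1) (fourier_pderiv k vL h2).
by rewrite mulrDr mulrCA -/(fourier w1 k) -/(fourier w2 k) E mulN1r subrr.
Qed.

Lemma is_pderivB m v1 v2 w1 w2 : inL2 v1 -> inL2 v2 ->
  is_pderiv m v1 w1 -> is_pderiv m v2 w2 ->
  is_pderiv m (fun x => v1 x - v2 x) (fun x => w1 x - w2 x).
Proof.
move=> /inL2_square_integrable v1I /inL2_square_integrable v2I.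
move=> [/inL2_square_integrable w1I h1] [/inL2_square_integrable w2I h2]; split.
  exact: square_integrable_inL2 (square_integrableD w1I (square_integrableN w2I)).
have B (a b p : R -> R[i]) : square_integrable a -> square_integrable b ->
    square_integrable p -> cintegral (fun x => (a x - b x) * p x) =
    cintegral (fun x => a x * p x) - cintegral (fun x => b x * p x).
  move=> aI bI pI; have ap := cintegrable_mul aI pI; have bp := cintegrable_mul bI pI.
  under eq_fun do rewrite mulrDl -[- b _]mulN1r -mulrA.
  by rewrite cintegralD// ?cintegralZ// ?mulN1r//; exact: cintegrableZ.
move=> phi tphi; rewrite !B// ?h1// ?h2//; [by ring|exact: square_integrable_test|].
exact: square_integrable_cderiv.
Qed.

Lemma pderivP s v m : inHp s v -> (m <= s)%N -> is_pderiv m v (pderiv m v).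
Proof. by move=> [_ vs] ms; have [w vw] := vs m ms; exact: (xgetI _ vw). Qed.

Lemma inHp_pderiv_square_integrable s v m : inHp s v -> (m <= s)%N ->
  square_integrable (pderiv m v).
Proof. by move=> vs ms; apply: inL2_square_integrable; case: (pderivP vs ms). Qed.

Lemma inHpB s v1 v2 : inHp s v1 -> inHp s v2 -> inHp s (fun x => v1 x - v2 x).
Proof.
move=> h1 h2; have [v1L _] := h1; have [v2L _] := h2; split.
  apply: square_integrable_inL2; apply: square_integrableD; first exact: inL2_square_integrable.
  exact/square_integrableN/inL2_square_integrable.
move=> m ms; exists (fun x => pderiv m v1 x - pderiv m v2 x).
by apply: is_pderivB => //; exact: pderivP ms.
Qed.

(** With w, w0, wd the derivatives of v, v0, v - v0, the function w is the sum of w - w0 - wd, of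
    norm 0 by uniqueness, and of w0 + wd; two uses of |a + b|^2 <= 2 |a|^2 + 2 |b|^2 give the
    factors 4. *)
Lemma pderiv_nsq_le s v v0 m : inHp s v -> inHp s v0 -> (m <= s)%N ->
  \int[mu]_(x in D) nsq (pderiv m v x) <=
  4 * (\int[mu]_(x in D) nsq (pderiv m v0 x)) +
  4 * (\int[mu]_(x in D) nsq (pderiv m (fun y => v y - v0 y) x)).
Proof.
move=> vs v0s ms; have vv0 := inHpB vs v0s.
have [vL _] := vs; have [v0L _] := v0s; have [dL _] := vv0.
have wI := inHp_pderiv_square_integrable vs ms.
have w0I := inHp_pderiv_square_integrable v0s ms.
have wdI := inHp_pderiv_square_integrable vv0 ms.
have := is_pderiv_unique dL (is_pderivB vL v0L (pderivP vs ms) (pderivP v0s ms)) (pderivP vv0 ms).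
set w := pderiv m v in wI *; set w0 := pderiv m v0 in w0I *.
set wd := pderiv m _ in wdI * => E.
have zI : square_integrable (fun x => w x - w0 x - wd x).
  exact: square_integrableD (square_integrableD wI (square_integrableN w0I)) (square_integrableN wdI).
have aI := square_integrableD w0I wdI.
have -> : (fun x => nsq (w x)) = (fun x => nsq ((w x - w0 x - wd x) + (w0 x + wd x))).
  by apply/funext => x; congr nsq; ring.
apply: le_trans (Rintegral_nsqD_le zI aI) _; rewrite E mulr0 add0r.
have aux (X a b : R) : X <= 2 * a + 2 * b -> 2 * X <= 4 * a + 4 * b by lra.
exact: (aux _ _ _ (Rintegral_nsqD_le w0I wdI)).
Qed.

Lemma HnormE s v : inHp s v ->
  Hnorm s v = (Num.sqrt (\sum_(k < s.+1) \int[mu]_(x in D) nsq (pderiv k v x)))%:E.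
Proof.
move=> vs; rewrite /Hnorm.
have -> : (\sum_(k < s.+1) (L2norm (pderiv k v)) ^+ 2)%E =
    (\sum_(k < s.+1) \int[mu]_(x in D) nsq (pderiv k v x))%:E.
  rewrite -sumEFin; apply: eq_bigr => k _.
  rewrite L2normE; last exact: (inHp_pderiv_square_integrable vs (ltn_ord k)).
  by rewrite -EFin_expe sqr_sqrtr//; exact: Rintegral_ge0.
by rewrite poweR_EFin powR12_sqrt//; apply: sumr_ge0 => k _; exact: Rintegral_ge0.
Qed.

(** Local bounds become a global one by compactness, with the bound K as the parameter of the
    covering. *)
Lemma bounded_on_segment (T : R) (g : R -> R) :
  (forall t0, t0 \in `[0, T] -> exists K, \forall t \near within `[0, T] (nbhs t0), g t <= K) ->
  exists K, forall t, t \in `[0, T] -> g t <= K.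
Proof.
move=> H.
have := @segment_compact R 0 T => /compact_near_coveringP.
move=> /(_ R (pinfty_nbhs R) (fun K t => t \in `[0, T] -> g t <= K) _).
have loc t0 : `[0, T]%classic t0 -> \forall t \near t0 & K \near +oo, t \in `[0, T] -> g t <= K.
  move=> t0T; have [K gK] := H t0 t0T.
  rewrite near_withinE in gK.
  exists ([set t | t \in `[0, T] -> g t <= K], [set x | K <= x]) => /=.
    split; first exact: gK.
    exact: nbhs_pinfty_ge (num_real K).
  by move=> [t x] [/= h1 h2] /h1 h; exact: le_trans h2.
move=> /(_ loc) [K [_ HK]].
by exists (K + 1) => t tT; apply: (HK (K + 1)) => //; rewrite ltrDl.
Qed.

Lemma continuous_Hp_bounded (T : R) s m (v : R -> R -> R[i]) :
  continuous_Hp T s v -> (m <= s)%N ->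
  exists K, forall t, t \in `[0, T] -> \int[mu]_(x in D) nsq (pderiv m (v t) x) <= K.
Proof.
move=> [vs vc] ms; apply: bounded_on_segment => t0 t0T.
(* For t near t0 the H^s norm of v t - v t0 is less than 1, and the last term of [pderiv_nsq_le] is
   at most 4. *)
exists (4 * (\int[mu]_(x in D) nsq (pderiv m (v t0) x)) + 4).
have := vc t0 t0T => /fine_cvgP [_ /cvgrPdist_lt /(_ 1 ltr01)].
rewrite !near_withinE; apply: filterS => t h tT.
have {h} := h tT; rewrite sub0r normrN => h.
have ds := inHpB (vs t tT) (vs t0 t0T).
move: h; rewrite /= HnormE// ger0_norm ?sqrtr_ge0// => h.
apply: le_trans (pderiv_nsq_le (vs t tT) (vs t0 t0T) ms) _; rewrite lerD2l.
set S := \sum_(k < s.+1) _ in h.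
have mS : \int[mu]_(x in D) nsq (pderiv m (fun y => v t y - v t0 y) x) <= S.
  have ms' : (m < s.+1)%N by [].
  rewrite /S (bigD1 (Ordinal ms'))//= lerDl; apply: sumr_ge0 => k _; exact: Rintegral_ge0.
have S0 : 0 <= S by apply: sumr_ge0 => k _; exact: Rintegral_ge0.
have S1 : S <= 1 by rewrite -[S]sqr_sqrtr// expr_le1// ltW.
by rewrite -[leRHS]mulr1; apply: ler_wpM2l => //; exact: le_trans S1.
Qed.

(** As [fine] sends +oo to 0, the bound rests on the finiteness of the supremum, which comes from
    the boundedness in time of the three norms. *)
Lemma max_regularity_bound (T : R) s (u ut : R -> R -> R[i]) :
  continuous_Hp T s.+2 u -> continuous_Hp T s ut ->
  forall t, t \in `[0, T] ->
    \int[mu]_(x in D) nsq (pderiv s.+2 (u t) x) <= fine (max_regularity T s u ut) ^+ 2.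
Proof.
move=> uc utc t tT.
have [K1 h1] := continuous_Hp_bounded uc (leqnSn s.+1).
have [K2 h2] := continuous_Hp_bounded uc (leqnn s.+2).
have [K3 h3] := continuous_Hp_bounded utc (leqnn s).
have uI t' m : t' \in `[0, T] -> (m <= s.+2)%N -> square_integrable (pderiv m (u t')).
  by move=> t'T ms; exact: (inHp_pderiv_square_integrable (uc.1 t' t'T) ms).
have utI t' : t' \in `[0, T] -> square_integrable (pderiv s (ut t')).
  by move=> t'T; exact: (inHp_pderiv_square_integrable (utc.1 t' t'T) (leqnn s)).
set E := max_regularity T s u ut.
have bnd (K : R) (w : R -> R[i]) : square_integrable w ->
    \int[mu]_(x in D) nsq (w x) <= K -> (L2norm w <= (Num.sqrt K)%:E)%E.
  by move=> wI wK; rewrite L2normE// lee_fin ler_wsqrtr.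
have Efin : (E <= (Num.max (Num.sqrt K1) (Num.max (Num.sqrt K2) (Num.sqrt K3)))%:E)%E.
  apply: ge_ereal_sup => _ [t' t'T <-]; rewrite !EFin_max.
  rewrite !ge_max; apply/and3P; split.
  - by rewrite le_max bnd//; [exact: uI|exact: h1].
  - by rewrite !le_max (bnd K2) ?orbT//; [exact: uI|exact: h2].
  - by rewrite !le_max (bnd K3) ?orbT//; [exact: utI|exact: h3].
have LE : (L2norm (pderiv s.+2 (u t)) <= E)%E.
  apply: le_trans (ereal_sup_ubound _); last by exists t.
  by rewrite !le_max lexx orbT.
have Efn : E \is a fin_num.
  rewrite ge0_fin_numE; first by apply: le_lt_trans Efin _; exact: ltry.
  apply: le_trans LE; rewrite L2normE; first by rewrite lee_fin sqrtr_ge0.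
  exact: uI.
move: LE; rewrite -(fineK Efn) L2normE ?lee_fin; last exact: uI.
move=> LE; rewrite -[leLHS]sqr_sqrtr; last exact: Rintegral_ge0.
by apply: lerXn2r => //; rewrite nnegrE ?sqrtr_ge0//; exact: le_trans (sqrtr_ge0 _) LE.
Qed.

End WeakDerivatives.

(** * Fourier series of the solution at a fixed time *)

Section FixedTime.
Context {R : realType}.
Implicit Types (f v vx vxx : R -> R[i]).

Notation mu := (@lebesgue_measure R).
Notation D := (@period R).

Lemma slope_lipschitz (a b M : R) (f f' : R -> R) :
  (forall x, x \in `[a, b] -> has_slope a b f x (f' x)) ->
  (forall x, x \in `[a, b] -> `|f' x| <= M) ->
  forall x y, x \in `[a, b] -> y \in `[a, b] -> `|f x - f y| <= M * `|x - y|.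
Proof.
move=> ff' f'M x y; wlog xy : x y / x <= y.
  move=> H xab yab; have [h|/ltW h] := leP x y; first exact: H.
  by rewrite distrC (distrC x); exact: H.
move=> xab yab; move: xy; rewrite le_eqVlt => /predU1P[->|xy].
  by rewrite !subrr normr0 mulr0.
move: (xab) (yab); rewrite !in_itv /= => /andP[ax xb] /andP[ay yb].
have [z zxy| |z zxy E] := @MVT R f f' x y xy.
- apply: (@has_slope_is_derive _ a b); last apply: ff'.
    by move: zxy; rewrite !in_itv /=; lra.
  by move: zxy; rewrite !in_itv /=; lra.
- apply: continuous_subspaceW (has_slope_within ff').
  by move=> z; rewrite /= !in_itv /=; lra.
rewrite distrC E normrM (distrC x) ler_wpM2r// f'M//.
by move: zxy; rewrite !in_itv /=; lra.
Qed.

Lemma within_bounded (a b : R) (f : R -> R) : {within `[a, b], continuous f} ->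
  exists M, forall x, x \in `[a, b] -> `|f x| <= M.
Proof.
move=> fc; have [ab|ba] := leP a b; last first.
  by exists 0 => x; rewrite in_itv /=; lra.
have [c _ fc1] := EVT_max ab fc; have [d _ fd1] := EVT_min ab fc.
exists (Num.max (`|f c|) (`|f d|)) => x xab.
have := fc1 x xab; have := fd1 x xab.
have := ler_norm (f c); have := ler_norm (- f d); rewrite normrN le_max ler_norml ler_norml.
by case: (leP (`|f c|) (`|f d|)) => ? *; apply/orP; [right|left]; apply/andP; split; lra.
Qed.

Lemma ccvg_inv_bound (u : nat -> R[i]) (l : R[i]) (Q : R) :
  (forall n, (0 < n)%N -> nsq (l - u n) <= 4 / n%:R * Q) -> ccvg u l.
Proof.
move=> h; suff : ccvg (fun n => u n.+1) l.
  by move=> [h1 h2]; split; rewrite -cvg_shiftS; [exact: h1|exact: h2].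
apply: ccvg_nsq_lim0.
have c0 : 4 * Q * (n.+1%:R)^-1 @[n --> \oo] --> (0 : R).
  by rewrite -[X in _ --> X](mulr0 (4 * Q)); apply: cvgMl_tmp; exact: cvg_harmonic.
apply: (squeeze_cvgr _ (cvg_cst 0) c0); apply: nearW => n; rewrite nsq_ge0 /=.
by rewrite -nsqN opprB; apply: le_trans (h n.+1 isT) _; rewrite mulrAC.
Qed.

Lemma intr_sqr_pow_le (k : int) (i j : nat) : (0 < i)%N -> (i <= j)%N ->
  (k%:~R ^+ 2 : R) ^+ i <= (k%:~R ^+ 2) ^+ j.
Proof.
move=> i0 ij; have [->|k0] := eqVneq k 0.
  by rewrite !mulr0z !expr0n /= (gtn_eqF i0) (gtn_eqF (leq_trans i0 ij)).
apply: ler_weXn2l => //; rewrite -rmorphXn /= ler1z.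
rewrite expr2; have [k1|k1] : k <= -1 \/ 1 <= k by lia.
  nia.
nia.
Qed.

Section Regular.
Variables (s : nat) (v vx vxx : R -> R[i]) (G : R).
Hypotheses (s1 : (1 <= s)%N) (vs : inHp s.+2 v).
Hypothesis vG : \int[mu]_(x in D) nsq (pderiv s.+2 v x) <= G.
Hypothesis v2pi : v 0 = v (2 * pi).
Hypothesis v_vx : forall x, x \in `[0, 2 * pi] -> has_cslope 0 (2 * pi) v x (vx x).
Hypothesis vx_vxx : forall x, x \in `[0, 2 * pi] -> has_cslope 0 (2 * pi) vx x (vxx x).

Let p0 : 0 < 2 * pi :> R. Proof. by rewrite mulr_gt0 ?pi_gt0. Qed.

Let c := fourier v.

Lemma sobolev_weight_sum_le n : \sum_(k <- freqs n) sobolev_weight s c k <= G.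
Proof.
apply: le_trans vG; apply: sobolev_fourier_le; first by case: vs.
exact: pderivP vs (leqnn _).
Qed.

Let G0 : 0 <= G.
Proof. by have := sobolev_weight_sum_le 0; rewrite big_freqs0. Qed.

Let sum_freqs_le (b : int -> R) n : (forall k, b k <= sobolev_weight s c k) ->
  \sum_(k <- freqs n) b k <= G.
Proof. by move=> bk; apply: le_trans (sobolev_weight_sum_le n); apply: ler_sum. Qed.

Let weight2 k : k%:~R ^+ 2 * nsq (fderiv c k) <= sobolev_weight s c k.
Proof.
rewrite nsq_fderiv (_ : _ * _ = (k%:~R ^+ 2) ^+ 2 * nsq (c k)); last by ring.
rewrite /sobolev_weight; apply: ler_wpM2r => //.
by apply: intr_sqr_pow_le.
Qed.

(** Differentiating twice and still summing absolutely takes six powers of k, hence s >= 1. *)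
Let weight3 k : k%:~R ^+ 2 * nsq (fderiv (fderiv c) k) <= sobolev_weight s c k.
Proof.
rewrite !nsq_fderiv (_ : _ * _ = (k%:~R ^+ 2) ^+ 3 * nsq (c k)); last by ring.
rewrite /sobolev_weight; apply: ler_wpM2r => //.
by apply: intr_sqr_pow_le.
Qed.

(** The existence of [vxx] makes [vx] continuous on the closed period, hence bounded. *)
Lemma slope_clipschitz : exists M, clipschitz M v.
Proof.
have [M1 h1] := within_bounded (has_slope_within (fun x xD => (vx_vxx xD).1)).
have [M2 h2] := within_bounded (has_slope_within (fun x xD => (vx_vxx xD).2)).
exists (Num.max M1 M2) => x y xD yD; split.
  apply: (slope_lipschitz (fun x xD => (v_vx xD).1)) => // z zD.
  by rewrite le_max h1.
apply: (slope_lipschitz (fun x xD => (v_vx xD).2)) => // z zD.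
by rewrite le_max h2// orbT.
Qed.

Lemma fourier_series_cvg x : x \in `[0, 2 * pi] -> ccvg (fun n => trig_sum n c x) (v x).
Proof.
by move=> xD; have [M vM] := slope_clipschitz; exact: (fourier_clipschitz_cvg vM v2pi xD).
Qed.

Lemma fourier_series_derive_cvg x : x \in `[0, 2 * pi] ->
  ccvg (fun n => trig_sum n (fderiv c) x) (vx x).
Proof.
move=> xD; apply: (@ccvg_inv_bound _ _ G) => n n0.
apply: nsq_derive_trig_remainder xD n0 G0 _ fourier_series_cvg (v_vx xD) => // m.
by apply: sum_freqs_le => k; exact: weight2.
Qed.

Lemma fourier_series_derive2_cvg x : x \in `[0, 2 * pi] ->
  ccvg (fun n => trig_sum n (fderiv (fderiv c)) x) (vxx x).
Proof.
move=> xD; apply: (@ccvg_inv_bound _ _ G) => n n0.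
apply: nsq_derive_trig_remainder xD n0 G0 _ fourier_series_derive_cvg (vx_vxx xD) => // m.
by apply: sum_freqs_le => k; exact: weight3.
Qed.

Lemma nsq_slope_le x : x \in `[0, 2 * pi] -> nsq (vx x) <= 5 * G.
Proof.
move=> xD; apply: nsq_trig_lim_le (fourier_series_derive_cvg xD).
  by rewrite /fderiv mulr0z -[0 +i* 0]/(0%:C) mul0r.
by move=> m; apply: sum_freqs_le => k; exact: weight2.
Qed.

(** Outside the band |k| >= N, so that k^2 <= N^(-2 s) k^(2 (s + 2)); the additional factor 1 / N of
    [nsq_trig_remainder] is given up. *)
Lemma nsq_fourier_remainder_le N x : (0 < N)%N -> x \in `[0, 2 * pi] ->
  nsq (v x - trig_sum N c x) <= 4 * ((N%:R ^+ 2) ^+ s)^-1 * G.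
Proof.
move=> N0 xD.
have P0 : 0 < (N%:R ^+ 2 : R) ^+ s by rewrite !exprn_gt0 ?ltr0n.
have Q0 : 0 <= ((N%:R ^+ 2) ^+ s)^-1 * G by rewrite mulr_ge0// invr_ge0 ltW.
apply: (@le_trans _ _ (4 / N%:R * (((N%:R ^+ 2) ^+ s)^-1 * G))).
  apply: nsq_trig_remainder (fourier_series_cvg xD) => // m.
  rewrite ler_pdivlMl// mulr_sumr.
  have mN : \sum_(k <- tail_freqs N m) sobolev_weight s c k <= G.
    have [Nm|mN] := leqP N m; last by rewrite big_tail_freqs big_geq// ltnW.
    apply: le_trans (sobolev_weight_sum_le m); rewrite (big_freqs_cat _ Nm) lerDr.
    by apply: sumr_ge0 => k _; exact: sobolev_weight_ge0.
  apply: le_trans mN; rewrite big_seq [leRHS]big_seq; apply: ler_sum => k kN.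
  rewrite mulrA /sobolev_weight; apply: ler_wpM2r => //.
  have Nk : (N%:R : R) ^+ 2 <= k%:~R ^+ 2.
    rewrite -[leRHS]real_normK ?num_real//; apply: lerXn2r; rewrite ?nnegrE//.
    by rewrite -intr_norm -[N%:R]/(N%:Z%:~R) ler_int; have := mem_tail_freqs kN; lia.
  apply: (@le_trans _ _ ((k%:~R ^+ 2) ^+ s * k%:~R ^+ 2)).
    apply: ler_wpM2r; first exact: sqr_ge0.
    by apply: lerXn2r => //; rewrite nnegrE sqr_ge0.
  by rewrite -exprSr; apply: intr_sqr_pow_le.
rewrite -[leRHS]mulrA; apply: ler_wpM2r => //.
by rewrite ler_pdivrMr ?ltr0n// ler_peMr// ler1n.
Qed.

End Regular.

End FixedTime.

(** * Gronwall bootstrap *)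

Section Bootstrap.
Context {R : realType}.

(** The differential inequality is only available while y < eta. Up to the infimum r of the times
    where y >= eta, Gronwall's estimate holds, including at r itself, where it gives y r < eta; by
    continuity y remains below eta just after r, which contradicts the choice of r. *)
Lemma gronwall_bootstrap (T L g eta : R) (y y' : R -> R) :
  0 < T -> 0 <= L -> 0 <= g -> y 0 = 0 ->
  (forall t, t \in `[0, T] -> has_slope 0 T y t (y' t)) ->
  (forall t, t \in `[0, T] -> y t < eta -> y' t <= L * y t + g) ->
  g * T * expR (L * T) < eta ->
  forall t, t \in `[0, T] -> y t <= g * T * expR (L * T).
Proof.
move=> T0 L0 g0 y0 yy' yeta geta.
have bnd t : t \in `[0, T] -> (forall r, 0 <= r < t -> y r < eta) ->
    y t <= g * T * expR (L * T).
  rewrite in_itv /= => /andP[t0 tT] yr.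
  (* Integrating factor: as e^{-L r} <= 1, the derivative of z is at most e^{-L r} g - g <= 0. *)
  pose z r := expR (- L * r) * y r - g * r.
  have zd r : r \in `]0, t[ ->
      is_derive r 1 z (expR (- L * r) * (y' r - L * y r) - g).
    rewrite in_itv /= => /andP[r0 rt].
    have rT : r \in `]0, T[ by rewrite in_itv /= r0 (lt_le_trans rt tT).
    have hy := has_slope_is_derive rT (yy' r (subset_itv_oo_cc rT)).
    by apply: is_derive_eq; rewrite /GRing.scale /= !mulr1; ring.
  have zc : {within `[0, t], continuous z}.
    apply: (@continuous_subspaceW _ _ `[0, t]%classic `[0, T]%classic z).
      by move=> r; rewrite /= !in_itv /= => /andP[-> /= rt]; exact: le_trans tT.
    apply/subspace_continuousP => r rT.
    have yc := has_slope_continuous (yy' r rT).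
    apply: cvgB; first apply: cvgM => //.
      apply: cvg_within_filter; apply: continuous_comp; last exact: continuous_expR.
      by apply: cvgMl_tmp; exact: cvg_id.
    by apply: cvg_within_filter; apply: cvgMl_tmp; exact: cvg_id.
  have z_le : z t <= z 0.
    apply: (@ler0_derive1_le_cc R z 0 t) => //; rewrite ?in_itv /= ?lexx ?t0//.
    - by move=> r rt; have := zd r rt; case.
    - move=> r rt; have h := zd r rt; rewrite derive1E derive_val.
      move: rt; rewrite in_itv /= => /andP[r0 rt].
      have rT : r \in `[0, T] by rewrite in_itv /= ltW//= (le_trans (ltW rt)).
      have := yeta r rT (yr r _); rewrite ltW//= => /(_ rt) h1.
      have e0 := expR_gt0 (- L * r).
      have e1 : expR (- L * r) <= 1 by rewrite -expR0 ler_expR mulNr oppr_le0 mulr_ge0// ltW.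
      rewrite subr_le0; apply: (@le_trans _ _ (expR (- L * r) * g)); last exact: ler_piMl.
      by apply: ler_wpM2l; [exact: ltW|lra].
  move: z_le; rewrite /z y0 !mulr0 subrr subr_le0 mulNr expRN => h.
  have {}h : y t <= g * t * expR (L * t).
    by rewrite -ler_pdivrMr ?expR_gt0// mulrC.
  apply: le_trans h _; apply: ler_pM; rewrite ?mulr_ge0 ?expR_ge0//.
    exact: ler_wpM2l.
  by rewrite ler_expR ler_wpM2l.
suff below t : t \in `[0, T] -> y t < eta.
  move=> t tT; apply: bnd => // r /andP[r0 rt]; apply: below.
  by move: tT; rewrite !in_itv /= r0 => /andP[_]; exact: le_trans (ltW rt).
move=> tT; rewrite ltNge; apply/negP => yt.
pose S : set R := fun r => r \in `[0, T] /\ eta <= y r.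
have S0 : lbound S 0 by move=> r [+ _]; rewrite in_itv /= => /andP[].
have Si : has_inf S by split; [exists t|exists 0].
pose r := inf S.
have r0 : 0 <= r by apply: lb_le_inf => //; exists t.
have rt : r <= t by apply: ge_inf => //; exists 0.
have rT : r \in `[0, T].
  by move: tT; rewrite !in_itv /= r0 => /andP[_]; exact: le_trans.
have yr : y r <= g * T * expR (L * T).
  apply: bnd => // q /andP[q0 qr]; rewrite ltNge; apply/negP => yq.
  have : r <= q.
    apply: ge_inf; first by exists 0.
    split => //; move: rT; rewrite !in_itv /= q0 => /andP[_]; exact: le_trans (ltW qr).
  by rewrite leNgt qr.
have yre := le_lt_trans yr geta.
have := has_slope_continuous (yy' r rT) => /cvgr_lt /(_ _ yre).
rewrite near_withinE => /nbhs_ballP[e /= e0 H].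
have [q [qT yq] qr] := inf_adherent e0 Si.
have rq : r <= q by apply: ge_inf => //; exists 0.
have := H q; rewrite /ball /= ler0_norm ?subr_le0// opprB ltrBlDl => /(_ qr qT).
by rewrite ltNge yq.
Qed.

End Bootstrap.

(** * The collocation error at a fixed time *)

Section BandLimited.
Context {R : realType}.

Lemma mem_tail_freqs_outside N m (j : 'I_(2 * N)) k : k \in tail_freqs N m ->
  k != j%:Z - N%:Z.
Proof.
case/flattenP => r /mapP[n]; rewrite mem_index_iota => /andP[Nn _] ->.
by have := ltn_ord j; rewrite !inE => jN /orP[]/eqP ->; apply/eqP; lia.
Qed.

(** Extension by 0 outside the band; at most one term of the sum is nonzero, which avoids converting
    [k] into an ordinal. *)
Definition extend_coef N (c : 'I_(2 * N) -> R[i]) (k : int) : R[i] :=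
  \sum_(j < 2 * N) if k == j%:Z - N%:Z then c j else 0.

Lemma extend_coef_tail N m (c : 'I_(2 * N) -> R[i]) k : k \in tail_freqs N m ->
  extend_coef c k = 0.
Proof.
by move=> kN; apply: big1 => j _; rewrite (negbTE (mem_tail_freqs_outside j kN)).
Qed.

Lemma extend_coefE N (c : 'I_(2 * N) -> R[i]) (m : 'I_(2 * N)) :
  extend_coef c (m%:Z - N%:Z) = c m.
Proof.
rewrite /extend_coef (bigD1 m)//= eqxx big1 ?addr0// => j jm.
by rewrite ifF//; apply: contraNF jm => /eqP h; apply/eqP/val_inj => /=; lia.
Qed.

Lemma trig_sum_extend_coef N (c : 'I_(2 * N) -> R[i]) x :
  trig_sum N (extend_coef c) x = \sum_(j < 2 * N) c j * expi ((j%:R - N%:R) * x).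
Proof.
rewrite /trig_sum big_freqs_ord; apply: eq_bigr => m _.
by rewrite extend_coefE intr_freq.
Qed.

Definition band_limited N (c : int -> R[i]) :=
  forall m k, k \in tail_freqs N m -> c k = 0.

Lemma band_limited_fderiv N c : band_limited N c -> band_limited N (fderiv c).
Proof. by move=> h m k kN; rewrite /fderiv (h m)// mulr0. Qed.

Lemma ccvg_band_limited N c x : band_limited N c ->
  ccvg (fun n => trig_sum n c x) (trig_sum N c x).
Proof.
move=> h; apply: (@ccvg_eventually_cst _ _ _ N) => n Nn.
rewrite (trig_sum_cat _ _ Nn) big_seq big1 ?addr0// => k kN.
by rewrite (h n)// mul0r.
Qed.

Lemma trig_sumB n (c d : int -> R[i]) x :
  trig_sum n (fun k => c k - d k) x = trig_sum n c x - trig_sum n d x.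
Proof. by rewrite /trig_sum -sumrB; apply: eq_bigr => k _; rewrite mulrBl. Qed.

Lemma fderivB (c d : int -> R[i]) :
  fderiv (fun k => c k - d k) = fun k => fderiv c k - fderiv d k.
Proof. by apply/funext => k; rewrite /fderiv mulrBr. Qed.

End BandLimited.

Section Consistency.
Context {R : realType}.
Notation mu := (@lebesgue_measure R).
Notation D := (@period R).

Variables (N s : nat) (A B G : R).
Variables (v vx vxx w wx wxx : R -> R[i]) (cN : 'I_(2 * N) -> R[i]).
Hypotheses (N0 : (0 < N)%N) (s1 : (1 <= s)%N) (A0 : 0 < A).
Hypothesis vs : inHp s.+2 v.
Hypothesis vG : \int[mu]_(x in D) nsq (pderiv s.+2 v x) <= G.
Hypothesis v2pi : v 0 = v (2 * pi).
Hypothesis v_vx : forall x, x \in `[0, 2 * pi] -> has_cslope 0 (2 * pi) v x (vx x).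
Hypothesis vx_vxx : forall x, x \in `[0, 2 * pi] -> has_cslope 0 (2 * pi) vx x (vxx x).
Hypothesis wE : forall x, x \in `[0, 2 * pi] ->
  w x = \sum_(j < 2 * N) cN j * expi ((j%:R - N%:R) * x).
Hypothesis w_wx : forall x, x \in `[0, 2 * pi] -> has_cslope 0 (2 * pi) w x (wx x).
Hypothesis wx_wxx : forall x, x \in `[0, 2 * pi] -> has_cslope 0 (2 * pi) wx x (wxx x).

Let p0 : 0 < 2 * pi :> R. Proof. by rewrite mulr_gt0 ?pi_gt0. Qed.

Let e := extend_coef cN.
Let c := fourier v.
Let d k := e k - c k.
Let f (j : 'I_(2 * N)) := w (node j) - v (node j).
Let eps : R := ((N%:R ^+ 2) ^+ s)^-1.

Let eN : band_limited N e.
Proof. by move=> m k; exact: extend_coef_tail. Qed.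

Let wE0 x : x \in `[0, 2 * pi] -> w x = trig_sum N e x.
Proof. by move=> xD; rewrite wE// trig_sum_extend_coef. Qed.

(** [wx] is known only as a slope of [w]; uniqueness of slopes identifies it with the termwise
    derivative. *)
Let wxE x : x \in `[0, 2 * pi] -> wx x = trig_sum N (fderiv e) x.
Proof.
move=> xD; apply: (has_cslope_uniq p0 xD (w_wx xD)).
apply: (@has_cslope_eq _ _ _ _ _ (trig_sum N e)) => //.
  by move=> y yD; rewrite wE0.
exact: has_cslope_trig_sum.
Qed.

Let wxxE x : x \in `[0, 2 * pi] -> wxx x = trig_sum N (fderiv (fderiv e)) x.
Proof.
move=> xD; apply: (has_cslope_uniq p0 xD (wx_wxx xD)).
apply: (@has_cslope_eq _ _ _ _ _ (trig_sum N (fderiv e))) => //.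
  by move=> y yD; rewrite wxE.
exact: has_cslope_trig_sum.
Qed.

(** Outside the band [d] is [- c]: the tail of the error inherits the regularity of [v], whatever
    [w] is. *)
Let dG m : \sum_(k <- tail_freqs N m) sobolev_weight s d k <= G.
Proof.
have G0 : 0 <= G by have := sobolev_weight_sum_le vs vG 0; rewrite big_freqs0.
have [Nm|mN] := leqP N m; last by rewrite big_tail_freqs big_geq// ltnW.
apply: le_trans (sobolev_weight_sum_le vs vG m); rewrite (big_freqs_cat _ Nm).
rewrite [X in X <= _](_ : _ = \sum_(k <- tail_freqs N m) sobolev_weight s c k).
  by rewrite lerDr; apply: sumr_ge0 => k _; exact: sobolev_weight_ge0.
rewrite big_seq [RHS]big_seq; apply: eq_bigr => k kN.
by rewrite /sobolev_weight /d (eN kN) sub0r nsqN.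
Qed.

Let node_period (j : 'I_(2 * N)) : (node j : R) \in `[0, 2 * pi] := node_bounds N0 j.

Let d_cvg x : x \in `[0, 2 * pi] -> ccvg (fun n => trig_sum n d x) (w x - v x).
Proof.
move=> xD; rewrite wE0//; under eq_fun do rewrite trig_sumB.
apply: ccvgD; first exact: ccvg_band_limited.
apply: ccvgN; exact: (fourier_series_cvg v2pi v_vx vx_vxx xD).
Qed.

Let dx_cvg x : x \in `[0, 2 * pi] -> ccvg (fun n => trig_sum n (fderiv d) x) (wx x - vx x).
Proof.
move=> xD; rewrite wxE//; under eq_fun do rewrite /d fderivB trig_sumB.
apply: ccvgD; first by apply: ccvg_band_limited; exact: band_limited_fderiv.
apply: ccvgN; exact: (fourier_series_derive_cvg vs vG v2pi v_vx vx_vxx xD).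
Qed.

Let dxx_cvg x : x \in `[0, 2 * pi] ->
  ccvg (fun n => trig_sum n (fderiv (fderiv d)) x) (wxx x - vxx x).
Proof.
move=> xD; rewrite wxxE//; under eq_fun do rewrite /d !fderivB trig_sumB.
apply: ccvgD; first by apply: ccvg_band_limited; do 2 apply: band_limited_fderiv.
apply: ccvgN; exact: (fourier_series_derive2_cvg s1 vs vG v2pi v_vx vx_vxx xD).
Qed.

Lemma collocation_energy : (forall j, nsq (f j) < 64^-1) ->
  \sum_(j < 2 * N) Re ((A%:C * (wxx (node j) - vxx (node j)) +
      B%:C * (wx (node j) - vx (node j)) +
      A%:C * (wx (node j) ^+ 2 - vx (node j) ^+ 2)) * conjc (f j)) <=
  (20 * G * A + A / 2 + `|B| / 2) * \sum_(j < 2 * N) nsq (f j) +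
  (2 * N)%:R * ((20 * (3 / 4 * A + `|B| / 2) + 5 * A / 2) * eps * G).
Proof.
move=> f64.
(* With z = w_x - v_x, one has w_x^2 - v_x^2 = z^2 + 2 v_x z; the bound 5 G on |v_x|^2 is
   [nsq_slope_le]. *)
have := @energy_lim R N s d G f N0 s1 dG (fun j => d_cvg (node_period j)) A B (5 * G)
  (fun j => wx (node j) - vx (node j)) (fun j => wxx (node j) - vxx (node j))
  (fun j => vx (node j)) A0 (fun j => dx_cvg (node_period j))
  (fun j => dxx_cvg (node_period j)) f64
  (fun j => nsq_slope_le vs vG v2pi v_vx vx_vxx (node_period j)).
rewrite (_ : 4 * (5 * G) * A = 20 * G * A); last by ring.
apply: le_trans; rewrite le_eqVlt; apply/orP; left; apply/eqP.
by apply: eq_bigr => j _; congr (Re (_ * _)); ring.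
Qed.

(** The error v - w is the truncation remainder of v minus the sum of [d] over the band. By
    [low_freqs_lim] the latter has squared norm at most 2 pi (2 H + 10 G) eps, the former at most 2
    pi * 4 G eps; doubling both gives 4 H + 28 G. *)
Lemma collocation_L2_error (H : R) :
  \sum_(j < 2 * N) nsq (f j) <= (2 * N)%:R * (H * eps) ->
  (L2norm (fun x => v x - w x)%R <=
    (Num.sqrt (2 * pi * (4 * H + 28 * G)) / N%:R ^+ s)%:E)%E.
Proof.
move=> fH.
have NN : 0 < (2 * N)%:R :> R by rewrite ltr0n muln_gt0.
have G0 : 0 <= G by have := sobolev_weight_sum_le vs vG 0; rewrite big_freqs0.
have low : \sum_(k <- freqs N) nsq (d k) <= 2 * (H * eps) + 10 * eps * G.
  have := low_freqs_lim N0 s1 dG (fun j => d_cvg (node_period j)).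
  rewrite -/eps => h; rewrite -(ler_pM2l NN); apply: le_trans h _.
  rewrite mulrDr lerD2r [leRHS]mulrCA; exact: ler_wpM2l.
pose r x := v x - trig_sum N c x.
have [M vM] := slope_clipschitz v_vx vx_vxx.
have rm : cmeasurable r.
  by apply: cmeasurableB; [exact: clipschitz_cmeasurable vM|exact: cmeasurable_trig_sum].
have rle x : x \in `[0, 2 * pi] -> nsq (r x) <= 4 * eps * G.
  by move=> xD; exact: (nsq_fourier_remainder_le s1 vs vG v2pi v_vx vx_vxx N0 xD).
have rI := bounded_square_integrable rm rle.
have TI := square_integrableN (square_integrable_trig_sum N d).
have FI := square_integrableD TI rI.
rewrite (_ : L2norm _ = L2norm (fun x => - trig_sum N d x + r x)); last first.
  rewrite /L2norm; congr (poweR _ _); apply: eq_integral => x /[!inE] xD.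
  have -> : v x - w x = - trig_sum N d x + r x; last by [].
  by rewrite /d trig_sumB /r -wE0//; ring.
rewrite L2normE// lee_fin.
have := Rintegral_nsqD_le TI rI; have := Rintegral_nsq_le rm rle.
have -> : \int[mu]_(x in D) nsq (- trig_sum N d x) = 2 * pi * \sum_(k <- freqs N) nsq (d k).
  by under eq_Rintegral do rewrite nsqN; exact: Parseval_trig_sum.
move: (\int[mu]_(x in D) nsq (r x)) (\int[mu]_(x in D) nsq (_ + r x)) low.
move: (\sum_(k <- freqs N) nsq (d k)) => S I1 I2 low h1 h2.
have I2le : I2 <= 2 * pi * (4 * H + 28 * G) * eps.
  have := ler_wpM2l (ltW p0) low; move: (2 * pi) h1 h2 => p h1 h2 h3; lra.
have eps0 : 0 < eps by rewrite invr_gt0 !exprn_gt0// ltr0n.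
have epsE : eps = (N%:R ^+ s) ^- 2 by rewrite /eps -!exprM mulnC.
apply: le_trans (ler_wsqrtr I2le) _.
have [C0|C0] := leP 0 (2 * pi * (4 * H + 28 * G)).
  rewrite sqrtrM// epsE sqrtrV ?sqr_ge0// sqrtr_sqr ger0_norm// exprn_ge0//.
rewrite ler0_sqrtr; last by rewrite mulr_le0_ge0 ?ltW.
by rewrite divr_ge0 ?sqrtr_ge0// exprn_ge0.
Qed.

End Consistency.

(** * Choice of the constants and conclusion *)

Lemma diffusion_coef_gt0 (R : realType) (sigma xmin xmax : R) : 0 < sigma -> xmin < xmax ->
  0 < diffusion_coef sigma xmin xmax.
Proof.
move=> s0 xx; have k0 : 0 < kappa xmin xmax.
  by rewrite /kappa divr_gt0 ?mulr_gt0 ?pi_gt0//; lra.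
by rewrite /diffusion_coef mulr_gt0 ?exprn_gt0// divr_gt0// exprn_gt0.
Qed.

Theorem theorem4p2 (R : realType) (alpha sigma xmin xmax T : R) (s : nat)
    (sigma_gt0 : 0 < sigma) (xmin_lt_xmax : xmin < xmax)
    (T_gt0 : 0 < T) (s_ge1 : (1 <= s)%N) :
  let A := diffusion_coef sigma xmin xmax in
  let B := drift_coef alpha sigma xmin xmax in
  let C := diffusion_coef sigma xmin xmax in
  exists M : R -> R,
  forall (u0 : R -> R[i]) (u ut ux uxx : R -> R -> R[i]),
    is_solution A B C T u0 u ut ux uxx ->
    inHp s.+2 u0 ->
    continuous_Hp T s.+2 u ->
    continuous_Hp T s ut ->
    exists N0 : nat,
    forall N : nat, (1 <= N)%N -> (N0 <= N)%N ->
    forall uN uNt uNx uNxx : R -> R -> R[i],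
      is_collocation A B C T u0 N uN uNt uNx uNxx ->
      (max_error T u uN
         <= (M (fine (max_regularity T s u ut)) / N%:R ^+ s)%:E)%E.
Proof.
move=> A B C.
have A0 : 0 < A := diffusion_coef_gt0 sigma_gt0 xmin_lt_xmax.
(* [Lam] and [Gam] are the constants of [collocation_energy] for G = K^2. [H] is the resulting
   Gronwall bound on the sum of the squared nodal errors, divided by 2 N eps; its factors 2 come
   from differentiating a square. *)
pose Lam (K : R) := 20 * K ^+ 2 * A + A / 2 + `|B| / 2.
pose Gam := 20 * (3 / 4 * A + `|B| / 2) + 5 * A / 2.
pose H (K : R) := 2 * (Gam * K ^+ 2) * T * expR (2 * Lam K * T).
exists (fun K => Num.sqrt (2 * pi * (4 * H K + 28 * K ^+ 2))).
move=> u0 u ut ux uxx [sd td pde per init] _ uc utc.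
have := max_regularity_bound uc utc; set K := fine (max_regularity T s u ut) => regK.
have B0 := normr_ge0 B; have K20 := sqr_ge0 K.
have KA : 0 <= K ^+ 2 * A by rewrite mulr_ge0// ltW.
have Lam0 : 0 <= Lam K by rewrite /Lam; lra.
have Gam0 : 0 <= Gam by rewrite /Gam; lra.
have GK0 : 0 <= Gam * K ^+ 2 by exact: mulr_ge0.
have H0 : 0 <= H K.
  by apply: mulr_ge0 (expR_ge0 _); apply: mulr_ge0 (ltW T_gt0); exact: mulr_ge0.
(* Since s >= 1, eps <= N^-2 and 2 N H eps <= 2 H / N, which is below the threshold 1/64 as soon as
   N > 128 H. *)
exists (Num.truncn (128 * H K)).+1 => N N1 N0N uN uNt uNx uNxx [SN sdN tdN pdeN initN].
pose eps : R := ((N%:R ^+ 2) ^+ s)^-1.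
have NR : 0 < (N%:R : R) by rewrite ltr0n.
have eps0 : 0 < eps by rewrite invr_gt0 !exprn_gt0.
have zT : 0 \in `[0, T] by rewrite in_itv /= lexx ltW.
have nodeD (j : 'I_(2 * N)) : (node j : R) \in `[0, 2 * pi] := node_bounds N1 j.
pose y (t : R) : R := \sum_(j < 2 * N) nsq (uN t (node j) - u t (node j)).
pose y' (t : R) : R := \sum_(j < 2 * N)
  2 * Re ((uNt t (node j) - ut t (node j)) * conjc (uN t (node j) - u t (node j))).
have yH : forall t, t \in `[0, T] -> y t <= (2 * N)%:R * (H K * eps).
  have -> : (2 * N)%:R * (H K * eps) =
      ((2 * N)%:R * (2 * (Gam * eps * K ^+ 2))) * T * expR (2 * Lam K * T).
    by rewrite /H; ring.
  apply: (@gronwall_bootstrap R T (2 * Lam K) _ 64^-1 y y') => //.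
  - by rewrite mulr_ge0.
  - apply: mulr_ge0 => //; apply: mulr_ge0 => //; rewrite mulrAC.
    exact: mulr_ge0 (ltW eps0).
  - rewrite /y big1// => j _.
    by rewrite initN init// subrr nsq0.
  - move=> t tT; apply: has_slope_sum => j; apply: has_cslope_nsq.
    apply: has_cslopeD; first exact/is_derive_on_cslope/tdN.
    exact/has_cslopeN/is_derive_on_cslope/td.
  - move=> t tT yt.
    (* A single nodal value is bounded by the whole unnormalized sum: this is where N^(1/2) is lost
       with respect to the L^2 norm. *)
    have f64 (j : 'I_(2 * N)) : nsq (uN t (node j) - u t (node j)) < 64^-1.
      by apply: le_lt_trans yt; rewrite /y (bigD1 j)//= lerDl; exact: sumr_ge0.
    have [c cE] := SN t tT.
    have := @collocation_energy R N s A B (K ^+ 2) (u t) (ux t) (uxx t)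
      (uN t) (uNx t) (uNxx t) c N1 s_ge1 A0 (uc.1 t tT) (regK t tT) (per t tT).1
      (fun x xD => is_derive_on_cslope (sd t x tT xD).1)
      (fun x xD => is_derive_on_cslope (sd t x tT xD).2) cE
      (fun x xD => is_derive_on_cslope (sdN t x tT xD).1)
      (fun x xD => is_derive_on_cslope (sdN t x tT xD).2) f64.
    (* Both equations hold exactly at the nodes, so that their difference has no residual, and C = A
       puts the quadratic term under the control of diffusion. *)
    have -> : y' t = 2 * \sum_(j < 2 * N) Re ((A%:C * (uNxx t (node j) - uxx t (node j)) +
        B%:C * (uNx t (node j) - ux t (node j)) +
        A%:C * (uNx t (node j) ^+ 2 - ux t (node j) ^+ 2)) *
        conjc (uN t (node j) - u t (node j))).
      rewrite /y' mulr_sumr; apply: eq_bigr => j _; congr (_ * Re (_ * _)).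
      by rewrite (pdeN t j tT) (pde t _ tT (nodeD j)) /C -/A; ring.
    rewrite -/(y t) -/Gam -/eps => h.
    have aux (X Y Z L : R) : X <= L * Y + Z -> 2 * X <= 2 * L * Y + 2 * Z by lra.
    by apply: le_trans (aux _ _ _ _ h) _; rewrite lerD2l (mulrCA 2 (2 * N)%:R).
  - rewrite (_ : _ * expR _ = 2 * H K * (N%:R * eps)); last by rewrite /H natrM; ring.
    have epsN : N%:R * eps <= N%:R^-1.
      rewrite /eps -ler_pdivlMl// -invfM -expr2 lef_pV2 ?posrE ?exprn_gt0//.
      by rewrite -[leLHS]expr1 ler_weXn2l// exprn_ege1// ler1n.
    apply: le_lt_trans (ler_wpM2l (mulr_ge0 _ H0) epsN) _ => //.
    rewrite ltr_pdivrMr// -ltr_pdivrMl ?invr_gt0// invrK.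
    have HN : 128 * H K < N%:R.
      by apply: lt_le_trans (truncnS_gt _) _; rewrite ler_nat.
    by apply: le_lt_trans HN; rewrite mulrA -natrM.
apply: ge_ereal_sup => _ [t tT <-].
have [c cE] := SN t tT.
exact: (@collocation_L2_error R N s (K ^+ 2) (u t) (ux t) (uxx t)
  (uN t) c N1 s_ge1 (uc.1 t tT) (regK t tT) (per t tT).1
  (fun x xD => is_derive_on_cslope (sd t x tT xD).1)
  (fun x xD => is_derive_on_cslope (sd t x tT xD).2) cE (H K) (yH t tT)).
Qed.
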